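(* Let $0<\kappa\le4$, $\alpha=8/\kappa$, and define $P_{fusion}(z)=\lim_{\xi\downarrow0}P(z,\xi)$ for $z=x+iy\in\mathbb{H}$, where $P(z,\xi)$ is the function defined in the context. Then $$P_{fusion}(z)=\frac{\Gamma(\frac\alpha2)\Gamma(\alpha)}{2^{2-\alpha}\pi\,\Gamma(\frac{3\alpha}2-1)}\int_{\frac xy}^\infty S(t')\,dt',$$ where the real-valued function $S(t)$ is defined by $$S(t)=(1+t^2)^{1-\alpha}\left\{{}_2F_1\left(\tfrac12+\tfrac\alpha2,1-\tfrac\alpha2,\tfrac12;-t^2\right)-\frac{2\Gamma(1+\frac\alpha2)\Gamma(\frac\alpha2)\,t}{\Gamma(\frac12+\frac\alpha2)\Gamma(-\frac12+\frac\alpha2)}\,{}_2F_1\left(1+\tfrac\alpha2,\tfrac32-\tfrac\alpha2,\tfrac32;-t^2\right)\right\},\quad t\in\mathbb{R}.$$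
   Context: ${}_2F_1(a,b,c;w)$ is the (principal branch of the) Gauss hypergeometric function. For $z=x+iy\in\mathbb{H}$ and $\xi>0$, $$P(z,\xi)=\frac1{c_\alpha}\int_x^\infty\mathrm{Re}\,\mathcal{M}(x'+iy,\xi)\,dx',\qquad c_\alpha=-\frac{2\pi^{3/2}\,\Gamma\left(\frac{\alpha-1}{2}\right)\Gamma\left(\frac{3\alpha}{2}-1\right)}{\Gamma\left(\frac{\alpha}{2}\right)^2\Gamma(\alpha)},$$ $$\mathcal{M}(z,\xi)=y^{\alpha-2}z^{-\frac{\alpha}{2}}(z-\xi)^{-\frac{\alpha}{2}}\bar z^{\,1-\frac{\alpha}{2}}(\bar z-\xi)^{1-\frac{\alpha}{2}}\int_{\bar z}^{z}(u-z)^{\alpha}(u-\bar z)^{\alpha-2}u^{-\frac{\alpha}{2}}(u-\xi)^{-\frac{\alpha}{2}}\,du,$$ with principal branches of all complex powers and with the contour from $\bar z$ to $z$ passing to the right of $\xi$: it crosses the real line in $(\xi,\infty)$ and avoids the branch cuts of the integrand (e.g. the polygonal path $\bar z\to s\to z$ with real $s>\xi$, $s\ge\mathrm{Re}\,z$). *)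

(* Defs.v *)
From Stdlib Require Import Reals Factorial.
From Coquelicot Require Import Coquelicot.

Open Scope R_scope.

(* Euler's integral; it converges, and is used, only for 0 < s. *)
Definition Gamma (s : R) : R :=
  RInt_gen (fun t => Rpower t (s - 1) * exp (- t))
    (at_right 0) (Rbar_locally p_infty).

(* Principal argument, with values in (-PI, PI]; not meaningful at 0. *)
Definition Carg (z : C) : R :=
  if Rlt_dec (Im z) 0
  then - acos (Re z / Cmod z)
  else acos (Re z / Cmod z).

Definition Clog (z : C) : C := (ln (Cmod z), Carg z).

Definition Cexp (z : C) : C := (exp (Re z) * cos (Im z), exp (Re z) * sin (Im z)).

(* Principal branch of z ^ a, with 0 ^ 0 = 1 and 0 ^ a = 0 for a <> 0. *)
Definition Cpower (z : C) (a : R) : C :=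
  if Ceq_dec z 0
  then (if Req_EM_T a 0 then 1 else 0)%C
  else Cexp (a * Clog z)%C.

Fixpoint pochhammer (a : R) (n : nat) : R :=
  match n with
  | O => 1
  | S m => pochhammer a m * (a + INR m)
  end.

Definition gauss_coef (a b c : R) (n : nat) : C :=
  RtoC (pochhammer a n * pochhammer b n / (pochhammer c n * INR (fact n))).

Definition is_Cpseries (u : nat -> C) (h l : C) : Prop :=
  is_pseries (K := C_AbsRing) (V := C_NormedModule) u h l.

Definition analytic_at (F : C -> C) (w : C) : Prop :=
  exists (u : nat -> C) (r : R), 0 < r /\
    forall h : C, Cmod h < r -> is_Cpseries u h (F (w + h)%C).

(* The plane cut along [1, +oo), on which the principal branch of 2F1 lives. *)
Definition slit_plane (w : C) : Prop := ~ (Im w = 0 /\ 1 <= Re w).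

(* [v] is the value at [w] of the analytic continuation of Gauss's series from
   the unit disc to a neighbourhood, star-shaped about 0, of the segment [0, w]
   in the slit plane.  As the slit plane is itself star-shaped about 0, the
   identity theorem makes this the value of the principal branch at [w]. *)
Definition is_hyp2F1 (a b c : R) (w v : C) : Prop :=
  exists (U : C -> Prop) (F : C -> C),
    open U /\
    (forall w', U w' -> slit_plane w') /\
    (forall (w' : C) (r : R), U w' -> 0 <= r <= 1 -> U (r * w')%C) /\
    (forall w', U w' -> analytic_at F w') /\
    (forall w', U w' -> Cmod w' < 1 -> is_Cpseries (gauss_coef a b c) w' (F w')) /\
    U w /\ F w = v.

Definition hyp2F1 (a b c : R) (w : C) : C :=
  iota (T := C_CompleteNormedModule) (is_hyp2F1 a b c w).

Definition Cint_segment (f : C -> C) (p q : C) : C :=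
  RInt (V := C_R_CompleteNormedModule)
    (fun t => (f (p + t * (q - p)) * (q - p))%C) 0 1.

(* The contour is the polygonal path from conj z through the real point s to z. *)
Definition M (alpha s : R) (z : C) (xi : R) : C :=
  let f (u : C) : C :=
    (Cpower (u - z) alpha * Cpower (u - Cconj z) (alpha - 2)
     * Cpower u (- alpha / 2) * Cpower (u - xi) (- alpha / 2))%C in
  (Rpower (Im z) (alpha - 2)
   * Cpower z (- alpha / 2) * Cpower (z - xi) (- alpha / 2)
   * Cpower (Cconj z) (1 - alpha / 2) * Cpower (Cconj z - xi) (1 - alpha / 2)
   * (Cint_segment f (Cconj z) s + Cint_segment f s z))%C.

Definition c_const (alpha : R) : R :=
  - (2 * Rpower PI (3 / 2) * Gamma ((alpha - 1) / 2) * Gamma (3 * alpha / 2 - 1)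
     / ((Gamma (alpha / 2)) ^ 2 * Gamma alpha)).

(* [s z xi] is a point where the contour used in M(z, xi) may cross the real line.
   By Cauchy's theorem M does not depend on which such point is chosen. *)
Definition right_crossing (s : C -> R -> R) : Prop :=
  forall (z : C) (xi : R), 0 < Im z -> 0 < xi -> xi < s z xi /\ Re z <= s z xi.

Definition P (alpha : R) (s : C -> R -> R) (z : C) (xi : R) : R :=
  / c_const alpha *
  RInt_gen (fun x' => let z' : C := (x', Im z) in Re (M alpha (s z' xi) z' xi))
    (at_point (Re z)) (Rbar_locally p_infty).

Definition S_fun (alpha t : R) : C :=
  (Rpower (1 + t ^ 2) (1 - alpha)
   * (hyp2F1 (1 / 2 + alpha / 2) (1 - alpha / 2) (1 / 2) (- t ^ 2)%R
      - (2 * Gamma (1 + alpha / 2) * Gamma (alpha / 2) * t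
         / (Gamma (1 / 2 + alpha / 2) * Gamma (- (1 / 2) + alpha / 2)))%R
        * hyp2F1 (1 + alpha / 2) (3 / 2 - alpha / 2) (3 / 2) (- t ^ 2)%R))%C.

(* Main.v *)
Require Import Defs.
From Stdlib Require Import ZArith Factorial Reals Lra Lia Psatz ClassicalEpsilon FunctionalExtensionality.
From Coquelicot Require Import Coquelicot.

Open Scope R_scope.

(* By Cauchy's theorem the contour in [M] may be replaced by the arc of the circle [|u| = |z|] through
   [z] and its conjugate.  There the integrand stays regular as [xi] tends to 0, dominated convergence
   applies, and at [xi = 0] the phase of the integrand is constant: with [z = |z| e^(i h)] and [t = x / y = cot h],

     Re M(z, 0) = - (1 / y) (1 + t^2)^(- alpha) K(t),
     K = 2^alpha (sin h)^(- alpha) int_0^h (cos v - cos h)^(alpha - 2) (1 - cos v cos h) dv.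

   Integration by parts gives [(1 + t^2) K'' = alpha (alpha - 1) K].  The hypergeometric equation says
   that [1 + t^2] times each of the two terms in [S] solves the same equation, so that
   [S(t) = (1 + t^2)^(- alpha) K(t) / K(0)] as soon as the values at 0 agree.  These values are Wallis
   integrals, which are quotients of Gamma values because both sides satisfy the same two-step
   recurrence and have the same asymptotics.

   The principal branch of 2F1 is realised on [Re w < 1 / 2] by Pfaff's formula
   [(1 - w)^(- a) 2F1(a, c - b, c; w / (w - 1))], which is analytic by Cauchy's integral formula and
   agrees with Gauss's series by uniqueness for the differential equation on a real segment and the
   identity theorem. *)

(** * Complex differentiability along curves *)

(** The condition [kappa <= 4] means [2 <= alpha]: the kernel then extends continuously to both ends
    of the contour, but its derivative may blow up there, so Cauchy's theorem is proved with
    holomorphy on a half-open homotopy only. Complex conjugation maps one half of the contour to the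
    other and exchanges the exponents [alpha] and [alpha - 2]; the pieces of real axis between
    [Cmod z] and the crossing point then cancel, which is why that point disappears. Alone, the
    limit integral satisfies no first-order equation in [h]; with a companion it forms a linear
    system of size two, for which powers of [sin h] are integrating factors. The hypergeometric
    equation is singular at the origin in [w]. With [w = - t^2] its two local solutions become the
    even and the odd solution of one equation that is regular on the whole real line. Hence one
    uniqueness lemma serves twice: to identify Gauss's series with Pfaff's form, and to identify [S]
    with the limit of the integrand. *)

Definition is_Cderive (g : R -> C) (t : R) (d : C) : Prop :=
  is_derive (fun s => Re (g s)) t (Re d) /\ is_derive (fun s => Im (g s)) t (Im d).

(* Hadamard form of complex differentiability: it composes with curves by definition. *)
Definition is_holo (f : C -> C) (w d : C) : Prop :=
  forall g t d', g t = w -> is_Cderive g t d' -> is_Cderive (fun s => f (g s)) t (d * d')%C.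

Definition slit (w : C) : Prop := 0 < Re w \/ Im w <> 0.

Lemma is_derive_val (f : R -> R) (t d d' : R) : is_derive f t d -> d = d' -> is_derive f t d'.
Proof. now intros H <-. Qed.

Lemma C_eq (u v : C) : Re u = Re v -> Im u = Im v -> u = v.
Proof. destruct u, v; simpl; congruence. Qed.

Lemma is_Cderive_val g t d d' : is_Cderive g t d -> d = d' -> is_Cderive g t d'.
Proof. now intros H <-. Qed.

Lemma is_Cderive_ext_loc f g t d :
  locally t (fun s => f s = g s) -> is_Cderive f t d -> is_Cderive g t d.
Proof.
intros H [H1 H2]; split.
- apply is_derive_ext_loc with (2 := H1).
  apply filter_imp with (2 := H); now intros s ->.
- apply is_derive_ext_loc with (2 := H2).
  apply filter_imp with (2 := H); now intros s ->.
Qed.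

Lemma is_Cderive_const c t : is_Cderive (fun _ => c) t 0.
Proof. split; simpl.
- exact (is_derive_const (V := R_NormedModule) (Re c) t).
- exact (is_derive_const (V := R_NormedModule) (Im c) t).
Qed.

Lemma is_Cderive_RtoC f t d : is_derive f t d -> is_Cderive (fun s => RtoC (f s)) t d.
Proof. intros H; split; simpl. exact H. exact (is_derive_const (V := R_NormedModule) 0 t). Qed.

Lemma is_Cderive_plus f g t df dg : is_Cderive f t df -> is_Cderive g t dg ->
  is_Cderive (fun s => f s + g s)%C t (df + dg)%C.
Proof.
intros [H1 H2] [H3 H4]; split; simpl.
- exact (is_derive_plus _ _ _ _ _ H1 H3).
- exact (is_derive_plus _ _ _ _ _ H2 H4).
Qed.

Lemma is_Cderive_opp f t df : is_Cderive f t df -> is_Cderive (fun s => - f s)%C t (- df)%C.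
Proof.
intros [H1 H2]; split; simpl.
- exact (is_derive_opp _ _ _ H1).
- exact (is_derive_opp _ _ _ H2).
Qed.

Lemma is_Cderive_minus f g t df dg : is_Cderive f t df -> is_Cderive g t dg ->
  is_Cderive (fun s => f s - g s)%C t (df - dg)%C.
Proof. intros; apply is_Cderive_plus; auto using is_Cderive_opp. Qed.

Lemma is_Cderive_mult f g t df dg : is_Cderive f t df -> is_Cderive g t dg ->
  is_Cderive (fun s => f s * g s)%C t (df * g t + f t * dg)%C.
Proof.
intros [H1 H2] [H3 H4]; split; simpl.
- eapply is_derive_val.
  apply (is_derive_minus (V := R_NormedModule)).
  apply (is_derive_mult (fun s => Re (f s)) (fun s => Re (g s)) _ _ _ H1 H3 Rmult_comm).
  apply (is_derive_mult (fun s => Im (f s)) (fun s => Im (g s)) _ _ _ H2 H4 Rmult_comm).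
  unfold minus, plus, opp, mult; simpl; unfold Re, Im; ring.
- eapply is_derive_val.
  apply (is_derive_plus (V := R_NormedModule)).
  apply (is_derive_mult (fun s => Re (f s)) (fun s => Im (g s)) _ _ _ H1 H4 Rmult_comm).
  apply (is_derive_mult (fun s => Im (f s)) (fun s => Re (g s)) _ _ _ H2 H3 Rmult_comm).
  unfold minus, plus, opp, mult; simpl; unfold Re, Im; ring.
Qed.

Lemma is_Cderive_continuous f t d : is_Cderive f t d ->
  continuous (fun s => Re (f s)) t /\ continuous (fun s => Im (f s)) t.
Proof.
intros [H1 H2]; split; apply (ex_derive_continuous (K := R_AbsRing) (V := R_NormedModule)); eexists; eauto.
Qed.

Lemma is_derive_cont (f : R -> R) (t d : R) : is_derive f t d -> continuous f t.
Proof. intros H; apply (ex_derive_continuous (K := R_AbsRing) (V := R_NormedModule)); eexists; eauto. Qed.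

Lemma locally_gt {T : UniformSpace} (f : T -> R) t a : continuous f t -> a < f t -> locally t (fun s => a < f s).
Proof. intros Hc H. apply (Hc (fun y => a < y)). exact (open_gt a (f t) H). Qed.

Lemma locally_lt {T : UniformSpace} (f : T -> R) t a : continuous f t -> f t < a -> locally t (fun s => f s < a).
Proof. intros Hc H. apply (Hc (fun y => y < a)). exact (open_lt a (f t) H). Qed.

Lemma slit_neq_0 w : slit w -> w <> 0%C.
Proof. intros [H|H] E; subst w; simpl in H; lra. Qed.

Lemma Cmod_sqr (w : C) : Cmod w * Cmod w = Re w * Re w + Im w * Im w.
Proof. unfold Cmod; rewrite sqrt_sqrt; simpl; unfold Re, Im; nra. Qed.

Lemma Cmod_pos w : slit w -> 0 < Cmod w.
Proof. intros H; apply Cmod_gt_0, slit_neq_0, H. Qed.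

Lemma sqrt_1m (w : C) : w <> 0%C -> sqrt (1 - (Re w / Cmod w)²) = Rabs (Im w) / Cmod w.
Proof.
intros H; pose proof (proj1 (Cmod_gt_0 w) H) as Hp; pose proof (Cmod_sqr w) as E.
replace (1 - (Re w / Cmod w)²) with ((Im w / Cmod w)²).
- rewrite sqrt_Rsqr_abs. unfold Rdiv. rewrite Rabs_mult, Rabs_inv, (Rabs_pos_eq (Cmod w)); [easy|lra].
- unfold Rsqr. apply Rmult_eq_reg_r with (Cmod w * Cmod w); [|nra]. field_simplify; [|lra|lra].
  replace (Cmod w ^ 2) with (Cmod w * Cmod w) by ring. rewrite E; ring.
Qed.

(** [acos] is not differentiable at its ends, that is, for real [w]. The right, upper and lower
    half-planes cover the slit plane, and on each of them the argument is an [atan], which is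
    smooth. *)
Lemma Carg_right w : 0 < Re w -> Carg w = atan (Im w / Re w).
Proof.
intros H. assert (Hs : slit w) by (now left).
pose proof (Cmod_pos w Hs) as Hp.
assert (Hx : 0 < Re w / Cmod w) by (apply Rdiv_lt_0_compat; lra).
unfold Carg. rewrite (acos_atan _ Hx), sqrt_1m by (now apply slit_neq_0).
replace (Rabs (Im w) / Cmod w / (Re w / Cmod w)) with (Rabs (Im w) / Re w) by (field; lra).
destruct (Rlt_dec (Im w) 0) as [Hi|Hi].
- rewrite Rabs_left, <- atan_opp by lra. f_equal; field; lra.
- now rewrite Rabs_pos_eq by lra.
Qed.

Lemma Carg_quot_bounds w : Im w <> 0 -> -1 < Re w / Cmod w < 1.
Proof.
intros H. assert (Hs : slit w) by (now right).
pose proof (Cmod_pos w Hs) as Hp; pose proof (Cmod_sqr w) as E.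
split; apply Rmult_lt_reg_r with (Cmod w); try lra; unfold Rdiv; rewrite Rmult_assoc, Rinv_l by lra; nra.
Qed.

Lemma Carg_up w : 0 < Im w -> Carg w = PI / 2 - atan (Re w / Im w).
Proof.
intros H. assert (Hs : slit w) by (right; lra).
pose proof (Cmod_pos w Hs) as Hp.
unfold Carg. destruct (Rlt_dec (Im w) 0) as [Hi|_]; [lra|].
rewrite acos_asin, asin_atan, sqrt_1m by (try apply slit_neq_0; try assumption;
  destruct (Carg_quot_bounds w); lra).
rewrite Rabs_pos_eq by lra. do 2 f_equal; field; lra.
Qed.

Lemma Carg_down w : Im w < 0 -> Carg w = - PI / 2 - atan (Re w / Im w).
Proof.
intros H. assert (Hs : slit w) by (right; lra).
pose proof (Cmod_pos w Hs) as Hp.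
unfold Carg. destruct (Rlt_dec (Im w) 0) as [_|Hi]; [|lra].
rewrite acos_asin, asin_atan, sqrt_1m by (try apply slit_neq_0; try assumption;
  destruct (Carg_quot_bounds w); lra).
rewrite Rabs_left by lra.
replace (Re w / Cmod w / (- Im w / Cmod w)) with (- (Re w / Im w)) by (field; lra).
rewrite atan_opp; lra.
Qed.

Lemma is_derive_ln_norm (a b : R -> R) (t da db : R) : is_derive a t da -> is_derive b t db ->
  0 < a t * a t + b t * b t ->
  is_derive (fun s => ln (sqrt (a s ^ 2 + b s ^ 2))) t
    ((a t * da + b t * db) / (a t * a t + b t * b t)).
Proof.
intros H1 H2 Hp.
assert (D1 : ex_derive a t) by (eexists; exact H1).
assert (D2 : ex_derive b t) by (eexists; exact H2).
assert (Hs : 0 < sqrt (a t * (a t * 1) + b t * (b t * 1))) by (apply sqrt_lt_R0; lra).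
assert (Es := sqrt_sqrt (a t * (a t * 1) + b t * (b t * 1))).
eapply is_derive_val.
- auto_derive. 2: reflexivity. repeat split; try assumption. lra.
- rewrite (is_derive_unique (fun x : R => a x) _ _ H1 : Derive (fun x : R => a x) t = _), (is_derive_unique (fun x : R => b x) _ _ H2 : Derive (fun x : R => b x) t = _).
  set (r := sqrt _) in *.
  transitivity ((a t * da + b t * db) / (r * r)). field; lra.
  rewrite Es by lra. field. nra.
Qed.

Lemma is_derive_atan_quot (a b : R -> R) (t da db : R) : is_derive a t da -> is_derive b t db ->
  b t <> 0 ->
  is_derive (fun s => atan (a s / b s)) t
    ((da * b t - a t * db) / (a t * a t + b t * b t)).
Proof.
intros H1 H2 Hp.
assert (D1 : ex_derive a t) by (eexists; exact H1).
assert (D2 : ex_derive b t) by (eexists; exact H2).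
eapply is_derive_val.
- auto_derive. 2: reflexivity. tauto.
- rewrite (is_derive_unique (fun x : R => a x) _ _ H1 : Derive (fun x : R => a x) t = _), (is_derive_unique (fun x : R => b x) _ _ H2 : Derive (fun x : R => b x) t = _). unfold Rsqr. field. split; nra.
Qed.

Lemma is_derive_expcos (a b : R -> R) (t da db : R) : is_derive a t da -> is_derive b t db ->
  is_derive (fun s => exp (a s) * cos (b s)) t (exp (a t) * cos (b t) * da - exp (a t) * sin (b t) * db) /\
  is_derive (fun s => exp (a s) * sin (b s)) t (exp (a t) * sin (b t) * da + exp (a t) * cos (b t) * db).
Proof.
intros H1 H2.
assert (D1 : ex_derive a t) by (eexists; exact H1).
assert (D2 : ex_derive b t) by (eexists; exact H2).
split; (eapply is_derive_val; [auto_derive; [tauto|reflexivity]|];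
  rewrite (is_derive_unique (fun x : R => a x) _ _ H1 : Derive (fun x : R => a x) t = _), (is_derive_unique (fun x : R => b x) _ _ H2 : Derive (fun x : R => b x) t = _); ring).
Qed.

Lemma is_derive_quot_norm (a b : R -> R) (t da db : R) : is_derive a t da -> is_derive b t db ->
  0 < a t * a t + b t * b t ->
  is_derive (fun s => a s / (a s ^ 2 + b s ^ 2)) t
    ((da * (b t * b t - a t * a t) - 2 * a t * b t * db) / (a t * a t + b t * b t) ^ 2).
Proof.
intros H1 H2 Hp.
assert (D1 : ex_derive a t) by (eexists; exact H1).
assert (D2 : ex_derive b t) by (eexists; exact H2).
eapply is_derive_val.
- auto_derive. 2: reflexivity. repeat split; try assumption. nra.
- rewrite (is_derive_unique (fun x : R => a x) _ _ H1 : Derive (fun x : R => a x) t = _), (is_derive_unique (fun x : R => b x) _ _ H2 : Derive (fun x : R => b x) t = _). field. nra.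
Qed.

Lemma is_derive_Rminus_const (c : R) (f : R -> R) (t d : R) : is_derive f t d -> is_derive (fun s => c - f s) t (- d).
Proof. intros H. auto_derive. eexists; exact H. rewrite (is_derive_unique (fun x : R => f x) _ _ H : Derive (fun x : R => f x) t = _). ring. Qed.

Lemma Clog_holo w : slit w -> is_holo Clog w (/ w)%C.
Proof.
intros Hs g t d' E [H1 H2].
pose proof (Cmod_pos w Hs) as Hp. pose proof (Cmod_sqr w) as Esq.
pose proof (is_derive_cont _ _ _ H1) as C1. pose proof (is_derive_cont _ _ _ H2) as C2.
assert (Hsq : 0 < Re w * Re w + Im w * Im w) by nra.
rewrite <- E in *. split.
- apply is_derive_ext with (fun s => ln (sqrt (Re (g s) ^ 2 + Im (g s) ^ 2))). reflexivity.
  eapply is_derive_val. exact (is_derive_ln_norm _ _ _ _ _ H1 H2 Hsq).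
  unfold Re, Im in *; simpl; field; nra.
- assert (Im (/ g t * d')%C = (Re (g t) * Im d' - Im (g t) * Re d') / (Re (g t) * Re (g t) + Im (g t) * Im (g t))) as Ed.
  { unfold Re, Im in *; simpl. field. nra. }
  rewrite Ed. change (fun s => Im (Clog (g s))) with (fun s => Carg (g s)).
  destruct (Rlt_dec 0 (Re (g t))) as [Hr|Hr]; [|destruct (Rlt_dec 0 (Im (g t))) as [Hi|Hi]].
  + apply is_derive_ext_loc with (fun s => atan (Im (g s) / Re (g s))).
    { apply filter_imp with (2 := locally_gt _ _ _ C1 Hr).
      intros s Hp'; symmetry; now apply Carg_right. }
    eapply is_derive_val. apply (is_derive_atan_quot _ _ _ _ _ H2 H1); lra. field; nra.
  + apply is_derive_ext_loc with (fun s => PI / 2 - atan (Re (g s) / Im (g s))).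
    { apply filter_imp with (2 := locally_gt _ _ _ C2 Hi).
      intros s Hp'; symmetry; now apply Carg_up. }
    eapply is_derive_val. apply is_derive_Rminus_const, (is_derive_atan_quot _ _ _ _ _ H1 H2); lra. field; nra.
  + assert (Hi' : Im (g t) < 0) by (destruct Hs; lra).
    apply is_derive_ext_loc with (fun s => - PI / 2 - atan (Re (g s) / Im (g s))).
    { apply filter_imp with (2 := locally_lt _ _ _ C2 Hi').
      intros s Hp'; symmetry; now apply Carg_down. }
    eapply is_derive_val. apply is_derive_Rminus_const, (is_derive_atan_quot _ _ _ _ _ H1 H2); lra. field; nra.
Qed.

Lemma Cexp_holo w : is_holo Cexp w (Cexp w).
Proof.
intros g t d' E [H1 H2]. rewrite <- E.
destruct (is_derive_expcos _ _ _ _ _ H1 H2) as [A B]. split.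
- eapply is_derive_val. exact A. reflexivity.
- eapply is_derive_val. exact B. unfold Cexp, Re, Im; simpl; ring.
Qed.

Lemma Cpower_nz (w : C) a : w <> 0%C -> Cpower w a = Cexp (a * Clog w)%C.
Proof. intros H; unfold Cpower. destruct (Ceq_dec w (RtoC 0)) as [e|e]. { exfalso. apply H. exact e. } reflexivity. Qed.

Lemma locally_slit {T : UniformSpace} (g : T -> C) t :
  continuous (fun s => Re (g s)) t -> continuous (fun s => Im (g s)) t -> slit (g t) ->
  locally t (fun s => slit (g s)).
Proof.
intros C1 C2 [H|H].
- apply filter_imp with (2 := locally_gt _ _ _ C1 H). now left.
- destruct (Rdichotomy _ _ H) as [H'|H'].
  + apply filter_imp with (2 := locally_lt _ _ _ C2 H'). intros; right; lra.
  + apply filter_imp with (2 := locally_gt _ _ _ C2 H'). intros; right; lra.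
Qed.

Lemma Cpower_holo w a : slit w -> is_holo (fun u => Cpower u a) w (a * Cpower w a / w)%C.
Proof.
intros Hs g t d' E Hg.
apply is_Cderive_ext_loc with (fun s => Cexp (a * Clog (g s))%C).
{ destruct (is_Cderive_continuous _ _ _ Hg) as [C1 C2].
  rewrite <- E in Hs. apply filter_imp with (2 := locally_slit _ _ C1 C2 Hs).
  intros s Hs'; symmetry; apply Cpower_nz, slit_neq_0, Hs'. }
eapply is_Cderive_val.
- apply (Cexp_holo (a * Clog w)%C (fun s => a * Clog (g s))%C). now rewrite E.
  apply is_Cderive_mult. apply is_Cderive_const.
  apply (Clog_holo w Hs g t d' E Hg).
- rewrite Cpower_nz by (now apply slit_neq_0). field. now apply slit_neq_0.
Qed.

Lemma is_holo_id w : is_holo (fun u => u) w 1.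
Proof. intros g t d' E H. eapply is_Cderive_val. exact H. ring. Qed.

Lemma is_holo_const c w : is_holo (fun _ => c) w 0.
Proof. intros g t d' E H. eapply is_Cderive_val. apply is_Cderive_const. ring. Qed.

Lemma is_holo_minus f g w df dg : is_holo f w df -> is_holo g w dg -> is_holo (fun u => f u - g u)%C w (df - dg)%C.
Proof. intros H1 H2 c t d' E H. eapply is_Cderive_val. apply is_Cderive_minus; eauto. ring. Qed.

Lemma is_holo_mult f g w df dg : is_holo f w df -> is_holo g w dg ->
  is_holo (fun u => f u * g u)%C w (df * g w + f w * dg)%C.
Proof. intros H1 H2 c t d' E H. eapply is_Cderive_val. apply is_Cderive_mult; [apply (H1 c)|apply (H2 c)]; eauto. cbv beta. rewrite E; ring. Qed.

Lemma is_holo_comp f g w df dg : is_holo g w dg -> is_holo f (g w) df ->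
  is_holo (fun u => f (g u)) w (df * dg)%C.
Proof.
intros H1 H2 c t d' E H. eapply is_Cderive_val.
apply (H2 (fun s => g (c s)) t (dg * d')%C). now rewrite E. now apply H1. ring.
Qed.

Lemma is_holo_val f w d d' : is_holo f w d -> d = d' -> is_holo f w d'.
Proof. now intros H <-. Qed.

Lemma is_holo_inv (w : C) : w <> 0%C -> is_holo Cinv w (- / (w * w))%C.
Proof.
intros Hw g t d' E [H1 H2].
assert (Hsq : 0 < Re w * Re w + Im w * Im w).
{ rewrite <- Cmod_sqr. pose proof (proj1 (Cmod_gt_0 w) Hw). nra. }
assert (Hn : (Re w * Re w - Im w * Im w) * (Re w * Re w - Im w * Im w) + (Re w * Im w + Im w * Re w) * (Re w * Im w + Im w * Re w) <> 0).
{ replace (_ + _) with ((Re w * Re w + Im w * Im w) * (Re w * Re w + Im w * Im w)) by ring. nra. }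
rewrite <- E in *. split.
- eapply is_derive_val. exact (is_derive_quot_norm _ _ _ _ _ H1 H2 Hsq).
  unfold Re, Im in *; simpl. field. split; nra.
(* [is_derive_quot_norm] serves again, with the two components exchanged. *)
- apply is_derive_ext with (fun s => - (Im (g s) / (Im (g s) ^ 2 + Re (g s) ^ 2))).
  { intros s. unfold Re, Im; simpl. unfold Rdiv. rewrite Rplus_comm. ring. }
  eapply is_derive_val. apply (is_derive_opp (V := R_NormedModule)). apply (is_derive_quot_norm _ _ _ _ _ H2 H1); lra.
  unfold opp; simpl. unfold Re, Im in *; simpl. field. split; nra.
Qed.

Lemma Cmod_Cexp w : Cmod (Cexp w) = exp (Re w).
Proof.
unfold Cexp, Cmod. cbn [fst snd].
replace ((exp (Re w) * cos (Im w)) ^ 2 + (exp (Re w) * sin (Im w)) ^ 2)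
  with (exp (Re w) ^ 2 * ((sin (Im w))² + (cos (Im w))²)) by (unfold Rsqr; ring).
rewrite sin2_cos2, Rmult_1_r. apply sqrt_pow2. left; apply exp_pos.
Qed.

Lemma Re_scal (a : R) (w : C) : Re (a * w)%C = a * Re w.
Proof. unfold Re; simpl; ring. Qed.

Lemma Im_scal (a : R) (w : C) : Im (a * w)%C = a * Im w.
Proof. unfold Im; simpl; ring. Qed.

Lemma Cmod_Cpower (w : C) a : w <> 0%C -> Cmod (Cpower w a) = Rpower (Cmod w) a.
Proof. intros H. rewrite Cpower_nz, Cmod_Cexp, Re_scal by assumption. reflexivity. Qed.

(** * Continuity and integrals with a parameter *)

Section Cont.
Context {T : UniformSpace}.
Implicit Types (f g : T -> R) (u v : T -> C) (x : T).

Lemma cont_plus f g x : continuous f x -> continuous g x -> continuous (fun t => f t + g t) x.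
Proof. apply (continuous_plus (K := R_AbsRing) (V := R_NormedModule)). Qed.

Lemma cont_minus f g x : continuous f x -> continuous g x -> continuous (fun t => f t - g t) x.
Proof. apply (continuous_minus (K := R_AbsRing) (V := R_NormedModule)). Qed.

Lemma cont_opp f x : continuous f x -> continuous (fun t => - f t) x.
Proof. apply (continuous_opp (K := R_AbsRing) (V := R_NormedModule)). Qed.

Lemma cont_mult f g x : continuous f x -> continuous g x -> continuous (fun t => f t * g t) x.
Proof. apply (continuous_mult (K := R_AbsRing)). Qed.

Lemma cont_const (c : R) x : continuous (fun _ : T => c) x.
Proof. apply continuous_const. Qed.

Lemma cont_pow f n x : continuous f x -> continuous (fun t => f t ^ n) x.
Proof.
intros H; induction n as [|n IH]; simpl. apply cont_const. now apply cont_mult.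
Qed.

Lemma cont_fun (h : R -> R) f x : continuous f x -> continuous h (f x) -> continuous (fun t => h (f t)) x.
Proof. intros; apply continuous_comp; assumption. Qed.

Lemma cont_inv f x : continuous f x -> f x <> 0 -> continuous (fun t => / f t) x.
Proof. intros H1 H2; apply (cont_fun Rinv); auto. now apply continuous_Rinv. Qed.

Lemma cont_div f g x : continuous f x -> continuous g x -> g x <> 0 -> continuous (fun t => f t / g t) x.
Proof. intros; apply cont_mult; auto using cont_inv. Qed.

Lemma cont_ext_loc f g x : locally x (fun t => g t = f t) -> continuous g x -> continuous f x.
Proof. apply continuous_ext_loc. Qed.

(** Continuity by components, ready for the real integrals of [Re] and [Im]. The source may be any
    uniform space, which covers joint continuity in several parameters. *)
Definition Ccont u x : Prop := continuous (fun t => Re (u t)) x /\ continuous (fun t => Im (u t)) x.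

Lemma Ccont_const c x : Ccont (fun _ => c) x.
Proof. split; apply cont_const. Qed.

Lemma Ccont_RtoC f x : continuous f x -> Ccont (fun t => RtoC (f t)) x.
Proof. intros H; split; simpl; [exact H|apply cont_const]. Qed.

Lemma Ccont_pair f g x : continuous f x -> continuous g x -> Ccont (fun t => (f t, g t)) x.
Proof. intros H1 H2; split; assumption. Qed.

Lemma Ccont_plus u v x : Ccont u x -> Ccont v x -> Ccont (fun t => u t + v t)%C x.
Proof. intros [A B] [A' B']; split; simpl; now apply cont_plus. Qed.

Lemma Ccont_opp u x : Ccont u x -> Ccont (fun t => - u t)%C x.
Proof. intros [A B]; split; simpl; now apply cont_opp. Qed.

Lemma Ccont_minus u v x : Ccont u x -> Ccont v x -> Ccont (fun t => u t - v t)%C x.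
Proof. intros A B; apply Ccont_plus; auto using Ccont_opp. Qed.

Lemma Ccont_conj u x : Ccont u x -> Ccont (fun t => Cconj (u t)) x.
Proof. intros [A B]; split; simpl. exact A. now apply cont_opp. Qed.

Lemma Ccont_mult u v x : Ccont u x -> Ccont v x -> Ccont (fun t => u t * v t)%C x.
Proof.
intros [A B] [A' B']; split; simpl.
- apply cont_minus; now apply cont_mult.
- apply cont_plus; now apply cont_mult.
Qed.

Lemma Ccont_inv u x : Ccont u x -> u x <> 0%C -> Ccont (fun t => / u t)%C x.
Proof.
intros [A B] H.
assert (Hn : fst (u x) ^ 2 + snd (u x) ^ 2 <> 0).
{ pose proof (Cmod_sqr (u x)) as E. pose proof (proj1 (Cmod_gt_0 _) H). unfold Re, Im in E. nra. }
split;
[change (continuous (fun t => fst (u t) / (fst (u t) ^ 2 + snd (u t) ^ 2)) x)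
|change (continuous (fun t => - snd (u t) / (fst (u t) ^ 2 + snd (u t) ^ 2)) x)];
apply cont_div; auto using cont_opp; apply cont_plus; now apply cont_pow.
Qed.

Lemma Ccont_div u v x : Ccont u x -> Ccont v x -> v x <> 0%C -> Ccont (fun t => u t / v t)%C x.
Proof. intros; apply Ccont_mult; auto using Ccont_inv. Qed.

Lemma cont_Cmod u x : Ccont u x -> continuous (fun t => Cmod (u t)) x.
Proof.
intros [A B]. apply (cont_fun sqrt). apply cont_plus; now apply cont_pow. apply continuous_sqrt.
Qed.

Lemma Ccont_ext_loc u v x : locally x (fun t => v t = u t) -> Ccont v x -> Ccont u x.
Proof.
intros H [A B]; split.
- apply cont_ext_loc with (2 := A); apply filter_imp with (2 := H); intros t E; now rewrite E.
- apply cont_ext_loc with (2 := B); apply filter_imp with (2 := H); intros t E; now rewrite E.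
Qed.

Lemma cont_Carg u x : Ccont u x -> slit (u x) -> continuous (fun t => Carg (u t)) x.
Proof.
intros [A B] Hs.
destruct (Rlt_dec 0 (Re (u x))) as [Hr|Hr]; [|destruct (Rlt_dec 0 (Im (u x))) as [Hi|Hi]].
- apply cont_ext_loc with (fun s => atan (Im (u s) / Re (u s))).
  { apply filter_imp with (2 := locally_gt _ _ _ A Hr). intros s Hp'; symmetry; now apply Carg_right. }
  apply (cont_fun atan). apply cont_div; auto; lra. apply continuous_atan.
- apply cont_ext_loc with (fun s => PI / 2 - atan (Re (u s) / Im (u s))).
  { apply filter_imp with (2 := locally_gt _ _ _ B Hi). intros s Hp'; symmetry; now apply Carg_up. }
  apply cont_minus. apply cont_const. apply (cont_fun atan). apply cont_div; auto; lra. apply continuous_atan.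
- assert (Hi' : Im (u x) < 0) by (destruct Hs; lra).
  apply cont_ext_loc with (fun s => - PI / 2 - atan (Re (u s) / Im (u s))).
  { apply filter_imp with (2 := locally_lt _ _ _ B Hi'). intros s Hp'; symmetry; now apply Carg_down. }
  apply cont_minus. apply cont_const. apply (cont_fun atan). apply cont_div; auto; lra. apply continuous_atan.
Qed.

Lemma Ccont_exp u x : Ccont u x -> Ccont (fun t => Cexp (u t)) x.
Proof.
intros [A B].
assert (H : continuous (fun t => exp (Re (u t))) x) by (apply (cont_fun exp); [exact A|apply continuous_exp]).
split.
- apply (cont_mult (fun t => exp (Re (u t))) (fun t => cos (Im (u t))) x H).
  apply (cont_fun cos); [exact B|apply continuous_cos].
- apply (cont_mult (fun t => exp (Re (u t))) (fun t => sin (Im (u t))) x H).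
  apply (cont_fun sin); [exact B|apply continuous_sin].
Qed.

Lemma Ccont_power u a x : Ccont u x -> slit (u x) -> Ccont (fun t => Cpower (u t) a) x.
Proof.
intros Hu Hs.
apply Ccont_ext_loc with (fun t => Cexp (a * Clog (u t))%C).
{ destruct Hu as [A B]. apply filter_imp with (2 := locally_slit _ _ A B Hs).
  intros t H; symmetry; apply Cpower_nz, slit_neq_0, H. }
apply Ccont_exp, Ccont_mult. apply Ccont_const.
apply Ccont_pair.
- apply (cont_fun ln). now apply cont_Cmod. apply continuous_ln. now apply Cmod_pos.
- now apply cont_Carg.
Qed.

Lemma cont_clamp f (a b : R) x : a <= b -> continuous f x -> continuous (fun t => Rmax a (Rmin b (f t))) x.
Proof.
intros Hab H.
(* Minimum and maximum are expressed through absolute values, whose continuity is known. *)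
apply continuous_ext with (fun t => (a + (b + f t - Rabs (b - f t)) / 2 + Rabs (a - (b + f t - Rabs (b - f t)) / 2)) / 2).
{ intros t. unfold Rmin, Rmax, Rabs. repeat destruct Rle_dec; repeat destruct Rcase_abs; lra. }
assert (HA : continuous (fun t => (b + f t - Rabs (b - f t)) / 2) x).
{ apply cont_div; try lra; try apply cont_const. apply cont_minus. apply cont_plus; auto using cont_const.
  apply (cont_fun Rabs). apply cont_minus; auto using cont_const. apply continuous_Rabs. }
apply cont_div; try lra; try apply cont_const.
apply cont_plus. apply cont_plus; auto using cont_const.
apply (cont_fun Rabs). apply cont_minus; auto using cont_const. apply continuous_Rabs.
Qed.

End Cont.

Lemma cont_id (x : R) : continuous (fun t : R => t) x.
Proof. apply continuous_id. Qed.

(** At the branch point the modulus [|u|^a] tends to 0 whatever the argument does. For [a = 0] the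
    convention [0 ^ 0 = 1] in [Cpower] makes the function constant; this case occurs at
    [alpha = 2]. *)
Lemma Ccont_power_0 {T : UniformSpace} (u : T -> C) x a : Ccont u x -> u x = 0%C -> 0 <= a ->
  Ccont (fun t => Cpower (u t) a) x.
Proof.
intros Hu E Ha. destruct (Req_dec a 0) as [->|Ha0].
- apply Ccont_ext_loc with (fun _ => 1%C).
  { apply filter_forall. intros t. unfold Cpower. destruct Ceq_dec.
    destruct Req_EM_T; [easy|lra]. apply C_eq; unfold Cexp; simpl.
    rewrite !Rmult_0_l, Rminus_0_r, exp_0, Rplus_0_l, cos_0; ring.
    rewrite !Rmult_0_l, Rplus_0_l, sin_0; ring. }
  apply Ccont_const.
- pose proof (cont_Cmod u x Hu) as Hm.
  assert (Hz : Cpower 0 a = 0%C).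
  { unfold Cpower; destruct Ceq_dec as [_|n]; [|now elim n]. destruct Req_EM_T; [lra|easy]. }
  assert (Hs : forall eps : posreal, locally x (fun t => Cmod (Cpower (u t) a) < eps)).
  { intros eps. set (d := Rpower eps (/ a)).
    assert (Hd : 0 < d) by apply exp_pos.
    assert (H0 : Cmod (u x) < d) by (rewrite E, Cmod_0; exact Hd).
    apply filter_imp with (2 := locally_lt _ _ _ Hm H0).
    intros t Ht. destruct (Ceq_dec (u t) 0) as [e|n].
    - rewrite e, Hz, Cmod_0. apply cond_pos.
    - rewrite Cpower_nz by assumption.
      rewrite Cmod_Cexp, Re_scal. change (Re (Clog (u t))) with (ln (Cmod (u t))).
      replace (pos eps) with (exp (a * ln d)).
      + apply exp_increasing, Rmult_lt_compat_l. lra. apply ln_increasing; auto. now apply Cmod_gt_0.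
      + unfold d, Rpower. rewrite ln_exp. rewrite <- (exp_ln eps) at 2 by apply cond_pos. f_equal; field; lra. }
  split; apply filterlim_locally; rewrite E, Hz; intros eps; apply filter_imp with (2 := Hs eps);
    intros t Ht; unfold ball; simpl; unfold AbsRing_ball, abs, minus, plus, opp; simpl; rewrite Ropp_0, Rplus_0_r;
    (eapply Rle_lt_trans; [|exact Ht]).
  apply Rle_trans with (2 := Rmax_Cmod _). apply Rmax_l.
  apply Rle_trans with (2 := Rmax_Cmod _). apply Rmax_r.
Qed.

(** The tube lemma: out of radii that depend on [t], compactness of [[a, b]] extracts one that works
    for every [t]. *)
Lemma tube {T : UniformSpace} (P : T -> R -> Prop) (x : T) a b :
  (forall t, a <= t <= b -> locally ((x, t) : T * R) (fun q => P (fst q) (snd q))) ->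
  locally x (fun y => forall t, a <= t <= b -> P y t).
Proof.
intros H.
assert (H' : forall t, exists d : posreal, a <= t <= b ->
  forall y s, ball x d y -> ball t d s -> P y s).
{ intros t. destruct (excluded_middle_informative (a <= t <= b)) as [h|h].
  - destruct (H t h) as [d Hd]. exists d. intros _ y s Hy Hs. apply (Hd (y, s)). now split.
  - exists (mkposreal 1 Rlt_0_1); tauto. }
set (delta := fun t => proj1_sig (constructive_indefinite_description _ (H' t))).
assert (Hdel : forall t, a <= t <= b -> forall y s, ball x (delta t) y -> ball t (delta t) s -> P y s).
{ intros t; unfold delta; destruct constructive_indefinite_description; assumption. }
destruct (compactness_value_1d a b delta) as [d Hd].
exists d. intros y Hy t Ht. apply Classical_Prop.NNPP. intros Hn.
apply (Hd t Ht). intros (s & Hs & Hst & Hds).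
apply Hn, (Hdel s Hs). now apply ball_le with d. exact Hst.
Qed.

Lemma cont_RInt_param {T : UniformSpace} (f : T -> R -> R) x a b : a <= b ->
  (forall t, a <= t <= b -> continuous (fun q : T * R => f (fst q) (snd q)) (x, t)) ->
  locally x (fun y => ex_RInt (f y) a b) ->
  continuous (fun y => RInt (f y) a b) x.
Proof.
intros Hab Hc Hi.
apply filterlim_locally. intros eps.
(* The summand 1 keeps the denominator positive when [a = b]. *)
set (e := eps / (2 * (1 + (b - a)))).
assert (He : 0 < e) by (apply Rdiv_lt_0_compat; [apply cond_pos|lra]).
assert (Hex := locally_singleton _ _ Hi).
assert (L : locally x (fun y => forall t, a <= t <= b -> Rabs (f y t - f x t) <= e)).
{ apply tube. intros t Ht.
  assert (Hx : continuous (fun q : T * R => f x (snd q)) (x, t)).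
  { apply (continuous_comp (fun q : T * R => (x, snd q)) (fun q => f (fst q) (snd q))).
    - intros P [d Hd]. exists d. intros [y s] [Hy Hs]. apply Hd. split; [apply ball_center|exact Hs].
    - now apply Hc. }
  assert (Hd := cont_minus _ _ _ (Hc t Ht) Hx).
  assert (Hd2 := cont_fun Rabs _ _ Hd (continuous_Rabs _)).
  eapply filter_imp. 2: apply (locally_lt _ _ e Hd2).
  - intros q; simpl; intros; lra.
  - simpl. rewrite Rminus_eq_0, Rabs_R0. exact He. }
generalize (filter_and _ _ L Hi). apply filter_imp. intros y [Hy Hey].
unfold ball; simpl; unfold AbsRing_ball, abs, minus, plus, opp; simpl.
change (Rabs (RInt (f y) a b - RInt (f x) a b) < eps).
rewrite <- (RInt_minus (V := R_CompleteNormedModule)) by assumption.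
eapply Rle_lt_trans.
- apply abs_RInt_le_const with (M := e); auto. apply (ex_RInt_minus (V := R_NormedModule)); auto.
- unfold e. apply Rmult_lt_reg_r with (2 * (1 + (b - a))). lra.
  replace ((b - a) * (eps / (2 * (1 + (b - a)))) * (2 * (1 + (b - a)))) with ((b - a) * eps) by (field; lra).
  pose proof (cond_pos eps). nra.
Qed.

Lemma clamp_id a b t : a <= t <= b -> Rmax a (Rmin b t) = t.
Proof. intros H; unfold Rmax, Rmin; repeat destruct Rle_dec; lra. Qed.

Lemma clamp_in a b t : a <= b -> a <= Rmax a (Rmin b t) <= b.
Proof. intros H; unfold Rmax, Rmin; repeat destruct Rle_dec; lra. Qed.

Lemma cont_slice_r (f : R -> R -> R) s t :
  continuous (fun q : R * R => f (fst q) (snd q)) (s, t) -> continuous (f s) t.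
Proof.
intros H. apply (continuous_comp_2 (fun _ : R => s) (fun t : R => t) f).
apply continuous_const. apply continuous_id. exact H.
Qed.

Lemma cont_slice_l (f : R -> R -> R) s t :
  continuous (fun q : R * R => f (fst q) (snd q)) (s, t) -> continuous (fun u => f u t) s.
Proof.
intros H. apply (continuous_comp_2 (fun u : R => u) (fun _ : R => t) f).
apply continuous_id. apply continuous_const. exact H.
Qed.

Lemma cont_pair_map (f : R -> R -> R) (g h : R -> R) s t :
  continuous (fun q : R * R => f (fst q) (snd q)) (g s, h t) ->
  continuous g s -> continuous h t ->
  continuous (fun q : R * R => f (g (fst q)) (h (snd q))) (s, t).
Proof.
intros H Hg Hh.
apply (continuous_comp_2 (fun q : R * R => g (fst q)) (fun q : R * R => h (snd q)) f).
- apply (continuous_comp fst g). apply continuous_fst. exact Hg.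
- apply (continuous_comp snd h). apply continuous_snd. exact Hh.
- exact H.
Qed.

(* Clamping the integration variable turns data on [a, b] into the two-sided data that
   [is_derive_RInt_param] asks for. *)
Lemma derive_RInt_param (A D : R -> R -> R) a b s : a <= b ->
  locally s (fun u => forall t, a <= t <= b -> is_derive (fun w => A w t) u (D u t)) ->
  (forall t, a <= t <= b -> continuous (fun q : R * R => D (fst q) (snd q)) (s, t)) ->
  locally s (fun u => ex_RInt (A u) a b) ->
  is_derive (fun u => RInt (A u) a b) s (RInt (D s) a b).
Proof.
intros Hab H1 H2 H3.
set (cl := fun t => Rmax a (Rmin b t)).
assert (Hcl : forall t, a <= t <= b -> cl t = t) by (intros; now apply clamp_id).
assert (Hin : forall t, a <= cl t <= b) by (intros; now apply clamp_in).
assert (E : forall u, RInt (fun t => A u (cl t)) a b = RInt (A u) a b).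
{ intros u. apply RInt_ext. rewrite Rmin_left, Rmax_right by assumption.
  intros t Ht. rewrite Hcl; lra. }
apply is_derive_ext with (fun u => RInt (fun t => A u (cl t)) a b). exact E.
replace (RInt (D s) a b) with (RInt (fun t => Derive (fun u => A u (cl t)) s) a b).
2:{ apply RInt_ext. rewrite Rmin_left, Rmax_right by assumption. intros t Ht.
    rewrite Hcl by lra. apply is_derive_unique. apply (locally_singleton _ _ H1); lra. }
apply (is_derive_RInt_param (fun u t => A u (cl t))).
- apply filter_imp with (2 := H1). intros u Hu t _. eexists. apply (Hu (cl t)), Hin.
- intros t _. apply continuity_2d_pt_filterlim.
  assert (C : continuous (fun q : R * R => D (fst q) (cl (snd q))) (s, t)).
  { apply (cont_pair_map D (fun u => u) cl). apply H2, Hin. apply continuous_id.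
    apply cont_clamp; auto using cont_id. }
  change (continuous (fun q : R * R => Derive (fun z => A z (cl (snd q))) (fst q)) (s, t)).
  apply continuous_ext_loc with (2 := C).
  destruct H1 as [d Hd]. exists d. intros [u v] [Hu _]. symmetry. apply is_derive_unique.
  apply Hd. exact Hu. apply Hin.
- apply filter_imp with (2 := H3). intros u Hu.
  apply ex_RInt_ext with (2 := Hu). rewrite Rmin_left, Rmax_right by assumption. intros t Ht. rewrite Hcl; lra.
Qed.

(** * Green's formula on a rectangle *)

Lemma const_of_derive_0 (g : R -> R) a b : a <= b ->
  (forall x, a < x < b -> is_derive g x 0) -> (forall x, a <= x <= b -> continuous g x) -> g b = g a.
Proof.
intros Hab H1 H2.
destruct (MVT_gen g a b (fun _ => 0)) as (c & _ & Hc).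
- rewrite Rmin_left, Rmax_right by assumption. exact H1.
- rewrite Rmin_left, Rmax_right by assumption. intros x Hx. apply continuity_pt_filterlim, H2, Hx.
- lra.
Qed.

Lemma ex_RInt_cont (f : R -> R) a b : a <= b -> (forall x, a <= x <= b -> continuous f x) -> ex_RInt f a b.
Proof.
intros Hab H; apply (ex_RInt_continuous (V := R_CompleteNormedModule)).
now rewrite Rmin_left, Rmax_right.
Qed.

Lemma is_derive_RInt_cont (f : R -> R) a x : locally x (fun y => ex_RInt f a y) -> continuous f x ->
  is_derive (fun y => RInt f a y) x (f x).
Proof.
intros H1 H2; apply (is_derive_RInt f (fun y => RInt f a y) a); auto.
apply filter_imp with (2 := H1). intros y Hy; now apply (RInt_correct (V := R_CompleteNormedModule)).
Qed.

Lemma locally_Ioo (a b x : R) : a < x < b -> locally x (fun y => a < y < b).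
Proof.
intros H; apply filter_and. exact (open_gt a x (proj1 H)). exact (open_lt b x (proj2 H)).
Qed.

(* The hypotheses say that [A dt + B ds] is closed. *)
Lemma green (A B D : R -> R -> R) s0 s1 a b : s0 <= s1 -> a <= b ->
  (forall s t, s0 <= s <= s1 -> a <= t <= b ->
     is_derive (fun u => A u t) s (D s t) /\ is_derive (B s) t (D s t) /\
     continuous (fun q : R * R => A (fst q) (snd q)) (s, t) /\
     continuous (fun q : R * R => D (fst q) (snd q)) (s, t)) ->
  (forall s, s0 <= s <= s1 -> continuous (fun u => B u a) s /\ continuous (fun u => B u b) s) ->
  RInt (A s1) a b - RInt (A s0) a b = RInt (fun s => B s b - B s a) s0 s1.
Proof.
intros Hs Hab H HB.
set (cl := fun s => Rmax s0 (Rmin s1 s)).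
assert (Hcl : forall s, s0 <= s <= s1 -> cl s = s) by (intros; now apply clamp_id).
assert (Hin : forall s, s0 <= cl s <= s1) by (intros; now apply clamp_in).
assert (Ccl : forall s, continuous cl s) by (intros; apply cont_clamp; auto using cont_id).
assert (exA : forall s, s0 <= s <= s1 -> ex_RInt (A s) a b).
{ intros s Hs'. apply ex_RInt_cont; auto. intros t Ht. now apply (cont_slice_r A), H. }
set (beta := fun s => B (cl s) b - B (cl s) a).
assert (Cb : forall s, continuous beta s).
{ intros s. apply cont_minus.
  apply (cont_fun (fun u => B u b) cl); auto. now apply HB.
  apply (cont_fun (fun u => B u a) cl); auto. now apply HB. }
assert (Db : forall s, is_derive (fun y => RInt beta s0 y) s (beta s)).
{ intros s. apply is_derive_RInt_cont; auto. apply filter_forall. intros y.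
  apply (ex_RInt_continuous (V := R_CompleteNormedModule)). auto. }
(* Under the integral sign the derivative of the first term is the integral of [D s], which is the
   increment of [B s] over [[a, b]]; so [g] is constant. The clamp [cl] keeps everything continuous
   past the ends of [[s0, s1]]. *)
pose (g := fun s => RInt (A (cl s)) a b - RInt beta s0 s).
assert (Cg : forall s, continuous g s).
{ intros s. apply cont_minus.
  - apply (cont_RInt_param (fun s => A (cl s))); auto.
    + intros t Ht. apply (cont_pair_map A cl (fun t => t)); auto using cont_id. now apply H.
    + apply filter_forall. intros; apply exA, Hin.
  - eapply is_derive_cont, Db. }
assert (E : g s1 = g s0).
{ apply const_of_derive_0; auto. intros s Hs'.
  assert (L := locally_Ioo _ _ _ Hs').
  replace 0 with (RInt (D s) a b - beta s).
  - apply (is_derive_minus (V := R_NormedModule)); auto.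
    apply is_derive_ext_loc with (fun u => RInt (A u) a b).
    { apply filter_imp with (2 := L). intros u Hu; rewrite Hcl; auto; lra. }
    apply (derive_RInt_param A D); auto.
    + apply filter_imp with (2 := L). intros u Hu t Ht. apply H; auto; lra.
    + intros t Ht; apply H; auto; lra.
    + apply filter_imp with (2 := L). intros u Hu; apply exA; lra.
  - unfold beta. rewrite Hcl by lra.
    replace (RInt (D s) a b) with (B s b - B s a). ring.
    symmetry. apply is_RInt_unique.
    apply (is_RInt_derive (V := R_CompleteNormedModule) (B s) (D s));
      rewrite Rmin_left, Rmax_right by assumption; intros t Ht.
    + apply H; auto; lra.
    + apply (cont_slice_r D), H; auto; lra. }
unfold g in E. rewrite !Hcl, (RInt_point s0) in E by lra.
replace (RInt (fun s => B s b - B s a) s0 s1) with (RInt beta s0 s1).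
- unfold zero in E; simpl in E. lra.
- apply RInt_ext. rewrite Rmin_left, Rmax_right by assumption. intros s Hs'. unfold beta. rewrite Hcl; auto; lra.
Qed.

Lemma zero_at_right_end (G : R -> R) a b : a < b -> continuous G b ->
  (forall c, a < c < b -> G c = 0) -> G b = 0.
Proof.
intros Hab Hc H.
destruct (Req_dec (G b) 0) as [E|E]; [exact E|exfalso].
assert (L : locally b (fun c => G c <> 0)).
{ apply (Hc (fun y => y <> 0)). now apply open_neq. }
destruct L as [d Hd]. pose proof (cond_pos d).
set (c := Rmax ((a + b) / 2) (b - d / 2)).
assert (Hcb : a < c < b /\ b - d / 2 <= c) by (unfold c, Rmax; destruct Rle_dec; lra).
apply (Hd c). 2: now apply H.
unfold ball; simpl; unfold AbsRing_ball, abs, minus, plus, opp; simpl.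
rewrite Rabs_left; lra.
Qed.

(* The kernels below have a singular derivative at the endpoint [z] when [alpha < 3]. *)
Lemma green_open (A B D : R -> R -> R) s0 s1 a b : s0 <= s1 -> a < b ->
  (forall s t, s0 <= s <= s1 -> a <= t < b ->
     is_derive (fun u => A u t) s (D s t) /\ is_derive (B s) t (D s t) /\
     continuous (fun q : R * R => D (fst q) (snd q)) (s, t)) ->
  (forall s t, s0 <= s <= s1 -> a <= t <= b ->
     continuous (fun q : R * R => A (fst q) (snd q)) (s, t) /\
     continuous (fun q : R * R => B (fst q) (snd q)) (s, t)) ->
  RInt (A s1) a b - RInt (A s0) a b = RInt (fun s => B s b - B s a) s0 s1.
Proof.
intros Hs Hab H HC.
set (cl := fun t => Rmax a (Rmin b t)).
assert (Hcl : forall t, a <= t <= b -> cl t = t) by (intros; now apply clamp_id).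
assert (Hin : forall t, a <= cl t <= b) by (intros; apply clamp_in; lra).
assert (Ccl : forall s, continuous cl s) by (intros; apply cont_clamp; auto using cont_id; lra).
assert (CA : forall s, s0 <= s <= s1 -> forall t, continuous (fun t => A s (cl t)) t).
{ intros s Hs' t. apply (cont_fun (A s) cl); auto. now apply (cont_slice_r A), HC. }
assert (DA : forall s, s0 <= s <= s1 -> forall c, continuous (fun c => RInt (fun t => A s (cl t)) a c) c).
{ intros s Hs' c. eapply is_derive_cont. apply is_derive_RInt_cont; auto.
  apply filter_forall; intros y. apply (ex_RInt_continuous (V := R_CompleteNormedModule)); auto. }
assert (CB : forall s t, s0 <= s <= s1 -> a <= t <= b -> continuous (fun u => B u t) s).
{ intros s t Hs' Ht. now apply (cont_slice_l B), HC. }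
(* [G c] is the defect of the formula on [[a, c]]: zero by [green] for [c < b], and continuous up to
   [b] by the continuity of [A] and [B] alone. *)
pose (G := fun c => (RInt (fun t => A s1 (cl t)) a c - RInt (fun t => A s0 (cl t)) a c)
   - RInt (fun s => B s (cl c) - B s a) s0 s1).
assert (E : G b = 0).
{ apply zero_at_right_end with a; auto.
  - apply cont_minus. apply cont_minus; apply DA; lra.
    apply (cont_RInt_param (fun c s => B s (cl c) - B s a)); auto.
    + intros s Hs'. apply cont_minus.
      * apply (continuous_comp_2 (fun q : R * R => snd q) (fun q : R * R => cl (fst q)) B).
        apply continuous_snd. apply (continuous_comp fst cl). apply continuous_fst. apply Ccl.
        apply HC; auto.
      * apply (continuous_comp snd (fun s => B s a)). apply continuous_snd. apply CB; auto; lra.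
    + apply filter_forall. intros c. apply ex_RInt_cont; auto. intros s Hs'.
      apply cont_minus; apply CB; auto; lra.
  - intros c Hc. unfold G.
    rewrite <- (RInt_ext (A s1) (fun t => A s1 (cl t))).
    2: rewrite Rmin_left, Rmax_right by lra; intros t Ht; rewrite Hcl; [reflexivity|lra].
    rewrite <- (RInt_ext (A s0) (fun t => A s0 (cl t))).
    2: rewrite Rmin_left, Rmax_right by lra; intros t Ht; rewrite Hcl; [reflexivity|lra].
    rewrite Hcl, (green A B D s0 s1 a c) by
     (try lra; intros; try split; try apply CB; try lra;
      destruct (H s t) as (h1 & h2 & h3); try lra; destruct (HC s t); try lra; auto).
    lra. }
unfold G in E.
rewrite <- (RInt_ext (A s1) (fun t => A s1 (cl t))) in E.
2: rewrite Rmin_left, Rmax_right by lra; intros t Ht; rewrite Hcl; [reflexivity|lra].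
rewrite <- (RInt_ext (A s0) (fun t => A s0 (cl t))) in E.
2: rewrite Rmin_left, Rmax_right by lra; intros t Ht; rewrite Hcl; [reflexivity|lra].
rewrite Hcl in E by lra. lra.
Qed.

(** * Complex line integrals and Cauchy's theorem *)

Definition CRInt (f : R -> C) a b : C := (RInt (fun t => Re (f t)) a b, RInt (fun t => Im (f t)) a b).

Lemma ex_RInt_ReIm (f : R -> C) a b : a <= b -> (forall t, a <= t <= b -> Ccont f t) ->
  ex_RInt (fun t => Re (f t)) a b /\ ex_RInt (fun t => Im (f t)) a b.
Proof.
intros Hab H; split; apply ex_RInt_cont; auto; intros t Ht; [exact (proj1 (H t Ht))|exact (proj2 (H t Ht))].
Qed.

Lemma CRInt_correct (f : R -> C) a b : a <= b -> (forall t, a <= t <= b -> Ccont f t) ->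
  is_RInt (V := C_R_NormedModule) f a b (CRInt f a b).
Proof.
intros Hab H.
destruct (ex_RInt_ReIm f a b Hab H) as [e1 e2].
apply (is_RInt_fct_extend_pair (U := R_NormedModule) (V := R_NormedModule) f).
- exact (RInt_correct (V := R_CompleteNormedModule) _ _ _ e1).
- exact (RInt_correct (V := R_CompleteNormedModule) _ _ _ e2).
Qed.

Lemma RInt_CRInt (f : R -> C) a b : a <= b -> (forall t, a <= t <= b -> Ccont f t) ->
  RInt (V := C_R_CompleteNormedModule) f a b = CRInt f a b.
Proof. intros; now apply (is_RInt_unique (V := C_R_CompleteNormedModule)), CRInt_correct. Qed.

Lemma CRInt_ext (f g : R -> C) a b : a <= b -> (forall t, a < t < b -> f t = g t) -> CRInt f a b = CRInt g a b.
Proof.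
intros Hab H; unfold CRInt; f_equal; apply RInt_ext; rewrite Rmin_left, Rmax_right by assumption;
  intros t Ht; now rewrite H.
Qed.

Lemma CRInt_bound (f : R -> C) a b M : a <= b -> (forall t, a <= t <= b -> Ccont f t) ->
  (forall t, a <= t <= b -> Cmod (f t) <= M) -> Cmod (CRInt f a b) <= (b - a) * M.
Proof.
intros Hab H HM.
(* The norm of the real module [C_R_NormedModule] is the Euclidean one, so the estimate loses no
   constant. *)
assert (N : forall w : C, norm (V := C_R_NormedModule) w = Cmod w).
{ intros [x y]; unfold norm; simpl. unfold prod_norm, Cmod; simpl. unfold norm; simpl. unfold abs; simpl.
  f_equal. rewrite !Rmult_1_r, <- !Rabs_mult, !Rabs_pos_eq; nra. }
rewrite <- N. apply (norm_RInt_le_const (V := C_R_NormedModule) f a b); auto.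
intros t Ht; rewrite N; auto. now apply CRInt_correct.
Qed.

Lemma CRInt_plus (f g : R -> C) a b : a <= b -> (forall t, a <= t <= b -> Ccont f t) ->
  (forall t, a <= t <= b -> Ccont g t) -> CRInt (fun t => f t + g t)%C a b = (CRInt f a b + CRInt g a b)%C.
Proof.
intros Hab Hf Hg. destruct (ex_RInt_ReIm f a b Hab Hf) as [e1 e2]. destruct (ex_RInt_ReIm g a b Hab Hg) as [e3 e4].
apply C_eq.
- exact (RInt_plus (V := R_CompleteNormedModule) _ _ _ _ e1 e3).
- exact (RInt_plus (V := R_CompleteNormedModule) _ _ _ _ e2 e4).
Qed.

Lemma CRInt_scal (c : C) (f : R -> C) a b : a <= b -> (forall t, a <= t <= b -> Ccont f t) ->
  CRInt (fun t => c * f t)%C a b = (c * CRInt f a b)%C.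
Proof.
intros Hab Hf. destruct (ex_RInt_ReIm f a b Hab Hf) as [e1 e2].
assert (S : forall k (g : R -> R), ex_RInt g a b -> is_RInt (fun t => k * g t) a b (k * RInt g a b)).
{ intros k g Hg. apply (is_RInt_scal (V := R_NormedModule)), (RInt_correct (V := R_CompleteNormedModule)), Hg. }
unfold CRInt, Cmult; simpl; f_equal; apply is_RInt_unique.
- apply (is_RInt_minus (V := R_NormedModule)); now apply S.
- apply (is_RInt_plus (V := R_NormedModule)); now apply S.
Qed.

Lemma CRInt_conj (f : R -> C) a b :  a <= b -> (forall t, a <= t <= b -> Ccont f t) ->
  CRInt (fun t => Cconj (f t)) a b = Cconj (CRInt f a b).
Proof.
intros Hab Hf. destruct (ex_RInt_ReIm f a b Hab Hf) as [e1 e2]. apply C_eq. reflexivity.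
exact (RInt_opp (V := R_CompleteNormedModule) _ _ _ e2).
Qed.

Lemma Cgreen_open (A B D : R -> R -> C) s0 s1 a b : s0 <= s1 -> a < b ->
  (forall s t, s0 <= s <= s1 -> a <= t < b ->
     is_Cderive (fun u => A u t) s (D s t) /\ is_Cderive (B s) t (D s t) /\
     Ccont (fun q : R * R => D (fst q) (snd q)) (s, t)) ->
  (forall s t, s0 <= s <= s1 -> a <= t <= b ->
     Ccont (fun q : R * R => A (fst q) (snd q)) (s, t) /\
     Ccont (fun q : R * R => B (fst q) (snd q)) (s, t)) ->
  (CRInt (A s1) a b - CRInt (A s0) a b)%C = CRInt (fun s => B s b - B s a)%C s0 s1.
Proof.
intros Hs Hab H HC. apply C_eq.
- apply (green_open (fun s t => Re (A s t)) (fun s t => Re (B s t)) (fun s t => Re (D s t)) s0 s1 a b); auto.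
  + intros s t h1 h2. destruct (H s t h1 h2) as ((? & ?) & (? & ?) & (? & ?)). auto.
  + intros s t h1 h2. destruct (HC s t h1 h2) as ((? & ?) & (? & ?)). auto.
- apply (green_open (fun s t => Im (A s t)) (fun s t => Im (B s t)) (fun s t => Im (D s t)) s0 s1 a b); auto.
  + intros s t h1 h2. destruct (H s t h1 h2) as ((? & ?) & (? & ?) & (? & ?)). auto.
  + intros s t h1 h2. destruct (HC s t h1 h2) as ((? & ?) & (? & ?)). auto.
Qed.

Definition lin_hom (a b : R -> C) (l t : R) : C := ((1 - l)%R * a t + l * b t)%C.

Lemma Ccont_snd (f : R -> C) (s t : R) : Ccont f t -> Ccont (fun q : R * R => f (snd q)) (s, t).
Proof.
intros [H1 H2]; split.
- apply (continuous_comp snd (fun t => Re (f t))). apply continuous_snd. exact H1.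
- apply (continuous_comp snd (fun t => Im (f t))). apply continuous_snd. exact H2.
Qed.

Lemma Ccont_slice_r (f : R -> R -> C) s t :
  Ccont (fun q : R * R => f (fst q) (snd q)) (s, t) -> Ccont (f s) t.
Proof. intros [H1 H2]; split; [apply (cont_slice_r (fun s t => Re (f s t)))|apply (cont_slice_r (fun s t => Im (f s t)))]; auto. Qed.

Lemma Ccont_of_deriv (f : R -> C) t d : is_Cderive f t d -> Ccont f t.
Proof. apply is_Cderive_continuous. Qed.

Lemma Ccont_lin_hom a b l t : Ccont a t -> Ccont b t ->
  Ccont (fun q : R * R => lin_hom a b (fst q) (snd q)) (l, t).
Proof.
intros Ha Hb. apply Ccont_plus; apply Ccont_mult; auto using Ccont_snd; apply Ccont_RtoC.
- apply cont_minus. apply cont_const. apply continuous_fst.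
- apply continuous_fst.
Qed.

(* Cauchy's theorem for the linear homotopy between two curves with a common endpoint, where
   [f] need only be continuous. *)
Lemma deform (f f' : C -> C) (a b a' b' : R -> C) :
  (forall t, is_Cderive a t (a' t)) -> (forall t, is_Cderive b t (b' t)) ->
  (forall t, Ccont a' t) -> (forall t, Ccont b' t) -> a 1 = b 1 ->
  (forall l t, 0 <= l <= 1 -> 0 <= t < 1 ->
     is_holo f (lin_hom a b l t) (f' (lin_hom a b l t)) /\
     Ccont (fun q : R * R => f' (lin_hom a b (fst q) (snd q))) (l, t)) ->
  (forall l t, 0 <= l <= 1 -> 0 <= t <= 1 ->
     Ccont (fun q : R * R => f (lin_hom a b (fst q) (snd q))) (l, t)) ->
  CRInt (fun t => f (a t) * a' t)%C 0 1 =
  (CRInt (fun t => f (b t) * b' t)%C 0 1 + CRInt (fun l => f (lin_hom a b l 0) * (b 0%R - a 0%R))%C 0 1)%C.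
Proof.
intros Da Db Ca' Cb' E1 H HC.
assert (Ca : forall t, Ccont a t) by (intros t; exact (Ccont_of_deriv _ _ _ (Da t))).
assert (Cb : forall t, Ccont b t) by (intros t; exact (Ccont_of_deriv _ _ _ (Db t))).
assert (Em : RtoC (-1) = (- (1))%C) by (apply C_eq; simpl; ring).
(* [A dt + B dl] is the pullback of [f(u) du] by the homotopy, and [D] is the common value of the
   two cross derivatives. *)
set (A := fun l t => (f (lin_hom a b l t) * lin_hom a' b' l t)%C).
set (B := fun l t => (f (lin_hom a b l t) * (b t - a t))%C).
set (D := fun l t => (f' (lin_hom a b l t) * (b t - a t) * lin_hom a' b' l t + f (lin_hom a b l t) * (b' t - a' t))%C).
assert (G : (CRInt (A 1%R) 0 1 - CRInt (A 0%R) 0 1)%C = CRInt (fun s => B s 1%R - B s 0%R)%C 0 1).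
{ apply (Cgreen_open A B D); try lra.
  - intros l t Hl Ht. destruct (H l t Hl Ht) as [Hh Hc]. split; [|split].
    + unfold A, D. eapply is_Cderive_val. apply is_Cderive_mult.
      * apply (Hh (fun u => lin_hom a b u t) l (b t - a t)%C); auto.
        unfold lin_hom. eapply is_Cderive_val. apply is_Cderive_plus; apply is_Cderive_mult.
        apply is_Cderive_RtoC, is_derive_Rminus_const, is_derive_id. apply is_Cderive_const.
        apply is_Cderive_RtoC, is_derive_id. apply is_Cderive_const.
        unfold one; simpl. apply C_eq; simpl; ring.
      * unfold lin_hom. apply is_Cderive_plus; apply is_Cderive_mult.
        apply is_Cderive_RtoC, is_derive_Rminus_const, is_derive_id. apply is_Cderive_const.
        apply is_Cderive_RtoC, is_derive_id. apply is_Cderive_const.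
      * unfold one; simpl. rewrite RtoC_opp. ring.
    + unfold B, D. eapply is_Cderive_val. apply is_Cderive_mult.
      * apply (Hh (fun u => lin_hom a b l u) t (lin_hom a' b' l t)%C); auto.
        unfold lin_hom. eapply is_Cderive_val. apply is_Cderive_plus; apply is_Cderive_mult.
        apply is_Cderive_const. apply Da. apply is_Cderive_const. apply Db. cbv beta. ring.
      * apply is_Cderive_minus. apply Db. apply Da.
      * cbv beta. ring.
    + unfold D. apply Ccont_plus; apply Ccont_mult.
      * apply Ccont_mult; auto. apply Ccont_minus; now apply Ccont_snd.
      * now apply Ccont_lin_hom.
      * apply HC; auto; lra.
      * apply Ccont_minus; now apply Ccont_snd.
  - intros l t Hl Ht. split.
    + apply Ccont_mult; auto. now apply Ccont_lin_hom.
    + apply Ccont_mult; auto. apply Ccont_minus; now apply Ccont_snd. }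
rewrite (CRInt_ext (A 1%R) (fun t => f (b t) * b' t)%C) in G.
2: lra.
2:{ intros t _; unfold A, lin_hom. replace (RtoC (1 - 1)) with (RtoC 0) by (f_equal; ring).
    rewrite !Cmult_0_l, !Cplus_0_l, !Cmult_1_l. reflexivity. }
rewrite (CRInt_ext (A 0%R) (fun t => f (a t) * a' t)%C) in G.
2: lra.
2:{ intros t _; unfold A, lin_hom. replace (RtoC (1 - 0)) with (RtoC 1) by (f_equal; ring).
    rewrite !Cmult_0_l, !Cplus_0_r, !Cmult_1_l. reflexivity. }
(* The edge [t = 1] contributes nothing, because both curves end at the same point; the edge [t = 0]
   runs between their starting points. *)
rewrite (CRInt_ext (fun s => B s 1%R - B s 0%R)%C (fun l => (-1)%R * (f (lin_hom a b l 0) * (b 0%R - a 0%R)))%C) in G.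
2: lra.
2:{ intros t _; unfold B. rewrite E1, Em. ring. }
rewrite CRInt_scal in G.
- rewrite Em in G. rewrite <- (Cplus_0_r (CRInt (fun t => f (b t) * b' t)%C 0 1)).
  set (X := CRInt (fun t => f (a t) * a' t)%C 0 1) in *.
  set (Y := CRInt (fun t => f (b t) * b' t)%C 0 1) in *.
  set (Z := CRInt _ _ _) in *.
  replace X with (Y - (Y - X))%C by ring. rewrite G. ring.
- lra.
- intros t Ht. apply Ccont_mult. 2: apply Ccont_const.
  assert (h := HC t 0 Ht (conj (Rle_refl 0) Rle_0_1)).
  destruct h as [h1 h2]; split.
  apply (cont_slice_l (fun s t => Re (f (lin_hom a b s t)))); auto.
  apply (cont_slice_l (fun s t => Im (f (lin_hom a b s t)))); auto.
Qed.

(** * Deforming the contour to an arc of circle *)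

(* The integrand of [M] has [p = alpha], [q = alpha - 2]; complex conjugation, which maps one half
   of the contour to the other, exchanges [p] and [q]. *)
Definition kern (p q c : R) (z : C) (xi : R) (u : C) : C :=
  (Cpower (u - z) p * Cpower (u - Cconj z) q * Cpower u (- c / 2) * Cpower (u - xi) (- c / 2))%C.

Definition kern' (p q c : R) (z : C) (xi : R) (u : C) : C :=
  (kern p q c z xi u *
   (p / (u - z) + q / (u - Cconj z) + (- c / 2)%R / u + (- c / 2)%R / (u - xi)))%C.

(** The alternatives [u x = z x] and [u x = Cconj (z x)] admit the ends of the contour, where the
    corresponding factor is continuous but need not be differentiable. *)
Lemma Ccont_kern {T : UniformSpace} p q c (z u : T -> C) (xi : T -> R) x :
  Ccont z x -> Ccont u x -> continuous xi x ->
  (slit (u x - z x) \/ u x = z x /\ 0 <= p) ->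
  (slit (u x - Cconj (z x)) \/ u x = Cconj (z x) /\ 0 <= q) -> slit (u x) -> slit (u x - xi x) ->
  Ccont (fun t => kern p q c (z t) (xi t) (u t)) x.
Proof.
intros Hz Hu Hxi H1 H2 H3 H4.
assert (P : forall a (v : T -> C), Ccont v x -> (slit (u x - v x) \/ u x = v x /\ 0 <= a) ->
  Ccont (fun t => Cpower (u t - v t) a) x).
{ intros a v Hv [H|[E H]].
  - apply (Ccont_power (fun t => u t - v t)%C); auto. now apply Ccont_minus.
  - apply (Ccont_power_0 (fun t => u t - v t)%C); auto. now apply Ccont_minus. rewrite E; ring. }
apply Ccont_mult; [apply Ccont_mult; [apply Ccont_mult|]|].
- now apply P.
- apply (P q (fun t => Cconj (z t))); auto. now apply Ccont_conj.
- now apply Ccont_power.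
- apply (P (- c / 2) (fun t => RtoC (xi t))); auto. now apply Ccont_RtoC.
Qed.

Lemma is_holo_power_shift a (v w : C) : slit (w - v) ->
  is_holo (fun u => Cpower (u - v) a) w (Cpower (w - v) a * (a / (w - v)))%C.
Proof.
intros H. eapply is_holo_val.
- apply (is_holo_comp (fun u => Cpower u a) (fun u => u - v)%C w).
  + apply is_holo_minus. apply is_holo_id. apply is_holo_const.
  + now apply Cpower_holo.
- field. now apply slit_neq_0.
Qed.

Lemma kern_holo p q c z (xi : R) u : slit (u - z) -> slit (u - Cconj z) -> slit u -> slit (u - xi) ->
  is_holo (kern p q c z xi) u (kern' p q c z xi u).
Proof.
intros H1 H2 H3 H4. unfold kern', kern. eapply is_holo_val.
- apply (is_holo_mult (fun u => Cpower (u - z) p * Cpower (u - Cconj z) q * Cpower u (- c / 2))%C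
     (fun u => Cpower (u - xi) (- c / 2))).
  apply (is_holo_mult (fun u => Cpower (u - z) p * Cpower (u - Cconj z) q)%C (fun u => Cpower u (- c / 2))).
  apply (is_holo_mult (fun u => Cpower (u - z) p)%C (fun u => Cpower (u - Cconj z) q)).
  + now apply is_holo_power_shift.
  + now apply is_holo_power_shift.
  + now apply Cpower_holo.
  + now apply is_holo_power_shift.
- cbv beta. field. repeat split; now apply slit_neq_0.
Qed.

Lemma Ccont_kern' {T : UniformSpace} p q c z (xi : R) (u : T -> C) x : Ccont u x ->
  slit (u x - z) -> slit (u x - Cconj z) -> slit (u x) -> slit (u x - xi) ->
  Ccont (fun t => kern' p q c z xi (u t)) x.
Proof.
intros Hu H1 H2 H3 H4. apply Ccont_mult.
- apply (Ccont_kern p q c (fun _ => z) u (fun _ => xi)); auto using Ccont_const, cont_const.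
- assert (P : forall (k v : C), slit (u x - v) -> Ccont (fun t => k / (u t - v))%C x).
  { intros k v Hv. apply (Ccont_div (fun _ => k) (fun t => u t - v)%C).
    apply Ccont_const. apply Ccont_minus; [exact Hu|apply Ccont_const]. now apply slit_neq_0. }
  apply Ccont_plus; [apply Ccont_plus; [apply Ccont_plus|]|].
  + now apply P.
  + now apply P.
  + apply (Ccont_div (fun _ => RtoC (- c / 2)) u). apply Ccont_const. exact Hu. now apply slit_neq_0.
  + now apply P.
Qed.

Lemma Carg_conj w : slit w -> Carg (Cconj w) = - Carg w.
Proof.
intros Hs. destruct (Rlt_dec 0 (Re w)) as [Hr|Hr]; [|destruct (Rlt_dec 0 (Im w)) as [Hi|Hi]].
- rewrite !Carg_right by assumption. rewrite <- atan_opp. f_equal. unfold Re, Im; simpl. unfold Rdiv; ring.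
- rewrite Carg_down, (Carg_up w) by (try assumption; unfold Im in *; simpl; lra).
  replace (Re (Cconj w) / Im (Cconj w)) with (- (Re w / Im w)).
  rewrite atan_opp; lra. unfold Re, Im in *; simpl; field; lra.
- assert (Hi' : Im w < 0) by (destruct Hs; lra).
  rewrite Carg_up, (Carg_down w) by (try assumption; unfold Im in *; simpl; lra).
  replace (Re (Cconj w) / Im (Cconj w)) with (- (Re w / Im w)).
  rewrite atan_opp; lra. unfold Re, Im in *; simpl; field; lra.
Qed.

Lemma Cmod_conj w : Cmod (Cconj w) = Cmod w.
Proof. unfold Cmod; f_equal; simpl; ring. Qed.

Lemma Cexp_conj w : Cexp (Cconj w) = Cconj (Cexp w).
Proof. apply C_eq; unfold Cexp, Re, Im; simpl; rewrite ?cos_neg, ?sin_neg; ring. Qed.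

Lemma Cpower_conj w a : slit w \/ w = 0%C -> Cpower (Cconj w) a = Cconj (Cpower w a).
Proof.
intros [H|H].
- assert (Hc : Cconj w <> 0%C).
  { intros E. apply (slit_neq_0 _ H). apply C_eq.
    now injection E. injection E; intros; simpl in *. unfold Im; simpl; lra. }
  rewrite !Cpower_nz, <- Cexp_conj by (auto using slit_neq_0). f_equal.
  apply C_eq; unfold Clog; rewrite Cmod_conj, Carg_conj by assumption; unfold Re, Im; simpl; ring.
- rewrite H. replace (Cconj 0) with (RtoC 0) by (apply C_eq; unfold Re, Im; simpl; ring).
  unfold Cpower; destruct Ceq_dec as [_|n]; [|now elim n].
  destruct Req_EM_T; apply C_eq; unfold Re, Im; simpl; ring.
Qed.

Lemma Cconj_minus u v : Cconj (u - v) = (Cconj u - Cconj v)%C.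
Proof. apply C_eq; unfold Re, Im; simpl; ring. Qed.

Lemma Cconj_mult u v : Cconj (u * v) = (Cconj u * Cconj v)%C.
Proof. apply C_eq; unfold Re, Im; simpl; ring. Qed.

Lemma Cconj_plus u v : Cconj (u + v) = (Cconj u + Cconj v)%C.
Proof. apply C_eq; unfold Re, Im; simpl; ring. Qed.

Lemma Cconj_invol u : Cconj (Cconj u) = u.
Proof. apply C_eq; unfold Re, Im; simpl; ring. Qed.

Lemma Cconj_R (r : R) : Cconj r = r.
Proof. apply C_eq; unfold Re, Im; simpl; ring. Qed.

Lemma slit_conj w : slit w -> slit (Cconj w).
Proof. intros [H|H]; [left|right]; unfold Re, Im in *; simpl; lra. Qed.

Lemma kern_conj p q c z (xi : R) u : (slit (u - z) \/ u = z) -> slit (u - Cconj z) -> slit u -> slit (u - xi) ->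
  kern p q c z xi (Cconj u) = Cconj (kern q p c z xi u).
Proof.
intros H1 H2 H3 H4. unfold kern. rewrite !Cconj_mult, <- !Cpower_conj; auto.
- rewrite !Cconj_minus, Cconj_invol, Cconj_R. ring.
- destruct H1 as [H|H]; [now left|right]. rewrite H; ring.
Qed.

(** * The homotopy from the arc to the segment *)

Definition polar (r th : R) : C := (r * cos th, r * sin th).

Lemma polar_Carg z : 0 < Im z -> polar (Cmod z) (Carg z) = z.
Proof.
intros H. assert (Hs : slit z) by (right; lra).
pose proof (Cmod_pos z Hs) as Hp.
unfold Carg. destruct (Rlt_dec (Im z) 0) as [?|_]; [lra|].
destruct (Carg_quot_bounds z); [lra|].
unfold polar. rewrite cos_acos, sin_acos, sqrt_1m, Rabs_pos_eq by (try lra; now apply slit_neq_0).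
apply C_eq; simpl; field; lra.
Qed.

Lemma Carg_bounds z : 0 < Im z -> 0 < Carg z < PI.
Proof.
intros H. unfold Carg. destruct (Rlt_dec (Im z) 0) as [?|_]; [lra|].
apply acos_bound_lt. apply Carg_quot_bounds; lra.
Qed.

Lemma is_Cderive_polar r (k t : R) :
  is_Cderive (fun s => polar r (k * s)) t (k * (Ci * polar r (k * t)))%C.
Proof.
split; unfold polar, Re, Im; simpl; auto_derive; try easy; ring.
Qed.

Lemma Ccont_polar {T : UniformSpace} (r th : T -> R) x : continuous r x -> continuous th x ->
  Ccont (fun t => polar (r t) (th t)) x.
Proof.
intros Hr Ht. apply Ccont_pair; apply cont_mult; auto.
- apply (cont_fun cos); auto. apply continuous_cos.
- apply (cont_fun sin); auto. apply continuous_sin.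
Qed.

Definition seg (s : R) (z : C) (t : R) : C := (s + t * (z - s))%C.

(* On the circle of radius [Cmod z] about 0 the quotient [(u - z) (u - Cconj z) / u] is real. *)
Definition arc (z : C) (t : R) : C := polar (Cmod z) (Carg z * t).

Lemma Im_arc_pos z t : 0 < Im z -> 0 < t <= 1 -> 0 < Im (arc z t).
Proof.
intros Hz Ht. destruct (Carg_bounds z Hz).
apply Rmult_lt_0_compat. apply Cmod_pos; right; lra. apply sin_gt_0; nra.
Qed.

(** Cosine decreases on [[0, PI]], so the arc stays to the right of its endpoint; this keeps [u - z]
    off the branch cut. *)
Lemma Re_arc_gt z t : 0 < Im z -> 0 <= t < 1 -> Re z < Re (arc z t).
Proof.
intros Hz Ht. destruct (Carg_bounds z Hz).
rewrite <- (polar_Carg z Hz) at 1. unfold arc, polar, Re; simpl.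
apply Rmult_lt_compat_l. apply Cmod_pos; right; lra.
apply cos_decreasing_1; nra.
Qed.

Section Homotopy.
Variables (z : C) (s xi : R).
Hypotheses (Hz : 0 < Im z) (Hxi : 0 <= xi < Cmod z) (Hs : xi < s) (Hsz : Re z <= s).
Let H := lin_hom (arc z) (seg s z).

Lemma Re_seg t : Re (seg s z t) = s + t * (Re z - s).
Proof. unfold seg, Re; simpl; ring. Qed.

Lemma Im_seg t : Im (seg s z t) = t * Im z.
Proof. unfold seg, Im; simpl; ring. Qed.

Lemma Re_hom l t : Re (H l t) = (1 - l) * Re (arc z t) + l * Re (seg s z t).
Proof. unfold H, lin_hom, Re; simpl; ring. Qed.

Lemma Im_hom l t : Im (H l t) = (1 - l) * Im (arc z t) + l * Im (seg s z t).
Proof. unfold H, lin_hom, Im; simpl; ring. Qed.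

Lemma arc_0 : arc z 0 = Cmod z.
Proof. unfold arc, polar. rewrite Rmult_0_r, cos_0, sin_0. apply C_eq; simpl; ring. Qed.

Lemma arc_1 : arc z 1 = z.
Proof. unfold arc. rewrite Rmult_1_r. now apply polar_Carg. Qed.

Lemma seg_0 : seg s z 0 = s.
Proof. unfold seg. ring. Qed.

Lemma seg_1 : seg s z 1 = z.
Proof. unfold seg. ring. Qed.

Lemma hom_1 l : H l 1 = z.
Proof. unfold H, lin_hom. rewrite arc_1, seg_1. rewrite RtoC_minus. ring. Qed.

(** For [t = 0] the homotopy moves on the real axis between [Cmod z] and [s], both beyond [xi]; for
    [t > 0] it lies in the open upper half-plane. Taking any [e] in [[0, xi]] treats the branch
    points 0 and [xi] at once. *)
Lemma hom_slit_xi l t (e : R) : 0 <= e <= xi -> 0 <= l <= 1 -> 0 <= t <= 1 -> slit (H l t - e).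
Proof.
intros He Hl Ht. destruct (Req_dec t 0) as [->|Ht0].
- left. replace (Re (H l 0 - e)%C) with (Re (H l 0) - e) by (unfold Re; simpl; ring).
  rewrite Re_hom, arc_0, Re_seg. simpl. destruct (Req_dec l 0) as [->|]; nra.
- right. replace (Im (H l t - e)%C) with (Im (H l t)) by (unfold Im; simpl; ring).
  rewrite Im_hom, Im_seg. pose proof (Im_arc_pos z t Hz ltac:(lra)).
  destruct (Req_dec l 0) as [->|]; [nra|]. assert (0 < l * (t * Im z)) by (apply Rmult_lt_0_compat; nra). nra.
Qed.

Lemma hom_slit l t : 0 <= l <= 1 -> 0 <= t <= 1 -> slit (H l t).
Proof.
intros Hl Ht. replace (H l t) with (H l t - 0%R)%C by ring. apply hom_slit_xi; auto; lra.
Qed.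

Lemma hom_slit_conj l t : 0 <= l <= 1 -> 0 <= t <= 1 -> slit (H l t - Cconj z).
Proof.
intros Hl Ht. right. replace (Im (H l t - Cconj z)%C) with (Im (H l t) + Im z) by (unfold Im; simpl; ring).
rewrite Im_hom, Im_seg.
assert (0 <= Im (arc z t)).
{ destruct (Req_dec t 0) as [->|]. rewrite arc_0; simpl; lra. left; apply Im_arc_pos; lra. }
assert (0 <= l * (t * Im z)) by (apply Rmult_le_pos; nra). nra.
Qed.

(** For [l < 1] the point lies strictly to the right of [z], since the arc does and [Re z <= s]
    keeps the segment from lying to the left. For [l = 1] it may be vertically below [z], and the
    imaginary part decides. *)
Lemma hom_slit_z l t : 0 <= l <= 1 -> 0 <= t < 1 -> slit (H l t - z).
Proof.
intros Hl Ht. destruct (Req_dec l 1) as [->|Hl1].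
- right. replace (Im (H 1 t - z)%C) with (Im (H 1 t) - Im z) by (unfold Im; simpl; ring).
  rewrite Im_hom, Im_seg. nra.
- left. replace (Re (H l t - z)%C) with (Re (H l t) - Re z) by (unfold Re; simpl; ring).
  rewrite Re_hom, Re_seg. pose proof (Re_arc_gt z t Hz Ht).
  assert (0 < (1 - l) * (Re (arc z t) - Re z)) by (apply Rmult_lt_0_compat; lra).
  assert (0 <= l * ((1 - t) * (s - Re z))) by (apply Rmult_le_pos; [lra|apply Rmult_le_pos; lra]). nra.
Qed.

Lemma hom_slit_z' l t : 0 <= l <= 1 -> 0 <= t <= 1 -> slit (H l t - z) \/ H l t = z.
Proof.
intros Hl Ht. destruct (Req_dec t 1) as [->|H1]. right; apply hom_1. left; apply hom_slit_z; lra.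
Qed.

Lemma is_Cderive_seg t : is_Cderive (seg s z) t (z - s)%C.
Proof.
unfold seg. eapply is_Cderive_val.
apply is_Cderive_plus. apply is_Cderive_const. apply is_Cderive_mult.
apply is_Cderive_RtoC, is_derive_id. apply is_Cderive_const.
apply C_eq; unfold Re, Im, one; simpl; ring.
Qed.

Definition arc' (t : R) : C := (Carg z * (Ci * arc z t))%C.

Lemma is_Cderive_arc t : is_Cderive (arc z) t (arc' t).
Proof. apply is_Cderive_polar. Qed.

Lemma Ccont_arc t : Ccont (arc z) t.
Proof. exact (Ccont_of_deriv _ _ _ (is_Cderive_arc t)). Qed.

Lemma Ccont_seg t : Ccont (seg s z) t.
Proof. exact (Ccont_of_deriv _ _ _ (is_Cderive_seg t)). Qed.

Lemma Ccont_arc' t : Ccont arc' t.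
Proof. apply Ccont_mult; [apply Ccont_const|apply Ccont_mult; [apply Ccont_const|apply Ccont_arc]]. Qed.

Lemma Ccont_kern_hom p q c l t : 0 <= p -> 0 <= q -> 0 <= l <= 1 -> 0 <= t <= 1 ->
  Ccont (fun r : R * R => kern p q c z xi (H (fst r) (snd r))) (l, t).
Proof.
intros Hp Hq Hl Ht.
apply (Ccont_kern p q c (fun _ => z) (fun r : R * R => H (fst r) (snd r)) (fun _ => xi)); simpl;
  auto using Ccont_const, cont_const.
- apply Ccont_lin_hom; auto using Ccont_arc, Ccont_seg.
- destruct (hom_slit_z' l t Hl Ht) as [h|h]; [now left|right; split; auto].
- left; now apply hom_slit_conj.
- now apply hom_slit.
- apply hom_slit_xi; auto; lra.
Qed.

Definition real_axis_int p q c : C :=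
  CRInt (fun l => kern p q c z xi ((1 - l) * Cmod z + l * s)%R * (s - Cmod z))%C 0 1.

(** Both curves end at [z], but one starts at [Cmod z] and the other at [s]; the integral along the
    real axis joins the two starting points. *)
Lemma arc_seg p q c : 0 <= p -> 0 <= q ->
  CRInt (fun t => kern p q c z xi (arc z t) * arc' t)%C 0 1 =
  (CRInt (fun t => kern p q c z xi (seg s z t) * (z - s))%C 0 1 + real_axis_int p q c)%C.
Proof.
intros Hp Hq.
rewrite (deform (kern p q c z xi) (kern' p q c z xi) (arc z) (seg s z) arc' (fun _ => z - s)%C);
  auto using is_Cderive_arc, is_Cderive_seg, Ccont_arc', Ccont_const.
- f_equal. apply CRInt_ext. lra. intros l Hl. rewrite arc_0, seg_0. f_equal. f_equal.
  unfold lin_hom. rewrite arc_0, seg_0. rewrite RtoC_plus, !RtoC_mult. reflexivity.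
- rewrite arc_1, seg_1; reflexivity.
- intros l t Hl Ht. split.
  + apply kern_holo. apply hom_slit_z; auto. apply hom_slit_conj; auto; lra. apply hom_slit; auto; lra. apply hom_slit_xi; auto; lra.
  + apply (Ccont_kern' p q c z xi (fun r : R * R => H (fst r) (snd r))); simpl.
    apply Ccont_lin_hom; auto using Ccont_arc, Ccont_seg.
    apply hom_slit_z; auto. apply hom_slit_conj; auto; lra. apply hom_slit; auto; lra. apply hom_slit_xi; auto; lra.
- intros l t Hl Ht. now apply Ccont_kern_hom.
Qed.

Lemma hom_0 l : H l 0 = ((1 - l) * Cmod z + l * s)%R.
Proof. unfold H, lin_hom. rewrite arc_0, seg_0, RtoC_plus, !RtoC_mult. reflexivity. Qed.

Lemma hom_seg t : H 1 t = seg s z t.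
Proof. unfold H, lin_hom. rewrite RtoC_minus. ring. Qed.

(** Conjugation fixes the points of the real axis, so it acts on the kernel only by exchanging the
    exponents at [z] and [Cconj z]. *)
Lemma real_axis_int_conj p q c : 0 <= p -> 0 <= q -> Cconj (real_axis_int p q c) = real_axis_int q p c.
Proof.
intros Hp Hq. unfold real_axis_int. rewrite <- CRInt_conj.
- apply CRInt_ext. lra. intros l Hl. rewrite Cconj_mult.
  rewrite <- kern_conj; rewrite <- ?hom_0.
  + rewrite hom_0, !Cconj_R, Cconj_minus, !Cconj_R. reflexivity.
  + left; apply hom_slit_z; lra.
  + apply hom_slit_conj; lra.
  + apply hom_slit; lra.
  + apply hom_slit_xi; lra.
- lra.
- intros l Hl. apply Ccont_mult. 2: apply Ccont_const.
  apply Ccont_ext_loc with (fun l => kern p q c z xi (H l 0)).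
  { apply filter_forall; intros l'; now rewrite hom_0. }
  destruct (Ccont_kern_hom p q c l 0 Hp Hq Hl) as [h1 h2]; try lra. split.
  apply (cont_slice_l (fun l t => Re (kern p q c z xi (H l t)))); auto.
  apply (cont_slice_l (fun l t => Im (kern p q c z xi (H l t)))); auto.
Qed.

Lemma Ccont_kern_seg p q c t : 0 <= p -> 0 <= q -> 0 <= t <= 1 -> Ccont (fun t => kern p q c z xi (seg s z t) * (z - s))%C t.
Proof.
intros Hp Hq Ht. apply Ccont_mult. 2: apply Ccont_const.
apply Ccont_ext_loc with (fun t => kern p q c z xi (H 1 t)).
{ apply filter_forall; intros t'; now rewrite hom_seg. }
apply (Ccont_slice_r (fun l t => kern p q c z xi (H l t))), Ccont_kern_hom; auto; lra.
Qed.

Lemma Cint_segment_up p q c : 0 <= p -> 0 <= q ->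
  Cint_segment (kern p q c z xi) s z = CRInt (fun t => kern p q c z xi (seg s z t) * (z - s))%C 0 1.
Proof.
intros Hp Hq. unfold Cint_segment. apply (RInt_CRInt (fun t => kern p q c z xi (seg s z t) * (z - s))%C).
lra. intros t Ht. now apply Ccont_kern_seg.
Qed.

Lemma RInt_flip (f : R -> R) : (forall t, 0 <= t <= 1 -> continuous f t) ->
  is_RInt (fun t => f (1 - t)) 0 1 (RInt f 0 1).
Proof.
intros Hf.
assert (e : ex_RInt f 0 1) by (apply ex_RInt_cont; auto; lra).
assert (h : is_RInt (fun y => scal (-1) (f (-1 * y + 1))) 0 1 (RInt f 1 0)).
{ apply (is_RInt_comp_lin (V := R_NormedModule) f (-1) 1 0 1).
  replace (-1 * 0 + 1) with 1 by ring. replace (-1 * 1 + 1) with 0 by ring.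
  apply (RInt_correct (V := R_CompleteNormedModule)). now apply ex_RInt_swap. }
apply (is_RInt_scal (V := R_NormedModule) _ _ _ (-1)) in h.
replace (RInt f 0 1) with (scal (-1) (RInt f 1 0)).
2:{ rewrite <- (opp_RInt_swap (V := R_CompleteNormedModule) f 0 1 e). unfold scal, opp; simpl. unfold mult; simpl. ring. }
apply is_RInt_ext with (2 := h). intros t _. unfold scal; simpl. unfold mult; simpl.
replace (1 - t) with (-1 * t + 1) by ring. ring.
Qed.

(** The lower half of the path is the mirror image of the upper half run backwards: hence the
    conjugate, the sign, and the exchange of [p] and [q]. *)
Lemma Cint_segment_down p q c : 0 <= p -> 0 <= q ->
  Cint_segment (kern p q c z xi) (Cconj z) s =
  (- Cconj (CRInt (fun t => kern q p c z xi (seg s z t) * (z - s)) 0 1))%C.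
Proof.
intros Hp Hq. set (g := fun t => (kern q p c z xi (seg s z t) * (z - s))%C).
assert (Hg : forall t, 0 <= t <= 1 -> Ccont g t) by (intros; now apply Ccont_kern_seg).
unfold Cint_segment. apply (is_RInt_unique (V := C_R_CompleteNormedModule)).
apply (is_RInt_ext (V := C_R_NormedModule)) with (fun t => (- Cconj (g (1 - t)%R))%C).
{ rewrite Rmin_left, Rmax_right by lra. intros t Ht. unfold g.
  match goal with |- @eq _ ?a ?b => change (@eq C a b) end.
  rewrite Cconj_mult, <- kern_conj; rewrite <- ?hom_seg.
  - replace (Cconj z + t * (s - Cconj z))%C with (Cconj (H 1 (1 - t))).
    + rewrite Cconj_minus, Cconj_R. ring.
    + rewrite hom_seg. unfold seg. rewrite Cconj_plus, Cconj_mult, Cconj_minus, !Cconj_R, RtoC_minus. ring.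
  - left. apply hom_slit_z; lra.
  - apply hom_slit_conj; lra.
  - apply hom_slit; lra.
  - apply hom_slit_xi; lra. }
apply (is_RInt_fct_extend_pair (U := R_NormedModule) (V := R_NormedModule)); simpl.
- apply (is_RInt_opp (V := R_NormedModule) (fun t => Re (g (1 - t)))).
  apply (RInt_flip (fun t => Re (g t))). intros t Ht; exact (proj1 (Hg t Ht)).
- apply is_RInt_ext with (fun t => Im (g (1 - t))). intros t _; symmetry; apply Ropp_involutive.
  rewrite Ropp_involutive.
  apply (RInt_flip (fun t => Im (g t))). intros t Ht; exact (proj2 (Hg t Ht)).
Qed.

Definition arc_int p q c : C := CRInt (fun t => kern p q c z xi (arc z t) * arc' t)%C 0 1.

(** The real-axis contributions of the two halves cancel by [real_axis_int_conj], and with them the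
    crossing point [s] leaves the right-hand side. *)
Lemma contour_arc p q c : 0 <= p -> 0 <= q ->
  (Cint_segment (kern p q c z xi) (Cconj z) s + Cint_segment (kern p q c z xi) s z)%C =
  (arc_int p q c - Cconj (arc_int q p c))%C.
Proof.
intros Hp Hq. rewrite Cint_segment_up, Cint_segment_down by assumption.
unfold arc_int. rewrite !arc_seg, Cconj_plus, real_axis_int_conj by assumption. ring.
Qed.

End Homotopy.

(** * The integrand on the circle at [xi = 0] *)

Lemma polar_mult r s a b : (polar r a * polar s b)%C = polar (r * s) (a + b).
Proof. apply C_eq; unfold polar, Re, Im; simpl; rewrite ?cos_plus, ?sin_plus; ring. Qed.

Lemma polar_scal (k r a : R) : (k * polar r a)%C = polar (k * r) a.
Proof. apply C_eq; unfold polar, Re, Im; simpl; ring. Qed.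

Lemma polar_conj r a : Cconj (polar r a) = polar r (- a).
Proof. apply C_eq; unfold polar, Re, Im; simpl; rewrite ?cos_neg, ?sin_neg; ring. Qed.

Lemma Ci_polar r a : (Ci * polar r a)%C = polar r (a + PI / 2).
Proof.
apply C_eq; unfold polar, Re, Im; simpl; rewrite ?cos_plus, ?sin_plus, cos_PI2, sin_PI2; ring.
Qed.

Lemma Cmod_polar r a : 0 < r -> Cmod (polar r a) = r.
Proof.
intros H. unfold Cmod, polar; cbn [fst snd].
replace ((r * cos a) ^ 2 + (r * sin a) ^ 2) with (r ^ 2 * ((sin a)² + (cos a)²)) by (unfold Rsqr; ring).
rewrite sin2_cos2, Rmult_1_r. apply sqrt_pow2; lra.
Qed.

Lemma Carg_polar r a : 0 < r -> - PI < a < PI -> Carg (polar r a) = a.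
Proof.
intros Hr Ha. unfold Carg. rewrite Cmod_polar by assumption.
replace (Re (polar r a) / r) with (cos a) by (unfold polar, Re; simpl; field; lra).
replace (Im (polar r a)) with (r * sin a) by reflexivity.
destruct (Rlt_dec (r * sin a) 0) as [h|h].
- assert (a < 0).
  { destruct (Rle_lt_dec 0 a); auto. assert (0 <= sin a) by (apply sin_ge_0; lra). nra. }
  rewrite <- (cos_neg a), acos_cos; lra.
- assert (0 <= a).
  { destruct (Rle_lt_dec 0 a); auto. assert (sin a < 0) by (apply sin_lt_0_var; lra). nra. }
  rewrite acos_cos; lra.
Qed.

Lemma Cpower_polar r a p : 0 < r -> - PI < a < PI -> Cpower (polar r a) p = polar (Rpower r p) (p * a).
Proof.
intros Hr Ha. rewrite Cpower_nz.
- unfold Clog. rewrite Cmod_polar, Carg_polar by assumption.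
  unfold Cexp, Rpower, polar. rewrite Re_scal, Im_scal. reflexivity.
- apply Cmod_gt_0. now rewrite Cmod_polar.
Qed.

(** A chord of the circle is perpendicular to the radius at the mean angle, and its length is [2 r]
    times the sine of half the difference of the angles. The form below is the same with the second
    angle negated and the opposite orientation. *)
Lemma polar_minus_up r a b : (polar r a - polar r b)%C = polar (2 * r * sin ((b - a) / 2)) ((a + b) / 2 - PI / 2).
Proof.
assert (Ea : a = (a + b) / 2 - (b - a) / 2) by field.
assert (Eb : b = (a + b) / 2 + (b - a) / 2) by field.
set (u := (a + b) / 2) in *. set (v := (b - a) / 2) in *. rewrite Ea, Eb.
apply C_eq; unfold polar, Re, Im; simpl;
  rewrite ?cos_minus, ?sin_minus, ?cos_plus, ?sin_plus, cos_PI2, sin_PI2; ring.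
Qed.

Lemma polar_minus_down r a b : (polar r a - polar r (- b))%C = polar (2 * r * sin ((a + b) / 2)) ((a - b) / 2 + PI / 2).
Proof.
assert (Ea : a = (a + b) / 2 + (a - b) / 2) by field.
assert (Eb : - b = (a - b) / 2 - (a + b) / 2) by field.
set (u := (a + b) / 2) in *. set (v := (a - b) / 2) in *. rewrite Ea, Eb.
apply C_eq; unfold polar, Re, Im; simpl;
  rewrite ?cos_minus, ?sin_minus, ?cos_plus, ?sin_plus, cos_PI2, sin_PI2; ring.
Qed.

Lemma Rpower_pos x a : 0 < Rpower x a.
Proof. apply exp_pos. Qed.

(** For [0 < t < 1] every base has a positive modulus and an argument inside [(- PI, PI)], so a
    principal power just multiplies the argument by the exponent. The power [1 - c] of [R] collects
    [u^(- c / 2)] twice and the factor [u] of the velocity. *)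
Lemma kern_arc_0 z p q c t : 0 < Im z -> 0 < t < 1 ->
  let R := Cmod z in let h := Carg z in
  (kern p q c z 0 (arc z t) * arc' z t)%C =
  polar (h * Rpower (2 * R * sin ((h - h * t) / 2)) p * Rpower (2 * R * sin ((h * t + h) / 2)) q * Rpower R (1 - c))
        (p * ((h * t + h) / 2 - PI / 2) + q * ((h * t - h) / 2 + PI / 2) + (1 - c) * (h * t) + PI / 2).
Proof.
intros Hz Ht R h.
assert (HR : 0 < R) by (apply Cmod_pos; right; lra).
destruct (Carg_bounds z Hz) as [Hh1 Hh2]. fold h in Hh1, Hh2.
assert (Hht : 0 < h * t < h) by nra.
unfold kern, arc', arc. fold R h.
rewrite <- (polar_Carg z Hz) at 1 2. fold R h.
replace (polar R (h * t) - 0%R)%C with (polar R (h * t)) by ring.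
rewrite polar_conj, polar_minus_up, polar_minus_down, Ci_polar, polar_scal.
rewrite !Cpower_polar; try lra.
2:{ apply Rmult_lt_0_compat. lra. apply sin_gt_0; lra. }
2:{ apply Rmult_lt_0_compat. lra. apply sin_gt_0; lra. }
rewrite !polar_mult. f_equal.
- replace (Rpower R (1 - c)) with (Rpower R (- c / 2) * Rpower R (- c / 2) * R). ring.
  rewrite <- (Rpower_1 R HR) at 3. rewrite <- !Rpower_plus. f_equal; field.
- field.
Qed.

Lemma Rpower_sqr x : 0 < x -> Rpower x 2 = x * x.
Proof. intros H. replace 2 with (1 + 1) by ring. rewrite Rpower_plus, Rpower_1; auto. Qed.

(** The integral over [[0, h]] in the formula for [K], pulled back to [[0, 1]] by [v = h t]. *)
Definition Nint (al h : R) : R :=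
  RInt (fun t => h * Rpower (cos (h * t) - cos h) (al - 2) * (1 - cos (h * t) * cos h)) 0 1.

Lemma polar_add_r r s a : (polar r a + polar s a)%C = polar (r + s) a.
Proof. apply C_eq; unfold polar, Re, Im; simpl; ring. Qed.

(** The two summands share [(s1 s2)^(al - 2)] and leave [s1^2 + s2^2]. In half-angles, the product
    of the chords is [2 R^2 (cos (h t) - cos h)] and the sum of their squares is
    [4 R^2 (1 - cos (h t) cos h)]. *)
Lemma arc_integrand_sum al R h t : 0 < R -> 0 < h < PI -> 0 < t < 1 ->
  let s1 := 2 * R * sin ((h - h * t) / 2) in let s2 := 2 * R * sin ((h * t + h) / 2) in
  h * Rpower s1 al * Rpower s2 (al - 2) * Rpower R (1 - al) +
  h * Rpower s1 (al - 2) * Rpower s2 al * Rpower R (1 - al) =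
  Rpower R (al - 1) * Rpower 2 al * (h * Rpower (cos (h * t) - cos h) (al - 2) * (1 - cos (h * t) * cos h)).
Proof.
intros HR Hh Ht s1 s2.
assert (Hht : 0 < h * t < h) by nra.
assert (H1 : 0 < s1) by (apply Rmult_lt_0_compat; [lra|apply sin_gt_0; lra]).
assert (H2 : 0 < s2) by (apply Rmult_lt_0_compat; [lra|apply sin_gt_0; lra]).
set (u := (h - h * t) / 2) in *. set (v := (h * t + h) / 2) in *.
assert (Et : h * t = v - u) by (unfold u, v; field).
assert (Eh : h = v + u) by (unfold u, v; field).
assert (E1 : s1 * s2 = 2 * (R * R) * (cos (h * t) - cos h)).
{ rewrite Et, Eh at 1. unfold s1, s2. rewrite cos_minus, cos_plus. ring. }
assert (E2 : s1 * s1 + s2 * s2 = 4 * (R * R) * (1 - cos (h * t) * cos h)).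
{ rewrite Et, Eh at 1. unfold s1, s2. rewrite cos_minus, cos_plus.
  pose proof (sin2_cos2 u) as Eu. pose proof (sin2_cos2 v) as Ev. unfold Rsqr in *.
  replace (cos v * cos v) with (1 - sin v * sin v) by lra.
  transitivity (4 * (R * R) * (sin u * sin u + sin v * sin v)). ring. 
  replace ((cos v * cos u + sin v * sin u) * (cos v * cos u - sin v * sin u))
    with (cos v * cos v * (cos u * cos u) - sin v * sin v * (sin u * sin u)) by ring.
  replace (cos v * cos v) with (1 - sin v * sin v) by lra.
  replace (cos u * cos u) with (1 - sin u * sin u) by lra. ring. }
assert (HX : 0 < cos (h * t) - cos h).
{ assert (0 < s1 * s2) by nra. rewrite E1 in H. apply Rmult_lt_reg_l with (2 * (R * R)). nra. lra. }
replace (Rpower s1 al) with (Rpower s1 (al - 2) * (s1 * s1)) by (rewrite <- Rpower_sqr, <- Rpower_plus by assumption; f_equal; ring).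
replace (Rpower s2 al) with (Rpower s2 (al - 2) * (s2 * s2)) by (rewrite <- Rpower_sqr, <- Rpower_plus by assumption; f_equal; ring).
transitivity (h * (Rpower s1 (al - 2) * Rpower s2 (al - 2)) * (s1 * s1 + s2 * s2) * Rpower R (1 - al)). ring.
rewrite Rpower_mult_distr, E1, E2 by assumption.
rewrite <- !Rpower_mult_distr by nra.
replace (Rpower R (al - 1)) with (Rpower R (al - 2) * Rpower R (al - 2) * (R * R) * Rpower R (1 - al)).
replace (Rpower 2 al) with (Rpower 2 (al - 2) * (2 * 2)). ring.
rewrite <- Rpower_sqr, <- Rpower_plus by lra; f_equal; ring.
rewrite <- (Rpower_sqr R), <- !Rpower_plus by assumption; f_equal; ring.
Qed.

Definition M_prefactor (al : R) (z : C) (xi : R) : C :=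
  (Rpower (Im z) (al - 2)
   * Cpower z (- al / 2) * Cpower (z - xi) (- al / 2)
   * Cpower (Cconj z) (1 - al / 2) * Cpower (Cconj z - xi) (1 - al / 2))%C.

(** [M] with its contour moved to the arc: free of the crossing point and regular at [xi = 0]. *)
Definition Marc (al : R) (z : C) (xi : R) : C :=
  (M_prefactor al z xi * (arc_int z xi al (al - 2) al - Cconj (arc_int z xi (al - 2) al al)))%C.

Lemma M_eq_Marc al s z xi : 2 <= al -> 0 < Im z -> 0 <= xi < Cmod z -> xi < s -> Re z <= s ->
  M al s z xi = Marc al z xi.
Proof.
intros Hal Hz Hxi Hs Hsz. unfold Marc. rewrite <- contour_arc with (s := s); auto; lra || reflexivity.
Qed.

Lemma slit_arc_xi z xi t : 0 < Im z -> xi < Cmod z -> 0 <= t <= 1 -> slit (arc z t - xi).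
Proof.
intros Hz Hxi Ht. destruct (Req_dec t 0) as [->|Ht0].
- left. rewrite arc_0. unfold Re; simpl; lra.
- right. replace (Im (arc z t - xi)%C) with (Im (arc z t)) by (unfold Im; simpl; ring).
  pose proof (Im_arc_pos z t Hz ltac:(lra)). lra.
Qed.

Lemma slit_arc z t : 0 < Im z -> 0 <= t <= 1 -> slit (arc z t).
Proof.
intros Hz Ht. replace (arc z t) with (arc z t - 0%R)%C by ring. apply slit_arc_xi; auto.
apply Cmod_pos; right; lra.
Qed.

Lemma slit_arc_conj z t : 0 < Im z -> 0 <= t <= 1 -> slit (arc z t - Cconj z).
Proof.
intros Hz Ht. right. replace (Im (arc z t - Cconj z)%C) with (Im (arc z t) + Im z) by (unfold Im; simpl; ring).
destruct (Req_dec t 0) as [->|]. rewrite arc_0; unfold Im at 1; simpl; lra.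
pose proof (Im_arc_pos z t Hz ltac:(lra)). lra.
Qed.

Lemma slit_arc_z z t : 0 < Im z -> 0 <= t <= 1 -> slit (arc z t - z) \/ arc z t = z.
Proof.
intros Hz Ht. destruct (Req_dec t 1) as [->|]. right; now apply arc_1.
left; left. replace (Re (arc z t - z)%C) with (Re (arc z t) - Re z) by (unfold Re; simpl; ring).
pose proof (Re_arc_gt z t Hz ltac:(lra)). lra.
Qed.

Lemma Ccont_arc_integrand {T : UniformSpace} p q c (z : T -> C) (xi t : T -> R) x : 0 <= p -> 0 <= q ->
  Ccont z x -> continuous xi x -> continuous t x -> 0 < Im (z x) -> xi x < Cmod (z x) -> 0 <= t x <= 1 ->
  Ccont (fun y => kern p q c (z y) (xi y) (arc (z y) (t y)) * arc' (z y) (t y))%C x.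
Proof.
intros Hp Hq Hz Hxi Ht Hy Hx Htx.
assert (Cg : continuous (fun y => Carg (z y)) x) by (apply cont_Carg; auto; right; lra).
assert (Ca : Ccont (fun y => arc (z y) (t y)) x).
{ apply (Ccont_polar (fun y => Cmod (z y)) (fun y => Carg (z y) * t y)).
  now apply cont_Cmod. now apply cont_mult. }
apply Ccont_mult.
- apply (Ccont_kern p q c z (fun y => arc (z y) (t y)) xi); auto.
  + destruct (slit_arc_z (z x) (t x)); auto.
  + left; now apply slit_arc_conj.
  + now apply slit_arc.
  + now apply slit_arc_xi.
- apply Ccont_mult. now apply Ccont_RtoC. apply Ccont_mult. apply Ccont_const. exact Ca.
Qed.

Lemma Ccont_arc_integrand_t z xi p q c t : 0 <= p -> 0 <= q -> 0 < Im z -> xi < Cmod z -> 0 <= t <= 1 ->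
  Ccont (fun t => kern p q c z xi (arc z t) * arc' z t)%C t.
Proof.
intros. apply (Ccont_arc_integrand p q c (fun _ => z) (fun _ => xi) (fun t => t));
  auto using Ccont_const, cont_const, cont_id.
Qed.

Lemma Ccont_arc_int {T : UniformSpace} p q c (z : T -> C) (xi : T -> R) x : 0 <= p -> 0 <= q ->
  Ccont z x -> continuous xi x -> 0 < Im (z x) -> xi x < Cmod (z x) ->
  Ccont (fun y => arc_int (z y) (xi y) p q c) x.
Proof.
intros Hp Hq Hz Hxi Hy Hx.
assert (Hc : forall t, 0 <= t <= 1 -> Ccont (fun r : T * R =>
   kern p q c (z (fst r)) (xi (fst r)) (arc (z (fst r)) (snd r)) * arc' (z (fst r)) (snd r))%C (x, t)).
{ intros t Ht.
  apply (Ccont_arc_integrand p q c (fun r => z (fst r)) (fun r => xi (fst r)) (fun r => snd r)); auto.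
  - destruct Hz as [h1 h2]; split.
    apply (continuous_comp fst (fun y => Re (z y))); auto. apply continuous_fst.
    apply (continuous_comp fst (fun y => Im (z y))); auto. apply continuous_fst.
  - apply (continuous_comp fst xi); auto. apply continuous_fst.
  - apply continuous_snd. }
assert (Hi : locally x (fun y => 0 < Im (z y) /\ xi y < Cmod (z y))).
{ apply filter_and.
  - apply (locally_gt (fun y => Im (z y))); auto. apply Hz.
  - apply filter_imp with (fun y => 0 < Cmod (z y) - xi y). intros; lra.
    apply (locally_gt (fun y => Cmod (z y) - xi y)). apply cont_minus; auto. now apply cont_Cmod. lra. }
split.
- apply (cont_RInt_param (fun y t => Re (kern p q c (z y) (xi y) (arc (z y) t) * arc' (z y) t)%C)). lra.
  + intros t Ht; exact (proj1 (Hc t Ht)).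
  + apply filter_imp with (2 := Hi). intros y [h1 h2].
    apply (ex_RInt_ReIm (fun t => kern p q c (z y) (xi y) (arc (z y) t) * arc' (z y) t)%C). lra.
    intros; now apply Ccont_arc_integrand_t.
- apply (cont_RInt_param (fun y t => Im (kern p q c (z y) (xi y) (arc (z y) t) * arc' (z y) t)%C)). lra.
  + intros t Ht; exact (proj2 (Hc t Ht)).
  + apply filter_imp with (2 := Hi). intros y [h1 h2].
    apply (ex_RInt_ReIm (fun t => kern p q c (z y) (xi y) (arc (z y) t) * arc' (z y) t)%C). lra.
    intros; now apply Ccont_arc_integrand_t.
Qed.

Lemma Ccont_Marc {T : UniformSpace} al (z : T -> C) (xi : T -> R) x : 2 <= al ->
  Ccont z x -> continuous xi x -> 0 < Im (z x) -> xi x < Cmod (z x) ->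
  Ccont (fun y => Marc al (z y) (xi y)) x.
Proof.
intros Hal Hz Hxi Hy Hx.
assert (Hsz : forall e : R, slit (z x - e)).
{ intros e; right. unfold Im in *; simpl; lra. }
assert (Hsc : forall e : R, slit (Cconj (z x) - e)).
{ intros e; right. unfold Im in *; simpl; lra. }
assert (Hs0 : slit (z x)) by (right; lra).
assert (Hs1 : slit (Cconj (z x))) by (now apply slit_conj).
assert (Cz : Ccont (fun y => Cconj (z y)) x) by (now apply Ccont_conj).
assert (Cx : Ccont (fun y => RtoC (xi y)) x) by (now apply Ccont_RtoC).
apply Ccont_mult.
- apply Ccont_mult; [apply Ccont_mult; [apply Ccont_mult; [apply Ccont_mult|]|]|].
  + apply Ccont_RtoC. apply (cont_fun (fun y => Rpower y (al - 2)) (fun y => Im (z y))). apply Hz.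
    apply (cont_fun exp). 2: apply continuous_exp. apply cont_mult. apply cont_const. now apply continuous_ln.
  + now apply Ccont_power.
  + apply (Ccont_power (fun y => z y - xi y)%C); auto. now apply Ccont_minus.
  + now apply Ccont_power.
  + apply (Ccont_power (fun y => Cconj (z y) - xi y)%C); auto. now apply Ccont_minus.
- apply Ccont_minus; [|apply Ccont_conj]; apply Ccont_arc_int; auto; lra.
Qed.

Lemma CRInt_polar (f : R -> R) a b h : a <= b -> ex_RInt f a b ->
  CRInt (fun t => polar (f t) h) a b = polar (RInt f a b) h.
Proof.
intros Hab Hf. unfold CRInt, polar; simpl. f_equal; apply is_RInt_unique.
- apply is_RInt_ext with (fun t => cos h * f t). intros; unfold Re; simpl; ring.
  rewrite Rmult_comm. apply (is_RInt_scal (V := R_NormedModule)), (RInt_correct (V := R_CompleteNormedModule)), Hf.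
- apply is_RInt_ext with (fun t => sin h * f t). intros; unfold Im; simpl; ring.
  rewrite Rmult_comm. apply (is_RInt_scal (V := R_NormedModule)), (RInt_correct (V := R_CompleteNormedModule)), Hf.
Qed.

Lemma CRInt_sub (f g : R -> C) a b : a <= b -> (forall t, a <= t <= b -> Ccont f t) ->
  (forall t, a <= t <= b -> Ccont g t) -> CRInt (fun t => f t - g t)%C a b = (CRInt f a b - CRInt g a b)%C.
Proof.
intros Hab Hf Hg. destruct (ex_RInt_ReIm f a b Hab Hf) as [e1 e2]. destruct (ex_RInt_ReIm g a b Hab Hg) as [e3 e4].
apply C_eq.
- exact (RInt_minus (V := R_CompleteNormedModule) _ _ _ _ e1 e3).
- exact (RInt_minus (V := R_CompleteNormedModule) _ _ _ _ e2 e4).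
Qed.

Lemma polar_plus_PI r a : polar r (a + PI) = (- polar r a)%C.
Proof.
apply C_eq; unfold polar, Re, Im; simpl; rewrite ?cos_plus, ?sin_plus, cos_PI, sin_PI; ring.
Qed.

(** With exponents [al] and [al - 2] the coefficient of [t] in the argument cancels and
    [Carg z - PI / 2] remains. The conjugate of the other kernel has this argument shifted by [PI],
    which the minus sign absorbs: the moduli add. *)
Lemma arc_diff_0 al z : 2 <= al -> 0 < Im z ->
  (arc_int z 0 al (al - 2) al - Cconj (arc_int z 0 (al - 2) al al))%C =
  polar (Rpower (Cmod z) (al - 1) * Rpower 2 al * Nint al (Carg z)) (Carg z - PI / 2).
Proof.
intros Hal Hz.
assert (HR : 0 < Cmod z) by (apply Cmod_pos; right; lra).
pose proof (Carg_bounds z Hz) as Hh.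
assert (C1 : forall t, 0 <= t <= 1 -> Ccont (fun t => kern al (al - 2) al z 0 (arc z t) * arc' z t)%C t)
  by (intros; apply Ccont_arc_integrand_t; auto; lra).
assert (C2 : forall t, 0 <= t <= 1 -> Ccont (fun t => kern (al - 2) al al z 0 (arc z t) * arc' z t)%C t)
  by (intros; apply Ccont_arc_integrand_t; auto; lra).
unfold arc_int. rewrite <- CRInt_conj by (auto; lra).
rewrite <- CRInt_sub; try lra; auto. 2: intros; apply Ccont_conj, C2; auto.
set (f := fun t => Carg z * Rpower (cos (Carg z * t) - cos (Carg z)) (al - 2) * (1 - cos (Carg z * t) * cos (Carg z))).
set (k := Rpower (Cmod z) (al - 1) * Rpower 2 al).
assert (E : forall t, 0 < t < 1 ->
  (kern al (al - 2) al z 0 (arc z t) * arc' z t - Cconj (kern (al - 2) al al z 0 (arc z t) * arc' z t))%C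
  = polar (k * f t) (Carg z - PI / 2)).
{ intros t Ht. rewrite !kern_arc_0, polar_conj by assumption. unfold k, f.
  rewrite <- arc_integrand_sum by assumption. rewrite <- polar_add_r. unfold Cminus. f_equal.
  - f_equal. field.
  - rewrite <- polar_plus_PI. f_equal. field. }
rewrite (CRInt_ext _ (fun t => polar (k * f t) (Carg z - PI / 2))) by (lra || exact E).
(* At [t = 1] the base of [Rpower] is 0, where [Rpower] takes a default value, so [f] may jump
   there. Integrability is read off the continuous complex integrand, after rotating its constant
   phase away. *)
assert (Hf : ex_RInt (fun t => k * f t) 0 1).
{ set (w := fun t => (kern al (al - 2) al z 0 (arc z t) * arc' z t - Cconj (kern (al - 2) al al z 0 (arc z t) * arc' z t))%C).
  destruct (ex_RInt_ReIm (fun t => polar 1 (PI / 2 - Carg z) * w t)%C 0 1) as [e _].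
  - lra.
  - intros t Ht. apply Ccont_mult. apply Ccont_const. apply Ccont_minus; auto. apply Ccont_conj; auto.
  - apply ex_RInt_ext with (2 := e). rewrite Rmin_left, Rmax_right by lra. intros t Ht. unfold w.
    rewrite E, polar_mult by assumption. unfold polar, Re; simpl.
    replace (PI / 2 - Carg z + (Carg z - PI / 2)) with 0 by ring. rewrite cos_0; ring. }
rewrite CRInt_polar by (auto; lra). f_equal. unfold Nint. fold f.
assert (Hk : k <> 0). { unfold k; apply Rmult_integral_contrapositive_currified; apply Rgt_not_eq, Rpower_pos. }
assert (Hf' : ex_RInt f 0 1).
{ apply ex_RInt_ext with (fun t => scal (/ k) (k * f t)). intros t _; unfold scal; simpl; unfold mult; simpl; field; auto.
  now apply (ex_RInt_scal (V := R_NormedModule)). }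
now apply (RInt_scal (V := R_CompleteNormedModule)).
Qed.

Lemma M_prefactor_0 al z : 0 < Im z -> M_prefactor al z 0 = polar (Rpower (Im z) (al - 2) * Rpower (Cmod z) (2 - 2 * al)) (- 2 * Carg z).
Proof.
intros Hz.
assert (HR : 0 < Cmod z) by (apply Cmod_pos; right; lra).
pose proof (Carg_bounds z Hz) as Hh.
unfold M_prefactor. replace (z - 0%R)%C with z by ring. replace (Cconj z - 0%R)%C with (Cconj z) by ring.
set (R := Cmod z) in *. set (h := Carg z) in *.
replace (Cpower z (- al / 2)) with (Cpower (polar R h) (- al / 2)) by (unfold R, h; now rewrite polar_Carg).
replace (Cpower (Cconj z) (1 - al / 2)) with (Cpower (polar R (- h)) (1 - al / 2))
  by (rewrite <- polar_conj; unfold R, h; now rewrite polar_Carg).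
rewrite !Cpower_polar, polar_scal, !polar_mult by lra. f_equal.
- rewrite !Rmult_assoc. f_equal. rewrite <- !Rpower_plus. f_equal. field.
- field.
Qed.

(** The inverse cotangent: for [0 < y], [angle (x / y)] is the argument of [(x, y)]. *)
Definition angle (t : R) : R := PI / 2 - atan t.

Definition limit_density (al t : R) : R := Rpower 2 al * Rpower (1 + t ^ 2) (- al / 2) * Nint al (angle t).

(** The arguments add up to [- (h + PI / 2)], whose cosine is [- sin h = - y / Cmod z]. The moduli
    then give [y^(al - 1) (Cmod z)^(- al)], and [Cmod z = y (1 + t^2)^(1 / 2)]. *)
Lemma Re_Marc_0 al x y : 2 <= al -> 0 < y -> Re (Marc al (x, y) 0) = - / y * limit_density al (x / y).
Proof.
intros Hal Hy. set (z := (x, y) : C).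
assert (Hz : 0 < Im z) by exact Hy.
assert (HR : 0 < Cmod z) by (apply Cmod_pos; right; lra).
unfold Marc. rewrite arc_diff_0, M_prefactor_0, polar_mult by assumption.
assert (Eh : Carg z = angle (x / y)) by (now apply Carg_up).
unfold polar, Re; cbn [fst].
replace (cos (-2 * Carg z + (Carg z - PI / 2))) with (- sin (Carg z)).
2:{ replace (-2 * Carg z + (Carg z - PI / 2)) with (- (Carg z + PI / 2)) by field.
    rewrite cos_neg, cos_plus, cos_PI2, sin_PI2; ring. }
assert (Es : Cmod z * sin (Carg z) = y).
{ change (Im (polar (Cmod z) (Carg z)) = y). now rewrite polar_Carg. }
replace (sin (Carg z)) with (y / Cmod z) by (apply Rmult_eq_reg_l with (Cmod z); [rewrite Es; field; lra|lra]).
unfold limit_density. rewrite <- Eh. change (Im z) with y.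
assert (ER : Cmod z = y * Rpower (1 + (x / y) ^ 2) (/ 2)).
{ rewrite Rpower_sqrt by nra. rewrite <- (sqrt_pow2 y) at 1 by lra. rewrite <- sqrt_mult by nra.
  unfold Cmod, z; simpl. f_equal. field; lra. }
set (q := 1 + (x / y) ^ 2) in *. assert (Hq : 0 < Rpower q (/2)) by apply Rpower_pos.
assert (EP : Rpower q (- al / 2) = Rpower (Rpower q (/ 2)) (- al)) by (rewrite Rpower_mult; f_equal; field).
rewrite EP. set (w := Rpower q (/2)) in *.
transitivity (- (Rpower y (al - 2) * (Rpower (Cmod z) (2 - 2 * al) * Rpower (Cmod z) (al - 1) * / Cmod z) * y) * Rpower 2 al * Nint al (Carg z)).
field; lra.
replace (/ Cmod z) with (Rpower (Cmod z) (Ropp 1)) by (rewrite Rpower_Ropp, Rpower_1; auto).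
rewrite <- !Rpower_plus. replace (2 - 2 * al + (al - 1) + Ropp 1) with (- al) by ring.
rewrite ER, <- Rpower_mult_distr by assumption.
replace (/ y) with (Rpower y (al - 2) * Rpower y (- al) * y). ring.
rewrite <- (Rpower_1 y) at 3 by assumption. rewrite <- !Rpower_plus.
replace (al - 2 + - al + 1) with (Ropp 1) by ring. rewrite Rpower_Ropp, Rpower_1; auto.
Qed.

(** * The limit xi -> 0 *)

Lemma Rpower_le_base x y a : 0 < x <= y -> 0 <= a -> Rpower x a <= Rpower y a.
Proof. intros H Ha. apply Rle_Rpower_l; lra. Qed.

Lemma Rpower_le_base_neg x y a : 0 < x <= y -> a <= 0 -> Rpower y a <= Rpower x a.
Proof.
intros H Ha. replace a with (- - a) by ring. rewrite !(Rpower_Ropp _ (- a)).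
apply Rinv_le_contravar. apply Rpower_pos. apply Rpower_le_base; lra.
Qed.

Lemma Cmod_Cpower_le w m a : Cmod w <= m -> 0 < m -> 0 <= a -> Cmod (Cpower w a) <= Rpower m a.
Proof.
intros Hw Hm Ha. destruct (Ceq_dec w 0) as [->|n].
- unfold Cpower. destruct Ceq_dec as [_|k]; [|now elim k]. destruct Req_EM_T as [->|].
  rewrite Rpower_O, Cmod_1; lra. rewrite Cmod_0. left; apply Rpower_pos.
- rewrite Cmod_Cpower by assumption. apply Rpower_le_base; auto. split; auto. now apply Cmod_gt_0.
Qed.

Lemma Cmod_Cpower_neg_le w m a : m <= Cmod w -> 0 < m -> a <= 0 -> Cmod (Cpower w a) <= Rpower m a.
Proof.
intros Hw Hm Ha. rewrite Cmod_Cpower. apply Rpower_le_base_neg; auto. apply Cmod_gt_0; lra.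
Qed.

Lemma Cmod_minus_R (w : C) (xi : R) : 0 <= xi -> Cmod w - xi <= Cmod (w - xi)%C.
Proof.
intros H. pose proof (Cmod_triangle (w - xi)%C xi) as T.
replace (w - xi + xi)%C with w in T by ring. rewrite Cmod_R, Rabs_pos_eq in T; lra.
Qed.

Lemma Cmod_polar_nonneg r a : 0 <= r -> Cmod (polar r a) = r.
Proof.
intros H. destruct (Req_dec r 0) as [->|]. 2: apply Cmod_polar; lra.
replace (polar 0 a) with (RtoC 0). apply Cmod_0. apply C_eq; unfold polar, Re, Im; simpl; ring.
Qed.

Section Bound.
Variables (al x y xi t : R).
Hypotheses (Hal : 2 <= al) (Hy : 0 < y) (Hx : 1 <= x) (Hxi : 0 <= xi <= y / 2) (Ht : 0 <= t <= 1).
Let z : C := (x, y).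
Let R := Cmod z.
Let h := Carg z.

Lemma bound_R : x <= R /\ y <= R.
Proof.
split. apply Rle_trans with (2 := Rmax_Cmod z). simpl. rewrite (Rabs_pos_eq x) by lra. apply Rmax_l.
apply Rle_trans with (2 := Rmax_Cmod z). simpl. rewrite (Rabs_pos_eq y) by lra. apply Rmax_r.
Qed.

Lemma bound_h : 0 < h < PI / 2 /\ R * sin h = y.
Proof.
assert (Hz : 0 < Im z) by exact Hy. pose proof (Carg_bounds z Hz). fold h in H.
assert (E : polar R h = z) by (now apply polar_Carg).
assert (Ec : R * cos h = x) by (apply (f_equal Re) in E; exact E).
assert (Es : R * sin h = y) by (apply (f_equal Im) in E; exact E).
destruct bound_R. split; auto. split. lra.
destruct (Rlt_le_dec h (PI / 2)); auto. assert (cos h <= 0) by (apply cos_le_0; lra). nra.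
Qed.

Lemma Cmod_arc : Cmod (arc z t) = R.
Proof. apply Cmod_polar. destruct bound_R; lra. Qed.

(** For [1 <= x] the angle [h] is below [PI / 2], so both chords are at most [2 R sin h = 2 y]
    however large [R] is. The bound on [xi] keeps [u - xi] at distance at least [R / 2] from 0, and
    [4 R] crudely bounds the speed [h R]. *)
Lemma kern_arc_bound p q : 0 <= p -> 0 <= q ->
  Cmod (kern p q al z xi (arc z t) * arc' z t)%C <=
  Rpower (2 * y) p * Rpower (2 * y) q * Rpower R (- al / 2) * Rpower (R / 2) (- al / 2) * (4 * R).
Proof.
intros Hp Hq. assert (Hz : 0 < Im z) by exact Hy.
destruct bound_R. destruct bound_h as [Hh Es].
assert (E : polar R h = z) by (now apply polar_Carg).
assert (Hht : 0 <= h * t <= h) by nra.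
assert (B : forall v, 0 <= v <= h -> Rabs (2 * R * sin v) <= 2 * y /\ 0 <= 2 * R * sin v).
{ intros v Hv. assert (0 <= sin v) by (apply sin_ge_0; lra).
  assert (sin v <= sin h) by (apply sin_incr_1; lra).
  assert (0 <= 2 * R * sin v) by nra. rewrite Rabs_pos_eq by assumption. split; nra. }
rewrite Cmod_mult. unfold kern. rewrite !Cmod_mult.
repeat apply Rmult_le_compat; auto using Cmod_ge_0, Rmult_le_pos.
- apply Cmod_Cpower_le; try lra. unfold arc. fold R h. rewrite <- E, polar_minus_up.
  destruct (B ((h - h * t) / 2)) as [b1 b2]. lra. rewrite Cmod_polar_nonneg; auto. rewrite Rabs_pos_eq in b1; auto.
- apply Cmod_Cpower_le; try lra. unfold arc. fold R h. rewrite <- E, polar_conj, polar_minus_down.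
  destruct (B ((h * t + h) / 2)) as [b1 b2]. lra. rewrite Cmod_polar_nonneg; auto. rewrite Rabs_pos_eq in b1; auto.
- apply Cmod_Cpower_neg_le. rewrite Cmod_arc; lra. lra. lra.
- apply Cmod_Cpower_neg_le. 2, 3: lra.
  pose proof (Cmod_minus_R (arc z t) xi ltac:(lra)). rewrite Cmod_arc in H1. lra.
- unfold arc'. rewrite !Cmod_mult, Cmod_arc, Cmod_R, Rabs_pos_eq by (fold h; lra). fold h.
  replace (Cmod Ci) with 1. pose proof PI_4. nra.
  transitivity (sqrt 1). symmetry; apply sqrt_1. unfold Cmod, Ci; simpl. f_equal; ring.
Qed.
End Bound.

(** The powers of [R] combine to the exponent [3 - 3 al], at most [- 3], of which only the
    integrable decay [- 2] is kept. The constant depends on [al] and [y] but not on [xi], as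
    dominated convergence requires. *)
Lemma Marc_bound al y : 2 <= al -> 0 < y -> exists K, 0 <= K /\ forall x xi, 1 <= x -> 0 <= xi <= y / 2 ->
  Cmod (Marc al (x, y) xi) <= K / x ^ 2.
Proof.
intros Hal Hy.
set (e := - al / 2).
set (h2 := Rpower (/ 2) e). set (h3 := Rpower (/ 2) (1 - al / 2)).
set (a := Rpower (2 * y) al * Rpower (2 * y) (al - 2)).
exists (Rpower y (al - 2) * h2 * h3 * (8 * a * h2)).
assert (p1 := Rpower_pos y (al - 2)). assert (p2 : 0 < h2) by apply Rpower_pos.
assert (p3 : 0 < h3) by apply Rpower_pos.
assert (p4 : 0 < a) by (apply Rmult_lt_0_compat; apply Rpower_pos).
split. { repeat apply Rmult_le_pos; (lra || (left; apply Rpower_pos)). }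
intros x xi Hx Hxi. set (z := (x, y) : C). set (R := Cmod z).
assert (Hz : 0 < Im z) by exact Hy.
destruct (bound_R x y Hy Hx) as [HR1 HR2]. fold z R in HR1, HR2.
assert (Hhalf : forall b, Rpower (R / 2) b = Rpower R b * Rpower (/ 2) b).
{ intros b. unfold Rdiv. rewrite Rpower_mult_distr; auto; lra. }
assert (A : forall p q, 0 <= p -> 0 <= q -> Rpower (2 * y) p * Rpower (2 * y) q = a ->
  Cmod (arc_int z xi p q al) <= a * Rpower R e * (Rpower R e * h2) * (4 * R)).
{ intros p q Hp Hq Ea.
  rewrite <- (Rmult_1_l (a * _ * _ * _)). replace 1 with (1 - 0) by ring.
  apply CRInt_bound. lra.
  - intros t Ht. apply Ccont_arc_integrand_t; auto. fold R; lra.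
  - intros t Ht. unfold h2. rewrite <- Hhalf, <- Ea. now apply kern_arc_bound. }
assert (P : Cmod (M_prefactor al z xi) <=
   Rpower y (al - 2) * Rpower R e * (Rpower R e * h2) * Rpower R (1 - al / 2) * (Rpower R (1 - al / 2) * h3)).
{ unfold M_prefactor. rewrite !Cmod_mult. unfold h2, h3. rewrite <- !Hhalf.
  assert (Q : forall w : C, Cmod w = R -> R / 2 <= Cmod (w - xi)).
  { intros w Hw. pose proof (Cmod_minus_R w xi ltac:(lra)). lra. }
  repeat apply Rmult_le_compat; auto using Cmod_ge_0, Rmult_le_pos.
  - rewrite Cmod_R, Rabs_pos_eq. apply Rle_refl. left; apply Rpower_pos.
  - apply Cmod_Cpower_neg_le; fold R; unfold e; lra.
  - apply Cmod_Cpower_neg_le. now apply Q. lra. unfold e; lra.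
  - apply Cmod_Cpower_neg_le; rewrite ?Cmod_conj; fold R; lra.
  - apply Cmod_Cpower_neg_le. apply Q. now rewrite Cmod_conj. lra. lra. }
assert (A1 := A al (al - 2) ltac:(lra) ltac:(lra) eq_refl).
assert (A2 := A (al - 2) al ltac:(lra) ltac:(lra) (Rmult_comm _ _)).
assert (T : Cmod (arc_int z xi al (al - 2) al - Cconj (arc_int z xi (al - 2) al al))%C <=
   2 * (a * Rpower R e * (Rpower R e * h2) * (4 * R))).
{ eapply Rle_trans. apply Cmod_triangle. rewrite Cmod_opp, Cmod_conj. lra. }
unfold Marc. rewrite Cmod_mult.
eapply Rle_trans. apply Rmult_le_compat; [apply Cmod_ge_0|apply Cmod_ge_0|exact P|exact T].
set (c := Rpower y (al - 2) * h2 * h3 * (8 * a * h2)).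
assert (Hc : 0 <= c) by (unfold c; repeat apply Rmult_le_pos; (lra || (left; apply Rpower_pos))).
transitivity (c * (Rpower R e * Rpower R e * Rpower R (1 - al / 2) * Rpower R (1 - al / 2) * Rpower R e * Rpower R e * R)).
{ right; unfold c; ring. }
change (c / x ^ 2) with (c * / x ^ 2). apply Rmult_le_compat_l. exact Hc.
rewrite <- (Rpower_1 R) at 7 by lra. rewrite <- !Rpower_plus.
replace (e + e + (1 - al / 2) + (1 - al / 2) + e + e + 1) with (- (3 * al - 3)) by (unfold e; field).
rewrite Rpower_Ropp. apply Rinv_le_contravar. apply pow_lt; lra.
apply Rle_trans with (R ^ 2). apply pow_incr; lra.
rewrite <- Rpower_pow by lra. apply Rle_Rpower. lra. simpl; lra.
Qed.

(** * Improper integrals with an inverse-square tail *)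

Lemma int_inv_sqr a b C : 0 < a <= b -> is_RInt (fun x => C / x ^ 2) a b (C / a - C / b).
Proof.
intros H. replace (C / a - C / b) with (minus (- C / b) (- C / a)) by (unfold minus, plus, opp; simpl; field; lra).
apply (is_RInt_derive (V := R_CompleteNormedModule) (fun x => - C / x)); rewrite Rmin_left, Rmax_right by lra; intros x Hx.
- auto_derive. lra. field. lra.
- apply cont_div. apply cont_const. apply cont_pow, cont_id. apply pow_nonzero; lra.
Qed.

Lemma tail_bound (f : R -> R) K X B1 B2 : 0 < X <= B1 -> B1 <= B2 ->
  (forall x, X <= x -> continuous f x) -> (forall x, X <= x -> Rabs (f x) <= K / x ^ 2) ->
  Rabs (RInt f B1 B2) <= K / B1.
Proof.
intros HX HB Hc Hb.
assert (0 <= K). { specialize (Hb X (Rle_refl _)). pose proof (Rabs_pos (f X)).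
  apply Rmult_le_reg_r with (/ X ^ 2). apply Rinv_0_lt_compat, pow_lt; lra. unfold Rdiv in Hb. lra. }
assert (e : ex_RInt f B1 B2) by (apply ex_RInt_cont; auto; intros; apply Hc; lra).
eapply Rle_trans. apply abs_RInt_le; auto.
assert (I := int_inv_sqr B1 B2 K ltac:(lra)).
apply Rle_trans with (RInt (fun x => K / x ^ 2) B1 B2).
- apply RInt_le; auto.
  + apply ex_RInt_cont; auto. intros x Hx. apply (cont_fun Rabs). apply Hc; lra. apply continuous_Rabs.
  + eexists; exact I.
  + intros x Hx; apply Hb; lra.
- rewrite (is_RInt_unique _ _ _ _ I). assert (0 <= K / B2) by (apply Rdiv_le_0_compat; lra). lra.
Qed.

Lemma is_RInt_gen_infty (f : R -> R) a l : (forall B, a <= B -> ex_RInt f a B) ->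
  filterlim (fun B => RInt f a B) (Rbar_locally p_infty) (locally l) ->
  is_RInt_gen f (at_point a) (Rbar_locally p_infty) l.
Proof.
intros He Hl P HP. specialize (Hl P HP). unfold filtermapi.
destruct Hl as [M HM].
exists (fun x => x = a) (fun x => Rmax M a < x). reflexivity. now exists (Rmax M a).
intros x y -> Hy. simpl. exists (RInt f a y). split.
- apply (RInt_correct (V := R_CompleteNormedModule)), He. pose proof (Rmax_r M a); lra.
- apply HM. pose proof (Rmax_l M a); lra.
Qed.

Lemma improper_exists (f : R -> R) a K X : 0 < X -> a <= X ->
  (forall x, a <= x -> continuous f x) -> (forall x, X <= x -> Rabs (f x) <= K / x ^ 2) ->
  exists l, filterlim (fun B => RInt f a B) (Rbar_locally p_infty) (locally l) /\
    forall B, X <= B -> Rabs (l - RInt f a B) <= K / B.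
Proof.
intros HX Ha Hc Hb.
assert (e : forall b1 b2, a <= b1 <= b2 -> ex_RInt f b1 b2) by (intros; apply ex_RInt_cont; try lra; intros; apply Hc; lra).
assert (Ch : forall b1 b2, a <= b1 <= b2 -> RInt f a b2 - RInt f a b1 = RInt f b1 b2).
{ intros b1 b2 H. rewrite <- (RInt_Chasles (V := R_CompleteNormedModule) f a b1 b2) by (apply e; lra).
  unfold plus; simpl. ring. }
assert (TB : forall b1 b2, X <= b1 <= b2 -> Rabs (RInt f a b2 - RInt f a b1) <= K / b1).
{ intros b1 b2 H. rewrite Ch by lra. apply tail_bound with X; try lra; auto. intros; apply Hc; lra. }
assert (K0 : 0 <= K). { specialize (Hb X (Rle_refl _)). pose proof (Rabs_pos (f X)).
  apply Rmult_le_reg_r with (/ X ^ 2). apply Rinv_0_lt_compat, pow_lt; lra. unfold Rdiv in Hb. lra. }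
assert (L : exists l, filterlim (fun B => RInt f a B) (Rbar_locally p_infty) (locally l)).
{ apply (filterlim_locally_cauchy (U := R_CompleteSpace)).
  intros eps. pose proof (cond_pos eps). set (M := Rmax X (2 * (K + 1) / eps)).
  exists (fun B => M < B). split. now exists M.
  assert (HM : forall b, M < b -> X <= b /\ K / b < eps).
  { intros b Hbm. assert (h1 := Rmax_l X (2 * (K + 1) / eps)). assert (h2 := Rmax_r X (2 * (K + 1) / eps)).
    fold M in h1, h2. split. lra.
    apply Rmult_lt_reg_r with b. lra. replace (K / b * b) with K by (field; lra).
    assert (2 * (K + 1) / eps * eps = 2 * (K + 1)) by (field; lra). nra. }
  intros u v Hu Hv. destruct (HM u Hu), (HM v Hv).
  unfold ball; simpl; unfold AbsRing_ball, abs, minus, plus, opp; simpl.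
  change (Rabs (RInt f a v - RInt f a u) < eps).
  destruct (Rle_dec u v).
  - eapply Rle_lt_trans. apply TB; lra. assumption.
  - rewrite Rabs_minus_sym. eapply Rle_lt_trans. apply TB; lra. assumption. }
destruct L as [l Hl]. exists l. split; auto.
intros B HB. apply Rnot_lt_le. intros Hn.
(* The limit is taken in [TB] by contradiction: [eps] is the supposed excess, and a later [B']
   brings the integral within [eps] of [l]. *)
set (eps := Rabs (l - RInt f a B) - K / B).
assert (Heps : 0 < eps) by (unfold eps; lra).
assert (Hlp := Hl _ (locally_ball l (mkposreal _ Heps))).
destruct Hlp as [M HM].
set (B' := Rmax B M + 1).
assert (h1 := Rmax_l B M). assert (h2 := Rmax_r B M).
specialize (HM B' ltac:(unfold B'; lra)). unfold ball in HM; simpl in HM; unfold AbsRing_ball, abs, minus, plus, opp in HM; simpl in HM.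
change (Rabs (RInt f a B' - l) < eps) in HM.
assert (HT := TB B B' ltac:(unfold B'; lra)). unfold eps in HM.
assert (Rabs (l - RInt f a B) <= Rabs (RInt f a B' - l) + Rabs (RInt f a B' - RInt f a B)).
{ replace (l - RInt f a B) with (- (RInt f a B' - l) + (RInt f a B' - RInt f a B)) by ring.
  eapply Rle_trans. apply Rabs_triang. rewrite Rabs_Ropp. lra. }
lra.
Qed.

(** The split [eps / 4 + eps / 2 + eps / 4]: cutting at [B] costs at most [K / B] uniformly in the
    parameter, and over [[a, B]] the integral depends continuously on it. *)
Lemma improper_dominated_limit (F : R -> R -> R) (l : R -> R) a K X d : 0 < X -> a <= X -> 0 < d ->
  (forall x e, a <= x -> 0 <= e < d -> continuous (fun q : R * R => F (fst q) (snd q)) (x, e)) ->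
  (forall B e, X <= B -> 0 <= e < d -> Rabs (l e - RInt (fun x => F x e) a B) <= K / B) ->
  locally 0 (fun e => forall B, a <= B -> ex_RInt (fun x => F x e) a B) ->
  filterlim l (at_right 0) (locally (l 0)).
Proof.
intros HX Ha Hd Hc Hb Hex. apply filterlim_locally. intros eps. pose proof (cond_pos eps) as Hp.
assert (K0 : 0 <= K). { specialize (Hb X 0 (Rle_refl _) ltac:(lra)). pose proof (Rabs_pos (l 0 - RInt (fun x => F x 0) a X)).
  apply Rmult_le_reg_r with (/ X). now apply Rinv_0_lt_compat. unfold Rdiv in Hb. lra. }
set (B := Rmax X (4 * (K + 1) / eps)).
assert (HB1 := Rmax_l X (4 * (K + 1) / eps)). assert (HB2 := Rmax_r X (4 * (K + 1) / eps)). fold B in HB1, HB2.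
assert (HKB : K / B < eps / 4).
{ apply Rmult_lt_reg_r with B. lra. replace (K / B * B) with K by (field; lra).
  assert (4 * (K + 1) / eps * eps = 4 * (K + 1)) by (field; lra). nra. }
assert (C : continuous (fun e => RInt (fun x => F x e) a B) 0).
{ apply (cont_RInt_param (fun e x => F x e)). lra.
  - intros t Ht. apply (continuous_comp_2 (fun q : R * R => snd q) (fun q : R * R => fst q) F).
    apply continuous_snd. apply continuous_fst. apply (Hc t 0); lra.
  - apply filter_imp with (2 := Hex). intros e He; apply He; lra. }
assert (C' := cont_fun Rabs _ _ (cont_minus _ _ _ C (cont_const (RInt (fun x => F x 0) a B) _)) (continuous_Rabs _)).
assert (L := locally_lt _ _ (eps / 2) C'). cbv beta in L. rewrite Rminus_eq_0, Rabs_R0 in L. specialize (L ltac:(lra)).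
assert (L2 := locally_Ioo (- d) d 0 ltac:(lra)).
unfold at_right, within.
apply filter_imp with (2 := filter_and _ _ L L2). intros e [He1 He2] He0.
unfold ball; simpl; unfold AbsRing_ball, abs, minus, plus, opp; simpl.
change (Rabs (l e - l 0) < eps).
assert (h1 := Hb B e HB1 ltac:(lra)). assert (h2 := Hb B 0 HB1 ltac:(lra)).
replace (l e - l 0) with ((l e - RInt (fun x => F x e) a B) + (RInt (fun x => F x e) a B - RInt (fun x => F x 0) a B) + - (l 0 - RInt (fun x => F x 0) a B)) by ring.
eapply Rle_lt_trans. apply Rabs_triang. eapply Rle_lt_trans. apply Rplus_le_compat_r, Rabs_triang.
rewrite Rabs_Ropp. lra.
Qed.

Lemma Cmod_ge_Im x y : 0 < y -> y <= Cmod (x, y).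
Proof.
intros H. apply Rle_trans with (2 := Rmax_Cmod _). simpl. rewrite (Rabs_pos_eq y) by lra. apply Rmax_r.
Qed.

Lemma continuous_Re_Marc al y x e : 2 <= al -> 0 < y -> e < y ->
  continuous (fun q : R * R => Re (Marc al (fst q, y) (snd q))) (x, e).
Proof.
intros Hal Hy He.
apply (Ccont_Marc al (fun q : R * R => (fst q, y) : C) (fun q => snd q) (x, e)); auto.
- apply Ccont_pair. apply continuous_fst. apply cont_const.
- apply continuous_snd.
- simpl. pose proof (Cmod_ge_Im x y Hy). lra.
Qed.

(** For [xi < y] the circle passes to the right of [xi], so [M_eq_Marc] removes the choice of
    crossing points. The factor [/ y] in [Re_Marc_0] is absorbed by the substitution [x' = y t], and
    its sign turns [l 0] into [- L]. *)
Lemma P_limit_density al s x y : 2 <= al -> right_crossing s -> 0 < y ->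
  exists L, is_RInt_gen (limit_density al) (at_point (x / y)) (Rbar_locally p_infty) L /\
    filterlim (fun xi => P al s (x, y) xi) (at_right 0) (locally (/ c_const al * - L)).
Proof.
intros Hal Hs Hy.
set (F := fun x' e => Re (Marc al (x', y) e)).
destruct (Marc_bound al y Hal Hy) as (K & HK & HB).
assert (CF : forall e, e < y -> forall x', continuous (fun x' => F x' e) x').
{ intros e He x'. apply (cont_slice_l F). now apply continuous_Re_Marc. }
set (X := Rmax 1 x). assert (HX1 : 1 <= X) by apply Rmax_l. assert (HX2 : x <= X) by apply Rmax_r.
assert (I : forall e, 0 <= e < y / 2 -> exists l, filterlim (fun B => RInt (fun x' => F x' e) x B) (Rbar_locally p_infty) (locally l) /\
    forall B, X <= B -> Rabs (l - RInt (fun x' => F x' e) x B) <= K / B).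
{ intros e He. apply improper_exists; try lra.
  - intros; apply CF; lra.
  - intros x' Hx'. eapply Rle_trans. 2: apply (HB x' e); lra.
    apply Rle_trans with (2 := Rmax_Cmod _). apply Rmax_l. }
assert (ex : forall e, e < y -> forall B, x <= B -> ex_RInt (fun x' => F x' e) x B).
{ intros e He B HB'. apply ex_RInt_cont; auto. }
set (l := fun e => RInt_gen (fun x' => F x' e) (at_point x) (Rbar_locally p_infty)).
assert (Hl : forall e, 0 <= e < y / 2 -> filterlim (fun B => RInt (fun x' => F x' e) x B) (Rbar_locally p_infty) (locally (l e)) /\
    forall B, X <= B -> Rabs (l e - RInt (fun x' => F x' e) x B) <= K / B).
{ intros e He. destruct (I e He) as (l' & H1 & H2).
  replace (l e) with l'; auto. symmetry. unfold l.
  apply (is_RInt_gen_unique (V := R_CompleteNormedModule)).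
  apply is_RInt_gen_infty; auto. apply ex; lra. }
assert (Hlim : filterlim l (at_right 0) (locally (l 0))).
{ apply (improper_dominated_limit F l x K X (y / 2)); try lra.
  - intros x' e Hx' He. apply continuous_Re_Marc; auto; lra.
  - intros B e HB' He. now apply Hl.
  - apply filter_imp with (2 := locally_Ioo (- y) y 0 ltac:(lra)). intros e He B; apply ex; lra. }
exists (- l 0). split.
(* The summand 0 matches the affine form of [is_RInt_comp_lin]. *)
- assert (Eg : forall t, limit_density al t = - (y * F (y * t + 0) 0)).
  { intros t. unfold F. rewrite Re_Marc_0 by assumption. replace ((y * t + 0) / y) with t by (field; lra). field; lra. }
  assert (J : forall B, x / y <= B -> is_RInt (limit_density al) (x / y) B (- RInt (fun x' => F x' 0) x (y * B))).
  { intros B HB'. apply is_RInt_ext with (fun t => opp (scal y (F (y * t + 0) 0))). intros t _; now rewrite Eg.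
    apply (is_RInt_opp (V := R_NormedModule)). apply (is_RInt_comp_lin (V := R_NormedModule) (fun x' => F x' 0)).
    replace (y * (x / y) + 0) with x by (field; lra). rewrite Rplus_0_r.
    apply (RInt_correct (V := R_CompleteNormedModule)), ex; auto.
    replace x with (y * (x / y)) by (field; lra). apply Rmult_le_compat_l; lra. }
  apply is_RInt_gen_infty.
  + intros B HB'; eexists; now apply J.
  + apply filterlim_ext_loc with (fun B => - RInt (fun x' => F x' 0) x (y * B)).
    { exists (x / y). intros B HB'. symmetry. apply is_RInt_unique, J. lra. }
    apply (filterlim_comp _ _ _ (fun B => RInt (fun x' => F x' 0) x (y * B)) Ropp _ (locally (l 0))).
    2: apply (filterlim_opp (K := R_AbsRing) (V := R_NormedModule)).
    apply (filterlim_comp _ _ _ (fun B => y * B) (fun B => RInt (fun x' => F x' 0) x B) _ (Rbar_locally p_infty)).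
    2: apply Hl; lra.
    intros P [M HM]. exists (M / y). intros B HB'. apply HM.
    replace M with (y * (M / y)) by (field; lra). apply Rmult_lt_compat_l; lra.
- rewrite Ropp_involutive.
  apply filterlim_ext_loc with (fun xi => / c_const al * l xi).
  + assert (L := locally_Ioo (- y) (y / 2) 0 ltac:(lra)).
    unfold at_right, within. apply filter_imp with (2 := L). intros e He He0.
    unfold P, l. f_equal. f_equal. apply functional_extensionality. intros x'. unfold F. cbn [Im Re fst snd].
    f_equal. symmetry. pose proof (Cmod_ge_Im x' y Hy).
    destruct (Hs (x', y) e Hy He0). apply M_eq_Marc; auto; lra.
  + apply (filterlim_comp _ _ _ l (fun v => / c_const al * v) _ (locally (l 0))). exact Hlim.
    apply (continuous_mult (K := R_AbsRing) (fun _ => / c_const al) (fun v => v)).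
    apply continuous_const. apply continuous_id.
Qed.

(** * A Legendre equation *)

(* Unlike [Rpower], whose value at 0 is the junk value 1, this is continuous for all [0 <= a], and
   being even it makes [x * apow x a] differentiable at 0. *)
Definition apow (x a : R) : R :=
  if Req_EM_T x 0 then (if Req_EM_T a 0 then 1 else 0) else Rpower (Rabs x) a.

Lemma apow_pos x a : 0 < x -> apow x a = Rpower x a.
Proof. intros H; unfold apow. destruct Req_EM_T; [lra|]. now rewrite Rabs_pos_eq by lra. Qed.

Lemma apow_O x : apow x 0 = 1.
Proof.
unfold apow. destruct Req_EM_T. destruct Req_EM_T; lra. apply Rpower_O. now apply Rabs_pos_lt.
Qed.

Lemma apow_ge_0 x a : 0 <= apow x a.
Proof. unfold apow. destruct Req_EM_T. destruct Req_EM_T; lra. left; apply Rpower_pos. Qed.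

Lemma apow_S x a : 0 <= x -> 0 <= a -> x * apow x a = apow x (a + 1).
Proof.
intros Hx Ha. destruct (Req_dec x 0) as [->|].
- unfold apow. destruct Req_EM_T; [|lra]. destruct (Req_EM_T (a + 1) 0); lra.
- rewrite !apow_pos, Rpower_plus, Rpower_1 by lra. ring.
Qed.

Lemma cont_apow a x : 0 <= a -> continuous (fun y => apow y a) x.
Proof.
intros Ha. destruct (Req_dec a 0) as [->|Ha0].
- apply continuous_ext with (fun _ => 1). intros; now rewrite apow_O. apply cont_const.
- destruct (Req_dec x 0) as [->|Hx].
  + apply filterlim_locally. intros eps.
    assert (Hd : 0 < Rpower eps (/ a)) by apply exp_pos.
    exists (mkposreal _ Hd). intros y Hy.
    unfold ball in *; simpl in *; unfold AbsRing_ball, abs, minus, plus, opp in *; simpl in *.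
    replace (apow 0 a) with 0 by (unfold apow; destruct Req_EM_T; [destruct Req_EM_T; lra|lra]).
    rewrite Ropp_0, Rplus_0_r in *. rewrite Rabs_pos_eq by apply apow_ge_0.
    unfold apow. destruct Req_EM_T. destruct Req_EM_T; [lra|apply cond_pos].
    replace (pos eps) with (Rpower (Rpower eps (/ a)) a).
    * apply Rlt_Rpower_l. lra. split; auto. now apply Rabs_pos_lt.
    * rewrite Rpower_mult, Rinv_l, Rpower_1; auto. apply cond_pos.
  + apply cont_ext_loc with (fun y => exp (a * ln (Rabs y))).
    * assert (L : locally x (fun y => y <> 0)) by (apply open_neq; auto).
      apply filter_imp with (2 := L). intros y Hy. unfold apow. now destruct Req_EM_T.
    * apply (cont_fun exp). 2: apply continuous_exp. apply cont_mult. apply cont_const.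
      apply (cont_fun ln). apply continuous_Rabs. apply continuous_ln. now apply Rabs_pos_lt.
Qed.

(** The odd power [x |x|^a], standing for [x^(a + 1)] but differentiable on the whole line. *)
Definition spow (x a : R) : R := x * apow x a.

Lemma is_derive_spow a x : 0 <= a -> is_derive (fun y => spow y a) x ((a + 1) * apow x a).
Proof.
intros Ha. destruct (Req_dec x 0) as [->|Hx].
- apply is_derive_Reals. intros eps Heps.
  destruct (proj1 (filterlim_locally _ _) (cont_apow a 0 Ha) (mkposreal _ Heps)) as [d Hd].
  exists d. intros h Hh Hhd.
  assert (E : (a + 1) * apow 0 a = apow 0 a).
  { unfold apow. destruct Req_EM_T; [|lra]. destruct Req_EM_T; [subst|]; ring. }
  rewrite E. unfold spow. replace ((((0 + h) * apow (0 + h) a - 0 * apow 0 a) / h)) with (apow h a)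
    by (rewrite Rplus_0_l; field; auto).
  apply (Hd h). unfold ball; simpl; unfold AbsRing_ball, abs, minus, plus, opp; simpl. now rewrite Ropp_0, Rplus_0_r.
- destruct (Rdichotomy _ _ Hx) as [Hn|Hp].
  + apply is_derive_ext_loc with (fun y => y * exp (a * ln (- y))).
    { assert (L : locally x (fun y => y < 0)) by (apply open_lt; auto).
      apply filter_imp with (2 := L). intros y Hy. unfold spow, apow, Rpower. destruct Req_EM_T; [lra|].
      now rewrite Rabs_left. }
    eapply is_derive_val. auto_derive. 2: reflexivity. lra.
    unfold apow, Rpower. destruct Req_EM_T; [lra|]. rewrite Rabs_left by assumption. field. lra.
  + apply is_derive_ext_loc with (fun y => y * exp (a * ln y)).
    { assert (L : locally x (fun y => 0 < y)) by (apply open_gt; auto).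
      apply filter_imp with (2 := L). intros y Hy. unfold spow. now rewrite apow_pos. }
    eapply is_derive_val. auto_derive. 2: reflexivity. lra.
    rewrite apow_pos by assumption. unfold Rpower. field. lra.
Qed.

Lemma cont_spow a x : 0 <= a -> continuous (fun y => spow y a) x.
Proof. intros Ha. eapply is_derive_cont. now apply is_derive_spow. Qed.

Section Legendre.
Variable al : R.
Hypothesis Hal : 2 <= al.
Let be := al - 2.

Definition Xf (h t : R) : R := cos (h * t) - cos h.
(** [Pf] stands for [Xf^(al - 1)] and [Pd] for its derivative with respect to [Xf]. The exponent is
    one higher than in [Nint], which makes the power differentiable for every [2 <= al]. *)
Definition Pf (h t : R) : R := spow (Xf h t) be.
Definition Pd (h t : R) : R := (al - 1) * apow (Xf h t) be.
(** With [v = h t]: integrals of [(cos v - cos h)^(al - 1)] over [[0, h]], with and without the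
    weight [cos v]. They are of Mehler-Dirichlet type and together satisfy a linear first-order
    system in [h]. *)
Definition Aint (h : R) : R := RInt (fun t => h * Pf h t * cos (h * t)) 0 1.
Definition Bint (h : R) : R := RInt (fun t => h * Pf h t) 0 1.

Lemma is_derive_Pf_h h t : is_derive (fun h => Pf h t) h (Pd h t * (sin h - t * sin (h * t))).
Proof.
eapply is_derive_val.
apply (is_derive_comp (fun y => spow y be) (fun h => Xf h t)).
apply is_derive_spow; unfold be; lra.
unfold Xf; auto_derive. easy. reflexivity.
unfold scal; simpl; unfold mult; simpl. unfold Pd, be. ring.
Qed.

Lemma is_derive_Pf_t h t : is_derive (fun t => Pf h t) t (Pd h t * (- h * sin (h * t))).
Proof.
eapply is_derive_val.
apply (is_derive_comp (fun y => spow y be) (fun t => Xf h t)).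
apply is_derive_spow; unfold be; lra.
unfold Xf; auto_derive. easy. reflexivity.
unfold scal; simpl; unfold mult; simpl. unfold Pd, be. ring.
Qed.

Lemma cont_cos_ht h t : continuous (fun q : R * R => cos (fst q * snd q)) (h, t).
Proof. apply (cont_fun cos). apply cont_mult. apply continuous_fst. apply continuous_snd. apply continuous_cos. Qed.

Lemma cont_sin_ht h t : continuous (fun q : R * R => sin (fst q * snd q)) (h, t).
Proof. apply (cont_fun sin). apply cont_mult. apply continuous_fst. apply continuous_snd. apply continuous_sin. Qed.

Lemma cont_Xf h t : continuous (fun q : R * R => Xf (fst q) (snd q)) (h, t).
Proof. apply cont_minus. apply cont_cos_ht. apply (cont_fun cos). apply continuous_fst. apply continuous_cos. Qed.

Lemma cont_Pf h t : continuous (fun q : R * R => Pf (fst q) (snd q)) (h, t).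
Proof. apply (cont_fun (fun y => spow y be)). apply cont_Xf. apply cont_spow; unfold be; lra. Qed.

Lemma cont_Pd h t : continuous (fun q : R * R => Pd (fst q) (snd q)) (h, t).
Proof. apply cont_mult. apply cont_const. apply (cont_fun (fun y => apow y be)). apply cont_Xf. apply cont_apow; unfold be; lra. Qed.

Definition DA (h t : R) : R :=
  Pf h t * cos (h * t) + h * (Pd h t * (sin h - t * sin (h * t))) * cos (h * t) - h * Pf h t * (t * sin (h * t)).
Definition DB (h t : R) : R := Pf h t + h * (Pd h t * (sin h - t * sin (h * t))).

Lemma cont_Xf_deriv h t : continuous (fun q : R * R => sin (fst q) - snd q * sin (fst q * snd q)) (h, t).
Proof.
apply cont_minus. apply (cont_fun sin). apply continuous_fst. apply continuous_sin.
apply cont_mult. apply continuous_snd. apply cont_sin_ht.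
Qed.

Lemma cont_DB h t : continuous (fun q : R * R => DB (fst q) (snd q)) (h, t).
Proof.
apply cont_plus. apply cont_Pf. apply cont_mult. apply continuous_fst.
apply cont_mult. apply cont_Pd. apply cont_Xf_deriv.
Qed.

Lemma cont_DA h t : continuous (fun q : R * R => DA (fst q) (snd q)) (h, t).
Proof.
apply cont_minus. apply cont_plus.
- apply cont_mult. apply cont_Pf. apply cont_cos_ht.
- apply cont_mult. 2: apply cont_cos_ht. apply cont_mult. apply continuous_fst.
  apply cont_mult. apply cont_Pd. apply cont_Xf_deriv.
- apply cont_mult. apply cont_mult. apply continuous_fst. apply cont_Pf.
  apply cont_mult. apply continuous_snd. apply cont_sin_ht.
Qed.

Lemma cont_slice_Pf h t : continuous (Pf h) t.
Proof. apply (cont_slice_r Pf). apply cont_Pf. Qed.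

Lemma ex_RInt_A h : ex_RInt (fun t => h * Pf h t * cos (h * t)) 0 1.
Proof.
apply ex_RInt_cont. lra. intros t _. apply cont_mult. apply cont_mult. apply cont_const. apply cont_slice_Pf.
apply (cont_slice_r (fun h t => cos (h * t))). apply cont_cos_ht.
Qed.

Lemma ex_RInt_B h : ex_RInt (fun t => h * Pf h t) 0 1.
Proof.
apply ex_RInt_cont. lra. intros t _. apply cont_mult. apply cont_const. apply cont_slice_Pf.
Qed.

Lemma is_derive_Aint h : is_derive Aint h (RInt (DA h) 0 1).
Proof.
apply (derive_RInt_param (fun h t => h * Pf h t * cos (h * t)) DA). lra.
- apply filter_forall. intros u t _. pose proof (is_derive_Pf_h u t) as D.
  assert (E : ex_derive (fun h => Pf h t) u) by (eexists; exact D).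
  eapply is_derive_val. auto_derive. repeat split; auto. reflexivity.
  rewrite (is_derive_unique (fun x : R => Pf x t) _ _ D : Derive (fun x : R => Pf x t) u = _). unfold DA. ring.
- intros; apply cont_DA.
- apply filter_forall; intros; apply ex_RInt_A.
Qed.

Lemma is_derive_Bint h : is_derive Bint h (RInt (DB h) 0 1).
Proof.
apply (derive_RInt_param (fun h t => h * Pf h t) DB). lra.
- apply filter_forall. intros u t _. pose proof (is_derive_Pf_h u t) as D.
  assert (E : ex_derive (fun h => Pf h t) u) by (eexists; exact D).
  eapply is_derive_val. auto_derive. repeat split; auto. reflexivity.
  rewrite (is_derive_unique (fun x : R => Pf x t) _ _ D : Derive (fun x : R => Pf x t) u = _). unfold DB. ring.
- intros; apply cont_DB.
- apply filter_forall; intros; apply ex_RInt_B.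
Qed.

Lemma Pf_1 h : Pf h 1 = 0.
Proof. unfold Pf, Xf, spow. rewrite Rmult_1_r. ring. Qed.

Lemma XPd h t : Xf h t * Pd h t = (al - 1) * Pf h t.
Proof. unfold Pd, Pf, spow. ring. Qed.

Lemma exact_int (E dE : R -> R) : (forall t, is_derive E t (dE t)) -> (forall t, continuous dE t) -> E 0 = 0 -> E 1 = 0 ->
  is_RInt dE 0 1 0.
Proof.
intros H Hc E0 E1. replace 0 with (minus (E 1) (E 0)) at 2 by (rewrite E0, E1; unfold minus, plus, opp; simpl; ring).
apply (is_RInt_derive (V := R_CompleteNormedModule)); intros; auto.
Qed.

Lemma cont_slice_Pd h t : continuous (Pd h) t.
Proof. apply (cont_slice_r Pd). apply cont_Pd. Qed.

Lemma cont_cos_k h t : continuous (fun t => cos (h * t)) t.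
Proof. apply (cont_slice_r (fun h t => cos (h * t))). apply cont_cos_ht. Qed.

Lemma cont_sin_k h t : continuous (fun t => sin (h * t)) t.
Proof. apply (cont_slice_r (fun h t => sin (h * t))). apply cont_sin_ht. Qed.

(** This integrand is the derivative of [Pf h t * sin (h * t)], which vanishes at both ends. With
    the next two lemmas it supplies the integrations by parts: multiples of such integrands may be
    added freely under the integral. *)
Lemma exact_P h : is_RInt (fun t => h * Pf h t * cos (h * t) - h * Pd h t * sin (h * t) ^ 2) 0 1 0.
Proof.
apply (exact_int (fun t => Pf h t * sin (h * t))).
- intros t. pose proof (is_derive_Pf_t h t) as D.
  assert (E : ex_derive (fun t => Pf h t) t) by (eexists; exact D).
  eapply is_derive_val. auto_derive. repeat split; auto. reflexivity.
  rewrite (is_derive_unique (fun x : R => Pf h x) _ _ D : Derive (fun x : R => Pf h x) t = _). ring.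
- intros t. apply cont_minus; apply cont_mult.
  apply cont_mult. apply cont_const. apply cont_slice_Pf. apply cont_cos_k.
  apply cont_mult. apply cont_const. apply cont_slice_Pd. apply cont_pow, cont_sin_k.
- rewrite Rmult_0_r, sin_0; ring.
- rewrite Pf_1; ring.
Qed.

Lemma exact_tP h : is_RInt (fun t => Pf h t - h * Pd h t * (t * sin (h * t))) 0 1 0.
Proof.
apply (exact_int (fun t => t * Pf h t)).
- intros t. pose proof (is_derive_Pf_t h t) as D.
  assert (E : ex_derive (fun t => Pf h t) t) by (eexists; exact D).
  eapply is_derive_val. auto_derive. repeat split; auto. reflexivity.
  rewrite (is_derive_unique (fun x : R => Pf h x) _ _ D : Derive (fun x : R => Pf h x) t = _). ring.
- intros t. apply cont_minus. apply cont_slice_Pf. apply cont_mult.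
  apply cont_mult. apply cont_const. apply cont_slice_Pd. apply cont_mult. apply cont_id. apply cont_sin_k.
- ring.
- rewrite Pf_1; ring.
Qed.

Lemma exact_tPcos h : is_RInt (fun t => Pf h t * cos (h * t) - h * Pd h t * (t * sin (h * t)) * cos (h * t)
   - h * Pf h t * (t * sin (h * t))) 0 1 0.
Proof.
apply (exact_int (fun t => t * Pf h t * cos (h * t))).
- intros t. pose proof (is_derive_Pf_t h t) as D.
  assert (E : ex_derive (fun t => Pf h t) t) by (eexists; exact D).
  eapply is_derive_val. auto_derive. repeat split; auto. reflexivity.
  rewrite (is_derive_unique (fun x : R => Pf h x) _ _ D : Derive (fun x : R => Pf h x) t = _). ring.
- intros t. assert (C : continuous (fun t => t * sin (h * t)) t).
  { apply cont_mult. apply cont_id. apply cont_sin_k. }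
  apply cont_minus. apply cont_minus.
  apply cont_mult. apply cont_slice_Pf. apply cont_cos_k.
  apply cont_mult. 2: apply cont_cos_k. apply cont_mult. 2: exact C. apply cont_mult. apply cont_const. apply cont_slice_Pd.
  apply cont_mult. 2: exact C. apply cont_mult. apply cont_const. apply cont_slice_Pf.
- ring.
- rewrite Pf_1; ring.
Qed.

Lemma RInt_lin3 (f g1 g2 g3 : R -> R) (c1 c2 c3 l1 l2 l3 : R) :
  is_RInt g1 0 1 l1 -> is_RInt g2 0 1 l2 -> is_RInt g3 0 1 l3 ->
  (forall t, f t = c1 * g1 t + c2 * g2 t + c3 * g3 t) -> RInt f 0 1 = c1 * l1 + c2 * l2 + c3 * l3.
Proof.
intros H1 H2 H3 E. apply is_RInt_unique.
apply is_RInt_ext with (fun t => plus (plus (scal c1 (g1 t)) (scal c2 (g2 t))) (scal c3 (g3 t))).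
{ intros t _. rewrite E. reflexivity. }
apply (is_RInt_plus (V := R_NormedModule)). apply (is_RInt_plus (V := R_NormedModule)).
all: apply (is_RInt_scal (V := R_NormedModule)); assumption.
Qed.

Lemma is_RInt_A h : is_RInt (fun t => h * Pf h t * cos (h * t)) 0 1 (Aint h).
Proof. apply (RInt_correct (V := R_CompleteNormedModule)), ex_RInt_A. Qed.

Lemma is_RInt_B h : is_RInt (fun t => h * Pf h t) 0 1 (Bint h).
Proof. apply (RInt_correct (V := R_CompleteNormedModule)), ex_RInt_B. Qed.

Lemma sin_sq x : sin x ^ 2 = 1 - cos x ^ 2.
Proof. pose proof (sin2_cos2 x) as E; unfold Rsqr in E. lra. Qed.

(** [sin h] times [DA] is the integrand of the right-hand side plus [sin h] times that of
    [exact_tPcos] minus [cos h] times that of [exact_P]. Pointwise, this rests on [XPd] and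
    [sin^2 + cos^2 = 1]. *)
Lemma derive_Aint h : RInt (DA h) 0 1 * sin h = al * cos h * Aint h + (al - 1) * Bint h.
Proof.
assert (E : RInt (fun t => sin h * DA h t) 0 1 = sin h * RInt (DA h) 0 1).
{ apply (RInt_scal (V := R_CompleteNormedModule)). apply ex_RInt_cont. lra.
  intros t _. apply (cont_slice_r DA), cont_DA. }
rewrite Rmult_comm, <- E.
assert (J : is_RInt (fun t => al * cos h * (h * Pf h t * cos (h * t)) + (al - 1) * (h * Pf h t)) 0 1
   (al * cos h * Aint h + (al - 1) * Bint h)).
{ apply (is_RInt_plus (V := R_NormedModule)); apply (is_RInt_scal (V := R_NormedModule)).
  apply is_RInt_A. apply is_RInt_B. }
rewrite (RInt_lin3 _ _ _ _ 1 (sin h) (- cos h) _ _ _ J (exact_tPcos h) (exact_P h)). ring.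
intros t. unfold DA. rewrite (sin_sq (h * t)).
pose proof (XPd h t) as EX. unfold Xf in EX. pose proof (sin_sq h) as Es.
set (k := cos (h * t)) in *. set (c := cos h) in *. set (s := sin h) in *. set (P := Pf h t) in *. set (D := Pd h t) in *.
apply Rminus_diag_uniq.
transitivity (h * (D * k * (s ^ 2) - D * c * (1 - k ^ 2) - (al - 1) * P * (1 + c * k))). ring.
rewrite Es. replace ((al - 1) * P * (1 + c * k)) with (((al - 1) * P) * (1 + c * k)) by ring. rewrite <- EX. ring.
Qed.

(** The same elimination, with [sin h] times [exact_tP] minus [exact_P]. *)
Lemma derive_Bint h : RInt (DB h) 0 1 * sin h = (al - 1) * cos h * Bint h + al * Aint h.
Proof.
assert (E : RInt (fun t => sin h * DB h t) 0 1 = sin h * RInt (DB h) 0 1).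
{ apply (RInt_scal (V := R_CompleteNormedModule)). apply ex_RInt_cont. lra.
  intros t _. apply (cont_slice_r DB), cont_DB. }
rewrite Rmult_comm, <- E.
assert (J : is_RInt (fun t => (al - 1) * cos h * (h * Pf h t) + al * (h * Pf h t * cos (h * t))) 0 1
   ((al - 1) * cos h * Bint h + al * Aint h)).
{ apply (is_RInt_plus (V := R_NormedModule)); apply (is_RInt_scal (V := R_NormedModule)).
  apply is_RInt_B. apply is_RInt_A. }
rewrite (RInt_lin3 _ _ _ _ 1 (sin h) (- 1) _ _ _ J (exact_tP h) (exact_P h)). ring.
intros t. unfold DB. rewrite (sin_sq (h * t)).
pose proof (XPd h t) as EX. unfold Xf in EX. pose proof (sin_sq h) as Es.
set (k := cos (h * t)) in *. set (c := cos h) in *. set (s := sin h) in *. set (P := Pf h t) in *. set (D := Pd h t) in *.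
apply Rminus_diag_uniq.
transitivity (h * (D * (s ^ 2) - D * (1 - k ^ 2) - (al - 1) * P * (c + k))). ring.
rewrite Es. replace ((al - 1) * P * (c + k)) with (((al - 1) * P) * (c + k)) by ring. rewrite <- EX. ring.
Qed.

(** With [k = cos (h t)], [c = cos h] and [X = k - c] one has [1 - k c = X k + (1 - k^2)]; [exact_P]
    trades the term with [sin (h t)^2] for a further multiple of [Aint]. *)
Lemma Nint_Aint h : 0 < h < PI -> Nint al h = al / (al - 1) * Aint h.
Proof.
intros Hh. unfold Nint.
assert (E : RInt (fun t => h * Rpower (cos (h * t) - cos h) (al - 2) * (1 - cos (h * t) * cos h)) 0 1 =
  RInt (fun t => h * apow (Xf h t) be * (1 - cos (h * t) * cos h)) 0 1).
{ apply RInt_ext. rewrite Rmin_left, Rmax_right by lra. intros t Ht.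
  rewrite apow_pos. reflexivity. unfold Xf. apply Rlt_0_minus, cos_decreasing_1; nra. }
rewrite E.
rewrite (RInt_lin3 _ _ _ _ (al / (al - 1)) (- / (al - 1)) 0 _ _ _ (is_RInt_A h) (exact_P h) (exact_P h)). ring.
intros t. rewrite (sin_sq (h * t)).
pose proof (XPd h t) as EX. unfold Pf, Pd, Xf, spow in *. set (k := cos (h * t)) in *. set (c := cos h) in *.
set (w := apow _ _) in *. field. lra.
Qed.

(* With [t = cot h] the pair [Kfun], [Kfun'] turns the two relations above into
   [(1 + t ^ 2) Kfun'' = al (al - 1) Kfun]. *)
Definition Kfun (t : R) : R := Rpower 2 al * (al / (al - 1)) * Rpower (1 + t ^ 2) (al / 2) * Aint (angle t).
Definition Kfun' (t : R) : R := - (Rpower 2 al * al) * Rpower (1 + t ^ 2) ((al - 1) / 2) * Bint (angle t).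

Lemma cos_angle t : cos (angle t) = t / sqrt (1 + t ^ 2).
Proof.
unfold angle. rewrite cos_shift, sin_atan. do 3 f_equal. unfold Rsqr; ring.
Qed.

Lemma sin_angle t : sin (angle t) = / sqrt (1 + t ^ 2).
Proof.
unfold angle. rewrite sin_shift, cos_atan. unfold Rdiv. rewrite Rmult_1_l. do 2 f_equal. unfold Rsqr; ring.
Qed.

Lemma is_derive_angle t : is_derive angle t (- / (1 + t ^ 2)).
Proof. unfold angle. auto_derive. easy. unfold Rsqr. field. nra. Qed.

Lemma is_derive_Rpower_sq a t : is_derive (fun t => Rpower (1 + t ^ 2) a) t (2 * a * t * Rpower (1 + t ^ 2) (a - 1)).
Proof.
assert (0 < 1 + t ^ 2) by nra.
unfold Rpower at 1. eapply is_derive_val. auto_derive. 2: reflexivity. simpl in H; lra.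
unfold Rminus. rewrite Rpower_plus, Rpower_Ropp, Rpower_1 by assumption. unfold Rpower.
replace (t * (t * 1)) with (t ^ 2) by ring. field. lra.
Qed.

Lemma is_derive_angle_comp (F : R -> R) t d : is_derive F (angle t) d ->
  is_derive (fun t => F (angle t)) t (- / (1 + t ^ 2) * d).
Proof.
intros H. eapply is_derive_val. apply (is_derive_comp F angle). exact H. apply is_derive_angle.
reflexivity.
Qed.

Lemma Rpower_half q b : 0 < q -> Rpower q (b - 1) * sqrt q = Rpower q (b - 1 / 2).
Proof. intros H. rewrite <- Rpower_sqrt, <- Rpower_plus by assumption. f_equal. field. Qed.

(** At [h = angle t] the factor [(1 + t^2)^(al / 2)] is [(sin h)^(- al)], the integrating factor
    that removes the term [al cos h Aint] from [derive_Aint]. In [Kfun'] the power [(al - 1) / 2]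
    does the same for [derive_Bint]. *)
Lemma is_derive_Kfun t : is_derive Kfun t (Kfun' t).
Proof.
assert (Hq : 0 < 1 + t ^ 2) by nra. assert (Hs : 0 < sqrt (1 + t ^ 2)) by now apply sqrt_lt_R0.
pose proof (is_derive_angle_comp Aint t _ (is_derive_Aint (angle t))) as D1.
pose proof (is_derive_Rpower_sq (al / 2) t) as D2.
pose proof (derive_Aint (angle t)) as EA. rewrite sin_angle, cos_angle in EA.
eapply is_derive_val.
- apply (is_derive_mult (fun t => Rpower 2 al * (al / (al - 1)) * Rpower (1 + t ^ 2) (al / 2)) (fun t => Aint (angle t)) t).
  apply (is_derive_scal (fun t => Rpower (1 + t ^ 2) (al / 2)) t (Rpower 2 al * (al / (al - 1)))). exact D2.
  exact D1. exact Rmult_comm.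
- match goal with |- plus (mult ?a ?b) (mult ?c ?d) = ?r => change (a * b + c * d = r) end. unfold Kfun'.
  replace (Rpower (1 + t ^ 2) ((al - 1) / 2)) with (Rpower (1 + t ^ 2) (al / 2 - 1) * sqrt (1 + t ^ 2))
   by (rewrite Rpower_half by assumption; f_equal; field).
  replace (Rpower (1 + t ^ 2) (al / 2)) with (Rpower (1 + t ^ 2) (al / 2 - 1) * (1 + t ^ 2)).
  2:{ rewrite <- (Rpower_1 (1 + t ^ 2)) at 2 by assumption. rewrite <- Rpower_plus. f_equal. ring. }
  replace (RInt (DA (angle t)) 0 1) with (al * t * Aint (angle t) + (al - 1) * sqrt (1 + t ^ 2) * Bint (angle t)).
  + field. lra.
  + apply Rmult_eq_reg_r with (/ sqrt (1 + t ^ 2)). rewrite EA. field. lra. apply Rinv_neq_0_compat; lra.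
Qed.

Lemma is_derive_Kfun' t : is_derive Kfun' t (al * (al - 1) / (1 + t ^ 2) * Kfun t).
Proof.
assert (Hq : 0 < 1 + t ^ 2) by nra. assert (Hs : 0 < sqrt (1 + t ^ 2)) by now apply sqrt_lt_R0.
assert (Hss := sqrt_sqrt (1 + t ^ 2) ltac:(lra)).
pose proof (is_derive_angle_comp Bint t _ (is_derive_Bint (angle t))) as D1.
pose proof (is_derive_Rpower_sq ((al - 1) / 2) t) as D2.
pose proof (derive_Bint (angle t)) as EB. rewrite sin_angle, cos_angle in EB.
eapply is_derive_val.
- apply (is_derive_mult (fun t => - (Rpower 2 al * al) * Rpower (1 + t ^ 2) ((al - 1) / 2)) (fun t => Bint (angle t)) t).
  apply (is_derive_scal (fun t => Rpower (1 + t ^ 2) ((al - 1) / 2)) t (- (Rpower 2 al * al))). exact D2.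
  exact D1. exact Rmult_comm.
- match goal with |- plus (mult ?a ?b) (mult ?c ?d) = ?r => change (a * b + c * d = r) end. unfold Kfun.
  replace (Rpower (1 + t ^ 2) (al / 2)) with (Rpower (1 + t ^ 2) ((al - 1) / 2 - 1) * sqrt (1 + t ^ 2) * (1 + t ^ 2)).
  2:{ rewrite Rpower_half by assumption. rewrite <- (Rpower_1 (1 + t ^ 2)) at 2 by assumption. rewrite <- Rpower_plus. f_equal. field. }
  replace (Rpower (1 + t ^ 2) ((al - 1) / 2)) with (Rpower (1 + t ^ 2) ((al - 1) / 2 - 1) * (1 + t ^ 2)).
  2:{ rewrite <- (Rpower_1 (1 + t ^ 2)) at 2 by assumption. rewrite <- Rpower_plus. f_equal. ring. }
  replace (RInt (DB (angle t)) 0 1) with ((al - 1) * t * Bint (angle t) + al * sqrt (1 + t ^ 2) * Aint (angle t)).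
  + field. lra.
  + apply Rmult_eq_reg_r with (/ sqrt (1 + t ^ 2)). rewrite EB. field. lra. apply Rinv_neq_0_compat; lra.
Qed.

Lemma angle_bounds t : 0 < angle t < PI.
Proof. unfold angle. pose proof (atan_bound t). lra. Qed.

Lemma limit_density_Kfun t : limit_density al t = Rpower (1 + t ^ 2) (- al) * Kfun t.
Proof.
unfold limit_density, Kfun. rewrite Nint_Aint by apply angle_bounds.
replace (Rpower (1 + t ^ 2) (- al / 2)) with (Rpower (1 + t ^ 2) (- al) * Rpower (1 + t ^ 2) (al / 2)). ring.
rewrite <- Rpower_plus. f_equal; field.
Qed.

End Legendre.

(** * The Gamma function and the Wallis integrals *)

(** The limit is the supremum over all compact subintervals, approached because the integral grows
    with the interval. *)
Lemma improper_nonneg (f : R -> R) C : (forall t, 0 < t -> continuous f t) -> (forall t, 0 < t -> 0 <= f t) ->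
  (forall a b, 0 < a <= b -> RInt f a b <= C) ->
  exists l, is_RInt_gen f (at_right 0) (Rbar_locally p_infty) l /\
    forall a b, 0 < a <= b -> RInt f a b <= l.
Proof.
intros Hc Hp Hb.
assert (ex : forall a b, 0 < a <= b -> ex_RInt f a b).
{ intros a b H. apply ex_RInt_cont. lra. intros; apply Hc; lra. }
set (E := fun v => exists a b, 0 < a <= b /\ v = RInt f a b).
destruct (completeness E) as [l [Hl1 Hl2]].
- exists C. intros v (a & b & H & ->). now apply Hb.
- exists (RInt f 1 1), 1, 1. split; auto; lra.
- assert (Hle : forall a b, 0 < a <= b -> RInt f a b <= l) by (intros a b H; apply Hl1; now exists a, b).
  assert (mono : forall a b a' b', 0 < a' <= a -> a <= b <= b' -> RInt f a b <= RInt f a' b').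
  { intros a b a' b' H1 H2.
    rewrite <- (RInt_Chasles (V := R_CompleteNormedModule) f a' a b') by (apply ex; lra).
    rewrite <- (RInt_Chasles (V := R_CompleteNormedModule) f a b b') by (apply ex; lra).
    assert (0 <= RInt f a' a) by (apply RInt_ge_0; [lra|apply ex; lra|intros; apply Hp; lra]).
    assert (0 <= RInt f b b') by (apply RInt_ge_0; [lra|apply ex; lra|intros; apply Hp; lra]).
    unfold plus; simpl. lra. }
  exists l; split; auto.
  intros P [eps HP].
  assert (Ha : exists a0 b0, 0 < a0 <= b0 /\ l - eps < RInt f a0 b0).
  { apply Classical_Prop.NNPP. intros Hn. pose proof (cond_pos eps).
    assert (l <= l - eps); [|lra]. apply Hl2. intros v (a & b & H' & ->).
    apply Rnot_lt_le. intros Hlt. apply Hn. now exists a, b. }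
  destruct Ha as (a0 & b0 & H0 & Hlt).
  exists (fun a => 0 < a < a0) (fun b => b0 < b).
  + unfold at_right, within. assert (L := locally_Ioo (- a0) a0 0 ltac:(lra)).
    apply filter_imp with (2 := L). intros; lra.
  + now exists b0.
  + intros a b Ha' Hb'. simpl. exists (RInt f a b). split.
    * apply (RInt_correct (V := R_CompleteNormedModule)), ex; lra.
    * apply HP. unfold ball; simpl; unfold AbsRing_ball, abs, minus, plus, opp; simpl.
      assert (h1 := mono a0 b0 a b ltac:(lra) ltac:(lra)). assert (h2 := Hle a b ltac:(lra)).
      apply Rabs_def1; pose proof (cond_pos eps); lra.
Qed.

Definition gker (s t : R) : R := Rpower t (s - 1) * exp (- t).

Lemma cont_exp_opp t : continuous (fun t => exp (- t)) t.
Proof. apply (cont_fun exp). apply cont_opp, cont_id. apply continuous_exp. Qed.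

Lemma cont_Rpower a t : 0 < t -> continuous (fun t => Rpower t a) t.
Proof.
intros H. apply (cont_fun exp). 2: apply continuous_exp. apply cont_mult. apply cont_const. now apply continuous_ln.
Qed.

Lemma cont_gker s t : 0 < t -> continuous (gker s) t.
Proof. intros H. apply cont_mult. now apply cont_Rpower. apply cont_exp_opp. Qed.

Lemma gker_pos s t : 0 < gker s t.
Proof. apply Rmult_lt_0_compat; apply exp_pos. Qed.

(** The witness is the maximum of [t^m e^(- t)], taken at [t = m]; the bound is [ln u <= u - 1] at
    [u = t / m]. *)
Lemma power_exp_bound m : 0 < m -> exists C, 0 < C /\ forall t, 0 < t -> Rpower t m * exp (- t) <= C.
Proof.
intros Hm. exists (exp (m * ln m - m)). split. apply exp_pos. intros t Ht.
unfold Rpower. rewrite <- exp_plus. 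
assert (H : ln (t / m) <= t / m - 1).
{ assert (0 < t / m) by (apply Rdiv_lt_0_compat; lra).
  pose proof (exp_ineq1_le (ln (t / m))) as E. rewrite exp_ln in E by assumption. lra. }
rewrite ln_div in H by lra.
assert (m * (ln t - ln m) <= m * (t / m - 1)) by (apply Rmult_le_compat_l; lra).
replace (m * (t / m - 1)) with (t - m) in H0 by (field; lra).
destruct (Req_dec (m * ln t + - t) (m * ln m - m)) as [->|]. lra.
left. apply exp_increasing. lra.
Qed.

Lemma is_derive_Rpower_t a t : 0 < t -> is_derive (fun t => Rpower t a) t (a * Rpower t (a - 1)).
Proof.
intros H. unfold Rpower at 1. eapply is_derive_val. auto_derive. 2: reflexivity. lra.
unfold Rminus. rewrite Rpower_plus, Rpower_Ropp, Rpower_1 by assumption. unfold Rpower. field. lra.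
Qed.

(** On [(0, 1]] the power [t^(s - 1)] dominates and contributes at most [/ s]; beyond 1 the kernel
    is at most [C / t^2]. *)
Lemma Gamma_bound s : 0 < s -> exists C, forall a b, 0 < a <= b -> RInt (gker s) a b <= C.
Proof.
intros Hs. destruct (power_exp_bound (s + 1) ltac:(lra)) as (C & HC & HB).
exists (/ s + C).
assert (ex : forall a b, 0 < a <= b -> ex_RInt (gker s) a b).
{ intros a b H. apply ex_RInt_cont. lra. intros; apply cont_gker; lra. }
assert (H1 : forall a, 0 < a <= 1 -> RInt (gker s) a 1 <= / s).
{ intros a Ha.
  assert (I : is_RInt (fun t => Rpower t (s - 1)) a 1 (minus (Rpower 1 s / s) (Rpower a s / s))).
  { apply (is_RInt_derive (V := R_CompleteNormedModule) (fun t => Rpower t s / s)); rewrite Rmin_left, Rmax_right by lra; intros t Ht.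
    - pose proof (is_derive_Rpower_t s t ltac:(lra)) as D.
      apply is_derive_ext with (fun t => / s * Rpower t s). intros; unfold Rdiv; apply Rmult_comm.
      eapply is_derive_val. apply (is_derive_scal (fun t => Rpower t s) t (/ s)); exact D.
      field. lra.
    - apply cont_Rpower; lra. }
  apply Rle_trans with (RInt (fun t => Rpower t (s - 1)) a 1).
  - apply RInt_le; try lra. apply ex; lra. eexists; exact I.
    intros t Ht. unfold gker. rewrite <- (Rmult_1_r (Rpower t (s - 1))) at 2.
    apply Rmult_le_compat_l. left; apply Rpower_pos. rewrite <- exp_0. left. apply exp_increasing. lra.
  - rewrite (is_RInt_unique _ _ _ _ I). unfold minus, plus, opp; simpl.
    replace (Rpower 1 s) with 1 by (unfold Rpower; rewrite ln_1, Rmult_0_r, exp_0; reflexivity).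
    assert (0 < Rpower a s / s) by (apply Rdiv_lt_0_compat; [apply Rpower_pos|lra]). unfold Rdiv in *. lra. }
assert (H2 : forall b, 1 <= b -> RInt (gker s) 1 b <= C).
{ intros b Hb. eapply Rle_trans. apply Rle_abs.
  replace C with (C / 1) by field. apply tail_bound with 1; try lra.
  - intros; apply cont_gker; lra.
  - intros x Hx. rewrite Rabs_pos_eq by (left; apply gker_pos).
    apply Rmult_le_reg_r with (x ^ 2). apply pow_lt; lra.
    unfold Rdiv. rewrite Rmult_assoc, Rinv_l, Rmult_1_r by (apply pow_nonzero; lra).
    eapply Rle_trans. 2: apply (HB x); lra. right. unfold gker.
    replace (s + 1) with (s - 1 + 2) by ring. rewrite Rpower_plus.
    replace (Rpower x 2) with (x ^ 2) by (rewrite <- Rpower_pow by lra; f_equal; simpl; ring). ring. }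
assert (pos : forall a b, 0 < a <= b -> 0 <= RInt (gker s) a b).
{ intros a b H. apply RInt_ge_0. lra. now apply ex. intros; left; apply gker_pos. }
assert (0 < / s) by (now apply Rinv_0_lt_compat).
intros a b Hab.
destruct (Rle_dec b 1); [|destruct (Rle_dec 1 a)].
- assert (RInt (gker s) a b <= RInt (gker s) a 1).
  { rewrite <- (RInt_Chasles (V := R_CompleteNormedModule) (gker s) a b 1) by (apply ex; lra).
    pose proof (pos b 1 ltac:(lra)). unfold plus; simpl; lra. }
  pose proof (H1 a ltac:(lra)). lra.
- assert (RInt (gker s) a b <= RInt (gker s) 1 b).
  { rewrite <- (RInt_Chasles (V := R_CompleteNormedModule) (gker s) 1 a b) by (apply ex; lra).
    pose proof (pos 1 a ltac:(lra)). unfold plus; simpl; lra. }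
  pose proof (H2 b ltac:(lra)). lra.
- rewrite <- (RInt_Chasles (V := R_CompleteNormedModule) (gker s) a 1 b) by (apply ex; lra).
  pose proof (H1 a ltac:(lra)). pose proof (H2 b ltac:(lra)). unfold plus; simpl; lra.
Qed.

Lemma RInt_gen_0_infty (f : R -> R) l : is_RInt_gen f (at_right 0) (Rbar_locally p_infty) l ->
  RInt_gen f (at_right 0) (Rbar_locally p_infty) = l.
Proof. exact (is_RInt_gen_unique (V := R_CompleteNormedModule) f l). Qed.

Lemma Gamma_correct s : 0 < s ->
  is_RInt_gen (gker s) (at_right 0) (Rbar_locally p_infty) (Gamma s) /\
  forall a b, 0 < a <= b -> RInt (gker s) a b <= Gamma s.
Proof.
intros Hs. destruct (Gamma_bound s Hs) as [C HC].
destruct (improper_nonneg (gker s) C) as (l & H1 & H2); auto.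
- intros; now apply cont_gker.
- intros; left; apply gker_pos.
- replace (Gamma s) with l; auto. symmetry. exact (RInt_gen_0_infty (gker s) l H1).
Qed.

Lemma Gamma_pos s : 0 < s -> 0 < Gamma s.
Proof.
intros Hs. destruct (Gamma_correct s Hs) as [_ H].
eapply Rlt_le_trans. 2: apply (H 1 2); lra.
apply RInt_gt_0. lra. intros; apply gker_pos. intros; apply cont_gker; lra.
Qed.

Lemma at_right_0_ge (P : R * R -> Prop) : (forall a b, 0 < a <= b -> P (a, b)) ->
  filter_prod (at_right 0) (Rbar_locally p_infty) P.
Proof.
intros H. exists (fun a => 0 < a < 1) (fun b => 1 < b).
- unfold at_right, within. assert (L := locally_Ioo (- 1) 1 0 ltac:(lra)).
  apply filter_imp with (2 := L). intros; lra.
- now exists 1.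
- intros a b Ha Hb. apply H; lra.
Qed.

Lemma is_RInt_gen_nonneg (f : R -> R) l : is_RInt_gen f (at_right 0) (Rbar_locally p_infty) l ->
  (forall t, 0 < t -> 0 <= f t) -> 0 <= l.
Proof.
intros H Hp. apply Rnot_lt_le. intros Hl.
assert (L := H _ (open_lt 0 l Hl)). unfold filtermapi in L.
assert (G : filter_prod (at_right 0) (Rbar_locally p_infty) (fun ab => 0 < fst ab <= snd ab)).
{ now apply at_right_0_ge. }
destruct (filter_ex _ (filter_and _ _ L G)) as [[a b] [(v & Hv & Hv0) Hab]].
simpl in *. assert (0 <= v); [|lra].
rewrite <- (is_RInt_unique _ _ _ _ Hv). apply RInt_ge_0. lra. now exists v.
intros; apply Hp; lra.
Qed.

Lemma gker_limits s : 0 < s ->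
  filterlim (fun t => Rpower t s * exp (- t)) (at_right 0) (locally 0) /\
  filterlim (fun t => Rpower t s * exp (- t)) (Rbar_locally p_infty) (locally 0).
Proof.
intros Hs. split.
- apply filterlim_ext_loc with (fun t => apow t s * exp (- t)).
  { unfold at_right, within. apply filter_forall. intros t Ht. now rewrite apow_pos. }
  assert (C : continuous (fun t => apow t s * exp (- t)) 0).
  { apply cont_mult. apply cont_apow; lra. apply cont_exp_opp. }
  unfold continuous in C. replace (apow 0 s * exp (- 0)) with 0 in C.
  2:{ unfold apow. destruct Req_EM_T; [|lra]. destruct Req_EM_T; [lra|ring]. }
  apply filterlim_filter_le_1 with (2 := C). unfold at_right. apply filter_le_within.
- destruct (power_exp_bound (s + 1) ltac:(lra)) as (C & HC & HB).
  apply filterlim_locally. intros eps. pose proof (cond_pos eps).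
  exists (Rmax 1 (C / eps)). intros t Ht.
  assert (h1 := Rmax_l 1 (C / eps)). assert (h2 := Rmax_r 1 (C / eps)).
  unfold ball; simpl; unfold AbsRing_ball, abs, minus, plus, opp; simpl. rewrite Ropp_0, Rplus_0_r.
  rewrite Rabs_pos_eq by (left; apply Rmult_lt_0_compat; apply exp_pos).
  specialize (HB t ltac:(lra)). rewrite Rpower_plus, Rpower_1 in HB by lra.
  apply Rmult_lt_reg_r with t. lra.
  assert (C < eps * t). { apply Rmult_lt_reg_r with (/ eps). now apply Rinv_0_lt_compat.
    replace (eps * t * / eps) with t by (field; lra). unfold Rdiv in h2. lra. }
  lra.
Qed.

Lemma Derive_gker s t : 0 < t -> is_derive (fun t => Rpower t s * exp (- t)) t (s * gker s t - gker (s + 1) t).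
Proof.
intros Ht. pose proof (is_derive_Rpower_t s t Ht) as D.
assert (E : ex_derive (fun t => Rpower t s) t) by (eexists; exact D).
eapply is_derive_val. apply (is_derive_mult (fun t => Rpower t s) (fun t => exp (- t)) t _ (- exp (- t)) D).
auto_derive. easy. ring. exact Rmult_comm.
match goal with |- plus (mult ?a ?b) (mult ?c ?d) = ?r => change (a * b + c * d = r) end.
unfold gker. replace (s + 1 - 1) with s by ring. ring.
Qed.

Lemma Gamma_S s : 0 < s -> Gamma (s + 1) = s * Gamma s.
Proof.
intros Hs. destruct (gker_limits s Hs) as [L0 L1].
set (f := fun t => Rpower t s * exp (- t)) in *.
assert (D : forall t, 0 < t -> Derive f t = s * gker s t - gker (s + 1) t).
{ intros t Ht. apply is_derive_unique. now apply Derive_gker. }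
assert (I : is_RInt_gen (Derive f) (at_right 0) (Rbar_locally p_infty) (0 - 0)).
{ apply is_RInt_gen_Derive; auto; try apply _.
  - apply at_right_0_ge. simpl. intros a b Hab x Hx. rewrite Rmin_left, Rmax_right in Hx by lra.
    eexists. apply Derive_gker; lra.
  - apply at_right_0_ge. simpl. intros a b Hab x Hx. rewrite Rmin_left, Rmax_right in Hx by lra.
    apply cont_ext_loc with (fun t => s * gker s t - gker (s + 1) t).
    + assert (L : locally x (fun t => 0 < t)) by (apply open_gt; lra).
      apply filter_imp with (2 := L). intros t Ht; symmetry; now apply D.
    + apply cont_minus. apply cont_mult. apply cont_const. all: apply cont_gker; lra. }
assert (J : is_RInt_gen (Derive f) (at_right 0) (Rbar_locally p_infty) (s * Gamma s - Gamma (s + 1))).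
{ apply is_RInt_gen_ext with (fun t => minus (scal s (gker s t)) (gker (s + 1) t)).
  - apply at_right_0_ge. simpl. intros a b Hab x Hx. rewrite Rmin_left in Hx by lra. rewrite D by lra. reflexivity.
  - apply (is_RInt_gen_minus (V := R_NormedModule)).
    apply (is_RInt_gen_scal (V := R_NormedModule)). apply Gamma_correct; lra. apply Gamma_correct; lra. }
apply RInt_gen_0_infty in I.
apply RInt_gen_0_infty in J.
rewrite J in I. lra.
Qed.

Lemma Gamma_1 : Gamma 1 = 1.
Proof.
assert (I : is_RInt_gen (Derive (fun t => - exp (- t))) (at_right 0) (Rbar_locally p_infty) (0 - (- 1))).
{ assert (D : forall t, is_derive (fun t => - exp (- t)) t (exp (- t))).
  { intros t. auto_derive. easy. ring. }
  apply is_RInt_gen_Derive; try apply _.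
  - apply at_right_0_ge. intros a b _ x _. eexists; apply D.
  - apply at_right_0_ge. intros a b _ x _. apply continuous_ext with (fun t => exp (- t)).
    intros; symmetry; apply is_derive_unique, D. apply cont_exp_opp.
  - assert (C : continuous (fun t => - exp (- t)) 0) by (apply cont_opp, cont_exp_opp).
    unfold continuous in C. rewrite Ropp_0, exp_0 in C.
    apply filterlim_filter_le_1 with (2 := C). unfold at_right. apply filter_le_within.
  - apply filterlim_locally. intros eps. exists (- ln eps). intros t Ht.
    unfold ball; simpl; unfold AbsRing_ball, abs, minus, plus, opp; simpl. rewrite Ropp_0, Rplus_0_r, Rabs_Ropp.
    rewrite Rabs_pos_eq by (left; apply exp_pos). rewrite <- (exp_ln eps) by apply cond_pos.
    apply exp_increasing; lra. }
assert (J : is_RInt_gen (gker 1) (at_right 0) (Rbar_locally p_infty) (0 - (- 1))).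
{ apply is_RInt_gen_ext with (2 := I). apply at_right_0_ge. simpl. intros a b Hab x Hx. rewrite Rmin_left in Hx by lra.
  unfold gker. rewrite Rminus_eq_0, Rpower_O, Rmult_1_l by lra. apply is_derive_unique.
  auto_derive. easy. ring. }
apply RInt_gen_0_infty in J. change (Gamma 1) with (RInt_gen (gker 1) (at_right 0) (Rbar_locally p_infty)). rewrite J. ring.
Qed.

(** The Cauchy-Schwarz inequality: integrate [t^(x - 1) e^(- t) (l - sqrt t)^2], which is
    nonnegative, with the optimal [l = Gamma (x + 1 / 2) / Gamma x]. *)
Lemma Gamma_half_sq x : 0 < x -> Gamma (x + 1 / 2) ^ 2 <= Gamma x * Gamma (x + 1).
Proof.
intros Hx. pose proof (Gamma_pos x Hx) as P0. pose proof (Gamma_pos (x + 1 / 2) ltac:(lra)) as P1.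
set (l := Gamma (x + 1 / 2) / Gamma x).
assert (I : is_RInt_gen (fun t => plus (minus (scal (l * l) (gker x t)) (scal (2 * l) (gker (x + 1 / 2) t))) (gker (x + 1) t))
  (at_right 0) (Rbar_locally p_infty) (l * l * Gamma x - 2 * l * Gamma (x + 1 / 2) + Gamma (x + 1))).
{ apply (is_RInt_gen_plus (V := R_NormedModule)). apply (is_RInt_gen_minus (V := R_NormedModule)).
  1, 2 : apply (is_RInt_gen_scal (V := R_NormedModule)). all: apply Gamma_correct; lra. }
apply is_RInt_gen_nonneg in I.
- assert (E : l * l * Gamma x - 2 * l * Gamma (x + 1 / 2) + Gamma (x + 1) = Gamma (x + 1) - Gamma (x + 1 / 2) ^ 2 / Gamma x).
  { unfold l. field. lra. }
  rewrite E in I. apply Rmult_le_reg_r with (/ Gamma x). now apply Rinv_0_lt_compat.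
  replace (Gamma x * Gamma (x + 1) * / Gamma x) with (Gamma (x + 1)) by (field; lra). unfold Rdiv in I. lra.
- intros t Ht. unfold plus, minus, opp, scal; simpl; unfold mult, plus; simpl. unfold gker.
  replace (x + 1 / 2 - 1) with (x - 1 + / 2) by field. replace (x + 1 - 1) with (x - 1 + 1) by ring.
  rewrite !Rpower_plus, Rpower_1, Rpower_sqrt by assumption.
  assert (Et := sqrt_sqrt t ltac:(lra)). set (q := sqrt t) in *.
  apply Rle_trans with (Rpower t (x - 1) * exp (- t) * ((l - q) * (l - q))).
  + apply Rmult_le_pos. left; apply Rmult_lt_0_compat; apply exp_pos. apply Rle_0_sqr.
  + right. transitivity (Rpower t (x - 1) * exp (- t) * (l * l - 2 * l * q + q * q)). ring. rewrite Et. ring.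
Qed.

(** * Wallis integrals as quotients of Gamma values *)

Definition wallis (b : R) : R := RInt (fun t => PI / 2 * apow (cos (PI / 2 * t)) b) 0 1.

Lemma cos_unit t : 0 <= t <= 1 -> 0 <= cos (PI / 2 * t) <= 1.
Proof.
intros Ht. pose proof PI_RGT_0. split. apply cos_ge_0; nra. apply COS_bound.
Qed.

Lemma cont_wallis b t : 0 <= b -> continuous (fun t => PI / 2 * apow (cos (PI / 2 * t)) b) t.
Proof.
intros Hb. apply cont_mult. apply cont_const. apply (cont_fun (fun y => apow y b)).
apply cont_cos_k. now apply cont_apow.
Qed.

Lemma ex_wallis b : 0 <= b -> ex_RInt (fun t => PI / 2 * apow (cos (PI / 2 * t)) b) 0 1.
Proof. intros Hb. apply ex_RInt_cont. lra. intros; now apply cont_wallis. Qed.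

Lemma apow_le x b c : 0 <= x <= 1 -> 0 <= b <= c -> apow x c <= apow x b.
Proof.
intros Hx Hb. destruct (Req_dec x 0) as [->|].
- unfold apow. destruct Req_EM_T; [|lra]. destruct (Req_EM_T c 0), (Req_EM_T b 0); lra.
- rewrite !apow_pos by lra. unfold Rpower.
  assert (ln x <= 0). { rewrite <- ln_1. apply ln_le; lra. }
  destruct (Req_dec (c * ln x) (b * ln x)) as [->|]; [lra|]. left. apply exp_increasing. nra.
Qed.

Lemma wallis_decr b c : 0 <= b <= c -> wallis c <= wallis b.
Proof.
intros H. apply RInt_le; try lra; try (apply ex_wallis; lra).
intros t Ht. apply Rmult_le_compat_l. pose proof PI_RGT_0; lra. apply apow_le; auto. apply cos_unit; lra.
Qed.

Lemma wallis_0 : wallis 0 = PI / 2.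
Proof.
unfold wallis. rewrite (RInt_ext _ (fun _ => PI / 2)). rewrite RInt_const. unfold scal; simpl; unfold mult; simpl; ring.
intros; rewrite apow_O; apply Rmult_1_r.
Qed.

Lemma wallis_1 : wallis 1 = 1.
Proof.
unfold wallis. rewrite (RInt_ext _ (fun t => PI / 2 * cos (PI / 2 * t))).
- apply is_RInt_unique. replace 1 with (minus (sin (PI / 2 * 1)) (sin (PI / 2 * 0))) at 2.
  + apply (is_RInt_derive (V := R_CompleteNormedModule) (fun t => sin (PI / 2 * t))); intros t _.
    eapply is_derive_val; [auto_derive; [easy|reflexivity]|ring]. apply cont_mult. apply cont_const. apply cont_cos_k.
  + rewrite Rmult_1_r, Rmult_0_r, sin_0, sin_PI2. unfold minus, plus, opp; simpl; ring.
- rewrite Rmin_left, Rmax_right by lra. intros t Ht.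
  assert (0 < cos (PI / 2 * t)) by (pose proof PI_RGT_0; apply cos_gt_0; nra).
  now rewrite apow_pos, Rpower_1.
Qed.

(** The derivative of [sin * cos^(b + 1)] is integrated; the function vanishes at both ends. *)
Lemma wallis_S b : 0 <= b -> (b + 2) * wallis (b + 2) = (b + 1) * wallis b.
Proof.
intros Hb. pose proof PI_RGT_0.
assert (E : forall t, 0 <= t <= 1 -> cos (PI / 2 * t) ^ 2 * apow (cos (PI / 2 * t)) b = apow (cos (PI / 2 * t)) (b + 2)).
{ intros t Ht. destruct (cos_unit t Ht). replace (b + 2) with (b + 1 + 1) by ring.
  rewrite <- apow_S, <- apow_S by lra. ring. }
assert (I : is_RInt (fun t => PI / 2 * ((b + 2) * (cos (PI / 2 * t) ^ 2 * apow (cos (PI / 2 * t)) b) - (b + 1) * apow (cos (PI / 2 * t)) b)) 0 1 0).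
{ apply (exact_int (fun t => sin (PI / 2 * t) * spow (cos (PI / 2 * t)) b)).
  - intros t.
    assert (D : is_derive (fun t => spow (cos (PI / 2 * t)) b) t ((b + 1) * apow (cos (PI / 2 * t)) b * (- (PI / 2) * sin (PI / 2 * t)))).
    { eapply is_derive_val. apply (is_derive_comp (fun y => spow y b) (fun t => cos (PI / 2 * t))).
      now apply is_derive_spow. auto_derive. easy. reflexivity. unfold scal; simpl; unfold mult; simpl. ring. }
    eapply is_derive_val. apply (is_derive_mult (fun t => sin (PI / 2 * t)) (fun t => spow (cos (PI / 2 * t)) b) t (PI / 2 * cos (PI / 2 * t)) ((b + 1) * apow (cos (PI / 2 * t)) b * (- (PI / 2) * sin (PI / 2 * t)))).
    auto_derive. easy. ring. exact D. exact Rmult_comm.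
    match goal with |- plus (mult ?a ?b) (mult ?c ?d) = ?r => change (a * b + c * d = r) end.
    unfold spow. pose proof (sin_sq (PI / 2 * t)) as Es.
    set (s := sin _) in *. set (c := cos _) in *. set (w := apow _ _).
    transitivity (PI / 2 * (c ^ 2 * w - (b + 1) * w * s ^ 2)). ring. rewrite Es. ring.
  - intros t. assert (Ca : continuous (fun t => apow (cos (PI / 2 * t)) b) t).
    { apply (cont_fun (fun y => apow y b)). apply cont_cos_k. now apply cont_apow. }
    apply cont_mult. apply cont_const. apply cont_minus; apply cont_mult; try apply cont_const; auto.
    apply cont_mult; auto. apply cont_pow, cont_cos_k.
  - rewrite Rmult_0_r, sin_0; ring.
  - rewrite Rmult_1_r, cos_PI2. unfold spow; ring. }
assert (J : is_RInt (fun t => PI / 2 * ((b + 2) * (cos (PI / 2 * t) ^ 2 * apow (cos (PI / 2 * t)) b) - (b + 1) * apow (cos (PI / 2 * t)) b)) 0 1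
   ((b + 2) * wallis (b + 2) - (b + 1) * wallis b)).
{ apply is_RInt_ext with (fun t => minus (scal (b + 2) (PI / 2 * apow (cos (PI / 2 * t)) (b + 2))) (scal (b + 1) (PI / 2 * apow (cos (PI / 2 * t)) b))).
  - rewrite Rmin_left, Rmax_right by lra. intros t Ht. rewrite E by lra. unfold minus, plus, opp, scal; simpl; unfold mult; simpl. ring.
  - apply (is_RInt_minus (V := R_NormedModule)); apply (is_RInt_scal (V := R_NormedModule));
    apply (RInt_correct (V := R_CompleteNormedModule)), ex_wallis; lra. }
pose proof (is_RInt_unique _ _ _ _ I) as I'. pose proof (is_RInt_unique _ _ _ _ J) as J'. rewrite J' in I'. lra.
Qed.

(* Invariant under [b -> b + 2], and squeezed for large [b] by the log-convexity of Gamma: hence constant. *)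
Definition rho (b : R) : R := wallis b * Gamma (b / 2 + 1) / Gamma ((b + 1) / 2).

Lemma rho_S b : 0 <= b -> rho (b + 2) = rho b.
Proof.
intros Hb. pose proof (wallis_S b Hb) as E. unfold rho.
replace ((b + 2) / 2 + 1) with (b / 2 + 1 + 1) by field. replace ((b + 2 + 1) / 2) with ((b + 1) / 2 + 1) by field.
rewrite (Gamma_S (b / 2 + 1)), (Gamma_S ((b + 1) / 2)) by lra. pose proof (Gamma_pos ((b + 1) / 2) ltac:(lra)). pose proof (Gamma_pos (b / 2 + 1) ltac:(lra)).
replace (wallis (b + 2)) with ((b + 1) * wallis b / (b + 2)) by (rewrite <- E; field; lra). field. repeat split; lra.
Qed.

Lemma rho_shift b n : 0 <= b -> rho (b + 2 * INR n) = rho b.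
Proof.
intros Hb. induction n as [|n IH]. f_equal; simpl; ring.
rewrite <- IH, S_INR. replace (b + 2 * (INR n + 1)) with (b + 2 * INR n + 2) by ring.
apply rho_S. pose proof (pos_INR n). lra.
Qed.

Lemma wallis_ge_0 b : 0 <= b -> 0 <= wallis b.
Proof.
intros Hb. apply RInt_ge_0. lra. now apply ex_wallis. intros t _. apply Rmult_le_pos. pose proof PI_RGT_0; lra. apply apow_ge_0.
Qed.

(** [Gamma_half_sq] at [x] and at [x + 1 / 2] encloses the squared quotient of Gamma values in [rho]
    between [x^2 / (x + 1 / 2)] and [x]. *)
Lemma rho_bounds b : 0 <= b -> let x := (b + 1) / 2 in
  x ^ 2 * wallis b ^ 2 <= (x + 1 / 2) * rho b ^ 2 /\ rho b ^ 2 <= x * wallis b ^ 2.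
Proof.
intros Hb x. assert (Hx : 0 < x) by (unfold x; lra).
pose proof (Gamma_pos x Hx) as P0. pose proof (Gamma_pos (x + 1 / 2) ltac:(lra)) as P1.
pose proof (Gamma_half_sq x Hx) as H1. pose proof (Gamma_half_sq (x + 1 / 2) ltac:(lra)) as H2.
replace (x + 1 / 2 + 1 / 2) with (x + 1) in H2 by field.
rewrite Gamma_S in H1 by assumption. rewrite Gamma_S in H2 by assumption. rewrite Gamma_S in H2 by lra.
unfold rho. replace (b / 2 + 1) with (x + 1 / 2) by (unfold x; field). fold x.
set (G := Gamma x) in *. set (G' := Gamma (x + 1 / 2)) in *. set (w := wallis b).
assert (E : (w * G' / G) ^ 2 = w ^ 2 * (G' ^ 2 / G ^ 2)) by (field; lra). rewrite E.
assert (Hw : 0 <= w ^ 2) by apply pow2_ge_0.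
assert (HG : 0 < G ^ 2) by (apply pow_lt; lra).
assert (Q : G' ^ 2 / G ^ 2 * G ^ 2 = G' ^ 2) by (field; lra). set (q := G' ^ 2 / G ^ 2) in *.
split.
- assert (x ^ 2 <= (x + 1 / 2) * q).
  { apply Rmult_le_reg_r with (G ^ 2). assumption. rewrite Rmult_assoc, Q. lra. }
  nra.
- assert (q <= x). { apply Rmult_le_reg_r with (G ^ 2). assumption. rewrite Q. lra. }
  nra.
Qed.

(** Shifting both arguments by [2 n] changes neither side. There [wallis] is decreasing, and
    [rho_bounds] bounds the ratio of the two squares by [(y + d) (y + 1 / 2) / y^2], which tends to
    1; [n] is chosen so large that an excess [D] becomes impossible. *)
Lemma rho_sq_le b c : 0 <= c <= b -> rho b ^ 2 <= rho c ^ 2.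
Proof.
intros H. apply Rnot_lt_le. intros Hn.
set (d := (b - c) / 2). set (D := rho b ^ 2 - rho c ^ 2). assert (HD : 0 < D) by (unfold D; lra).
assert (Hr : 0 <= rho c ^ 2) by apply pow2_ge_0.
destruct (INR_unbounded (rho c ^ 2 * (2 * d + 1) / D + 1)) as [n Hn'].
assert (Hn0 : 0 <= rho c ^ 2 * (2 * d + 1) / D).
{ apply Rdiv_le_0_compat; auto. apply Rmult_le_pos; auto. unfold d; lra. }
destruct (rho_bounds (b + 2 * INR n)) as [_ B1]. lra.
destruct (rho_bounds (c + 2 * INR n)) as [B2 _]. lra.
rewrite rho_shift in B1, B2 by lra.
assert (Wm : wallis (b + 2 * INR n) <= wallis (c + 2 * INR n)) by (apply wallis_decr; lra).
assert (W0 := wallis_ge_0 (b + 2 * INR n) ltac:(lra)).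
assert (W2 : wallis (b + 2 * INR n) ^ 2 <= wallis (c + 2 * INR n) ^ 2) by (apply pow_incr; lra).
set (y := (c + 2 * INR n + 1) / 2) in *.
replace ((b + 2 * INR n + 1) / 2) with (y + d) in B1 by (unfold y, d; field).
assert (Hd : 0 <= d) by (unfold d; lra). assert (Hy : INR n <= y) by (unfold y; lra).
set (w1 := wallis (b + 2 * INR n) ^ 2) in *. set (w2 := wallis (c + 2 * INR n) ^ 2) in *.
assert (h1 : y ^ 2 * rho b ^ 2 <= (y + d) * ((y + 1 / 2) * rho c ^ 2)).
{ apply Rle_trans with ((y + d) * (y ^ 2 * w2)).
  - apply Rle_trans with (y ^ 2 * ((y + d) * w1)). apply Rmult_le_compat_l; auto. apply pow2_ge_0.
    replace ((y + d) * (y ^ 2 * w2)) with (y ^ 2 * ((y + d) * w2)) by ring.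
    apply Rmult_le_compat_l. apply pow2_ge_0. apply Rmult_le_compat_l; lra.
  - apply Rmult_le_compat_l; auto. lra. }
assert (h2 : y ^ 2 * D <= y * ((2 * d + 1) * rho c ^ 2)).
{ unfold D. assert ((d * y + y / 2 + d / 2) * rho c ^ 2 <= y * (2 * d + 1) * rho c ^ 2) by (apply Rmult_le_compat_r; nra).
  nra. }
assert (h3 : y * D <= (2 * d + 1) * rho c ^ 2).
{ apply Rmult_le_reg_l with y. lra. nra. }
assert (h4 : rho c ^ 2 * (2 * d + 1) < y * D).
{ apply Rmult_lt_reg_r with (/ D). now apply Rinv_0_lt_compat. replace (y * D * / D) with y by (field; lra). unfold Rdiv in Hn'. lra. }
lra.
Qed.

Lemma rho_ge_0 b : 0 <= b -> 0 <= rho b.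
Proof.
intros Hb. apply Rdiv_le_0_compat. apply Rmult_le_pos. now apply wallis_ge_0. left; apply Gamma_pos; lra. apply Gamma_pos; lra.
Qed.

(** [rho_shift] lifts either argument above the other, so [rho_sq_le] applies in both directions. *)
Lemma rho_const b c : 0 <= b -> 0 <= c -> rho b = rho c.
Proof.
assert (L : forall b c, 0 <= b -> 0 <= c -> rho b <= rho c).
{ intros u v Hu Hv. destruct (INR_unbounded v) as [n Hn].
  assert (h := rho_sq_le (u + 2 * INR n) v ltac:(lra)). rewrite rho_shift in h by assumption.
  pose proof (rho_ge_0 u Hu). pose proof (rho_ge_0 v Hv). nra. }
intros Hb Hc. apply Rle_antisym; auto.
Qed.

(** Equality of [rho 0] and [rho 1], the two elementary cases, gives [Gamma (1 / 2) ^ 2 = PI] and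
    with it the value. *)
Lemma rho_value b : 0 <= b -> rho b = sqrt PI / 2.
Proof.
intros Hb. rewrite (rho_const b 0) by lra.
pose proof (rho_const 1 0 ltac:(lra) ltac:(lra)) as E. unfold rho in *.
rewrite wallis_0, wallis_1 in *.
replace (0 / 2 + 1) with 1 in * by field. replace ((1 + 1) / 2) with 1 in * by field.
replace ((0 + 1) / 2) with (1 / 2) in * by field. rewrite Gamma_S, Gamma_1 in * by lra.
pose proof (Gamma_pos (1 / 2) ltac:(lra)) as P. set (G := Gamma (1 / 2)) in *. pose proof PI_RGT_0.
assert (EG : G * G = PI). { apply Rmult_eq_reg_r with (/ 2 / G). 2: apply Rgt_not_eq; apply Rdiv_lt_0_compat; lra.
  transitivity (1 * (1 / 2 * G) / 1). field; lra. rewrite E. field; lra. }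
assert (sqrt PI = G). { rewrite <- EG. apply sqrt_square; lra. }
rewrite H0, <- EG. field. lra.
Qed.

Lemma wallis_value b : 0 <= b -> wallis b = sqrt PI / 2 * Gamma ((b + 1) / 2) / Gamma (b / 2 + 1).
Proof.
intros Hb. rewrite <- (rho_value b Hb). unfold rho.
pose proof (Gamma_pos ((b + 1) / 2) ltac:(lra)). pose proof (Gamma_pos (b / 2 + 1) ltac:(lra)). field. lra.
Qed.

(** * Initial values at [t = 0] *)

(** At [h = PI / 2] the number [cos h] vanishes, and [Nint] reduces to a Wallis integral. *)
Lemma Kfun_0 al : 2 <= al -> Kfun al 0 = Rpower 2 al * wallis (al - 2).
Proof.
intros Hal. assert (E := limit_density_Kfun al Hal 0).
replace (Rpower (1 + 0 ^ 2) (- al)) with 1 in E.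
2:{ replace (1 + 0 ^ 2) with 1 by ring. unfold Rpower. now rewrite ln_1, Rmult_0_r, exp_0. }
rewrite Rmult_1_l in E. rewrite <- E. unfold limit_density.
replace (Rpower (1 + 0 ^ 2) (- al / 2)) with 1.
2:{ replace (1 + 0 ^ 2) with 1 by ring. unfold Rpower. now rewrite ln_1, Rmult_0_r, exp_0. }
rewrite Rmult_1_r. f_equal. unfold angle. rewrite atan_0, Rminus_0_r. unfold Nint, wallis.
apply RInt_ext. rewrite Rmin_left, Rmax_right by lra. intros t Ht. pose proof PI_RGT_0.
rewrite cos_PI2, Rminus_0_r, apow_pos by (apply cos_gt_0; nra).
match goal with |- @eq _ ?a ?b => change (@eq R a b) end. ring.
Qed.

Lemma Kfun'_0 al : 2 <= al -> Kfun' al 0 = - (al * Rpower 2 al * wallis (al - 1)).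
Proof.
intros Hal. unfold Kfun'.
replace (Rpower (1 + 0 ^ 2) ((al - 1) / 2)) with 1.
2:{ replace (1 + 0 ^ 2) with 1 by ring. unfold Rpower. now rewrite ln_1, Rmult_0_r, exp_0. }
replace (Bint al (angle 0)) with (wallis (al - 1)). ring.
unfold angle. rewrite atan_0, Rminus_0_r. unfold Bint, wallis.
apply RInt_ext. rewrite Rmin_left, Rmax_right by lra. intros t Ht.
unfold Pf, Xf, spow. rewrite cos_PI2, Rminus_0_r. rewrite apow_S. do 2 f_equal; ring. apply cos_unit; lra. lra.
Qed.

(** * Complex power series *)

Definition Cpw (w : C) (n : nat) : C := pow_n (K := C_AbsRing) w n.

Lemma Cpw_S w n : Cpw w (S n) = (w * Cpw w n)%C.
Proof. reflexivity. Qed.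

Lemma Cmod_Cpw w n : Cmod (Cpw w n) = Cmod w ^ n.
Proof.
induction n as [|n IH]. apply Cmod_1. rewrite Cpw_S, Cmod_mult, IH. reflexivity.
Qed.

Lemma Cpw_mult w z n : Cpw (w * z)%C n = (Cpw w n * Cpw z n)%C.
Proof.
induction n as [|n IH]. unfold Cpw; simpl. change (one : C) with (RtoC 1). ring.
rewrite !Cpw_S, IH. ring.
Qed.

Definition Csum (a : nat -> C) (n : nat) : C := sum_n (G := C_AbelianMonoid) a n.

Lemma Csum_O a : Csum a 0 = a O.
Proof. exact (sum_O (G := C_AbelianMonoid) a). Qed.

Lemma Csum_S a n : Csum a (S n) = (Csum a n + a (S n))%C.
Proof. exact (sum_Sn (G := C_AbelianMonoid) a n). Qed.

Lemma Cball (x y : C) (eps : R) : Cmod (y - x)%C < eps -> ball (M := C_UniformSpace) x eps y.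
Proof.
intros H. split; unfold ball; simpl; unfold AbsRing_ball, abs, minus, plus, opp; simpl.
- apply Rle_lt_trans with (2 := H). apply Rle_trans with (2 := Rmax_Cmod _). apply Rmax_l.
- apply Rle_lt_trans with (2 := H). apply Rle_trans with (2 := Rmax_Cmod _). apply Rmax_r.
Qed.

(** The balls of [C_UniformSpace] are squares; the factor 2 stands for the square root of 2. *)
Lemma Cball_inv (x y : C) (eps : R) : ball (M := C_UniformSpace) x eps y -> Cmod (y - x)%C < 2 * eps.
Proof.
intros [H1 H2]. unfold ball in *; simpl in *; unfold AbsRing_ball, abs, minus, plus, opp in *; simpl in *.
eapply Rle_lt_trans. apply Cmod_2Rmax.
set (m := Rmax _ _).
assert (m < eps). { unfold m. apply Rmax_lub_lt; assumption. }
assert (0 <= m). { unfold m. eapply Rle_trans. 2: apply Rmax_l. apply Rabs_pos. }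
assert (sqrt 2 <= 2). { rewrite <- (sqrt_square 2) at 2 by lra. apply sqrt_le_1_alt; lra. }
nra.
Qed.

Lemma is_Cpseries_intro (u : nat -> C) h l :
  (forall eps, 0 < eps -> exists N, forall n, (N <= n)%nat -> Cmod (Csum (fun k => Cpw h k * u k)%C n - l)%C < eps) ->
  is_Cpseries u h l.
Proof.
intros H. apply (filterlim_locally (U := C_UniformSpace)). intros eps.
destruct (H eps (cond_pos eps)) as [N HN]. exists N. intros n Hn. apply Cball, HN, Hn.
Qed.

Lemma is_Cpseries_elim (u : nat -> C) h l : is_Cpseries u h l ->
  forall eps, 0 < eps -> exists N, forall n, (N <= n)%nat -> Cmod (Csum (fun k => Cpw h k * u k)%C n - l)%C < eps.
Proof.
intros H eps He. assert (He2 : 0 < eps / 2) by lra.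
destruct (proj1 (filterlim_locally (U := C_UniformSpace) _ _) H (mkposreal _ He2)) as [N HN].
exists N. intros n Hn. replace eps with (2 * (eps / 2)) by field. apply Cball_inv. exact (HN n Hn).
Qed.

Lemma is_Cpseries_unique u h l1 l2 : is_Cpseries u h l1 -> is_Cpseries u h l2 -> l1 = l2.
Proof.
intros H1 H2. apply Classical_Prop.NNPP. intros Hn.
assert (Hd : 0 < Cmod (l1 - l2)%C / 2).
{ assert (0 < Cmod (l1 - l2)%C); [|lra]. apply Cmod_gt_0. intros E. apply Hn.
  replace l1 with (l1 - l2 + l2)%C by ring. rewrite E; ring. }
destruct (is_Cpseries_elim _ _ _ H1 _ Hd) as [N1 K1]. destruct (is_Cpseries_elim _ _ _ H2 _ Hd) as [N2 K2].
specialize (K1 (N1 + N2)%nat ltac:(lia)). specialize (K2 (N1 + N2)%nat ltac:(lia)).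
set (s := Csum _ _) in *.
assert (Cmod (l1 - l2)%C <= Cmod (s - l1)%C + Cmod (s - l2)%C).
{ replace (l1 - l2)%C with (- (s - l1) + (s - l2))%C by ring. eapply Rle_trans. apply Cmod_triangle.
  rewrite Cmod_opp. lra. }
lra.
Qed.

Lemma is_Cpseries_minus u v h l m : is_Cpseries u h l -> is_Cpseries v h m ->
  is_Cpseries (fun n => u n - v n)%C h (l - m)%C.
Proof.
intros H1 H2. apply is_Cpseries_intro. intros eps He.
destruct (is_Cpseries_elim _ _ _ H1 (eps / 2) ltac:(lra)) as [N1 K1].
destruct (is_Cpseries_elim _ _ _ H2 (eps / 2) ltac:(lra)) as [N2 K2].
exists (N1 + N2)%nat. intros n Hn. specialize (K1 n ltac:(lia)). specialize (K2 n ltac:(lia)).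
assert (E : forall n, Csum (fun k => Cpw h k * (u k - v k))%C n = (Csum (fun k => Cpw h k * u k) n - Csum (fun k => Cpw h k * v k) n)%C).
{ intros k; induction k as [|k IH]. rewrite !Csum_O; ring. rewrite !Csum_S, IH; ring. }
rewrite E. replace (_ - _)%C with ((Csum (fun k => Cpw h k * u k) n - l) + - (Csum (fun k => Cpw h k * v k) n - m))%C by ring.
eapply Rle_lt_trans. apply Cmod_triangle. rewrite Cmod_opp. lra.
Qed.

Lemma is_Cpseries_0 (u : nat -> C) h l : (forall n, u n = 0%C) -> is_Cpseries u h l -> l = 0%C.
Proof.
intros Hu H. apply is_Cpseries_unique with (1 := H). apply is_Cpseries_intro.
intros eps He. exists O. intros n _.
replace (Csum (fun k => Cpw h k * u k)%C n) with (RtoC 0).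
- replace (0 - 0)%C with (RtoC 0) by ring. rewrite Cmod_0; exact He.
- induction n as [|n IH]. rewrite Csum_O, Hu; ring. rewrite Csum_S, <- IH, Hu; ring.
Qed.

(** * Cauchy's integral formula *)

Lemma small_pow t eps : 0 <= t < 1 -> 0 < eps -> exists N, forall n, (N <= n)%nat -> t ^ n < eps.
Proof.
intros Ht He. destruct (pow_lt_1_zero t ltac:(rewrite Rabs_pos_eq; lra) eps He) as [N HN].
exists N. intros n Hn. specialize (HN n Hn). rewrite Rabs_pos_eq in HN; auto. apply pow_le; lra.
Qed.

Section Cauchy.
Variables (f f' : C -> C) (w0 : C) (r : R).
Hypothesis Hr : 0 < r.
Hypothesis Hf : forall u, Cmod (u - w0)%C <= r -> is_holo f u (f' u) /\ Ccont (T := C_UniformSpace) f' u /\ Ccont (T := C_UniformSpace) f u.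
Variable h : C.
Hypothesis Hh : Cmod h < r.

(** On the circle, [q] is [h / e] and [wgt] is [e / (e - h)], the Cauchy kernel with respect to the
    angle. [H] contracts the circle around [w0] to the point [w0 + h]. *)
Let e (t : R) : C := polar r t.
Let q (t : R) : C := (h * polar (/ r) (- t))%C.
Let wgt (t : R) : C := (/ (1 - q t))%C.
Let H (l t : R) : C := (w0 + (1 - l)%R * h + l * e t)%C.
Let rat := Cmod h / r.

Lemma rat_bounds : 0 <= rat < 1.
Proof.
split. apply Rdiv_le_0_compat. apply Cmod_ge_0. exact Hr.
apply Rmult_lt_reg_r with r. exact Hr. unfold rat. replace (Cmod h / r * r) with (Cmod h) by (field; lra). lra.
Qed.

Lemma Cmod_q t : Cmod (q t) = rat.
Proof. unfold q. rewrite Cmod_mult, Cmod_polar. reflexivity. now apply Rinv_0_lt_compat. Qed.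

Lemma Cmod_1q t : 1 - rat <= Cmod (1 - q t)%C.
Proof.
pose proof (Cmod_triangle (1 - q t)%C (q t)) as T. replace (1 - q t + q t)%C with (RtoC 1) in T by ring.
rewrite Cmod_1, Cmod_q in T. lra.
Qed.

Lemma nz_1q t : (1 - q t)%C <> 0%C.
Proof. apply Cmod_gt_0. pose proof (Cmod_1q t). pose proof rat_bounds. lra. Qed.

Lemma qe t : (q t * e t)%C = h.
Proof.
unfold q, e. rewrite <- Cmult_assoc, polar_mult. replace (- t + t) with 0 by ring.
replace (/ r * r) with 1 by (field; lra). unfold polar. rewrite cos_0, sin_0.
apply C_eq; unfold Re, Im; simpl; ring.
Qed.

Lemma wgt_eh t : (wgt t * (e t - h))%C = e t.
Proof.
rewrite <- (qe t) at 1. unfold wgt. replace (e t - q t * e t)%C with ((1 - q t) * e t)%C by ring.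
rewrite Cmult_assoc, Cinv_l. ring. apply nz_1q.
Qed.

Lemma Ccont_e {T : UniformSpace} (g : T -> R) x : continuous g x -> Ccont (fun y => e (g y)) x.
Proof. intros Hg. apply (Ccont_polar (fun _ => r)); auto using cont_const. Qed.

Lemma Ccont_q {T : UniformSpace} (g : T -> R) x : continuous g x -> Ccont (fun y => q (g y)) x.
Proof.
intros Hg. apply Ccont_mult. apply Ccont_const. apply (Ccont_polar (fun _ => / r) (fun y => - g y)).
apply cont_const. now apply cont_opp.
Qed.

Lemma Ccont_wgt {T : UniformSpace} (g : T -> R) x : continuous g x -> Ccont (fun y => wgt (g y)) x.
Proof.
intros Hg. apply (Ccont_inv (fun y => 1 - q (g y))%C).
apply Ccont_minus. apply Ccont_const. now apply Ccont_q. apply nz_1q.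
Qed.

Lemma Ccont_comp {T : UniformSpace} (k : C -> C) (g : T -> C) x :
  Ccont g x -> Ccont (T := C_UniformSpace) k (g x) -> Ccont (fun y => k (g y)) x.
Proof.
intros [G1 G2] [K1 K2].
assert (G : continuous (U := C_UniformSpace) g x).
{ intros P [d Hd]. unfold filtermap.
  generalize (filter_and _ _ (proj1 (filterlim_locally _ _) G1 d) (proj1 (filterlim_locally _ _) G2 d)).
  apply filter_imp. intros y [h1 h2]. apply Hd. split; [exact h1|exact h2]. }
split.
- apply (continuous_comp (V := C_UniformSpace) g (fun w => Re (k w))); assumption.
- apply (continuous_comp (V := C_UniformSpace) g (fun w => Im (k w))); assumption.
Qed.

Lemma H_disc l t : 0 <= l <= 1 -> Cmod (H l t - w0)%C <= r.
Proof.
intros Hl. unfold H. replace (w0 + (1 - l)%R * h + l * e t - w0)%C with ((1 - l)%R * h + l * e t)%C by ring.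
eapply Rle_trans. apply Cmod_triangle. rewrite !Cmod_mult, !Cmod_R, !Rabs_pos_eq by lra.
unfold e. rewrite Cmod_polar by assumption. nra.
Qed.

Lemma Ccont_H l t : Ccont (fun p : R * R => H (fst p) (snd p)) (l, t).
Proof.
apply Ccont_plus. apply Ccont_plus. apply Ccont_const.
- apply Ccont_mult. 2: apply Ccont_const. apply Ccont_RtoC. apply cont_minus. apply cont_const. apply continuous_fst.
- apply Ccont_mult. apply Ccont_RtoC. apply continuous_fst. apply (Ccont_e (fun p : R * R => snd p)). apply continuous_snd.
Qed.

Let A (l t : R) : C := (f (H l t) * wgt t)%C.

Lemma Ccont_A l t : 0 <= l <= 1 -> Ccont (fun p : R * R => A (fst p) (snd p)) (l, t).
Proof.
intros Hl. apply Ccont_mult.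
- apply (Ccont_comp f (fun p : R * R => H (fst p) (snd p))). apply Ccont_H. apply Hf. now apply H_disc.
- apply (Ccont_wgt (fun p : R * R => snd p)). apply continuous_snd.
Qed.

(** Divided by [Ci], the Cauchy form [f(u) du / (u - w0 - h)] pulls back under [H] to [A dt] plus a
    part [f(H) / (Ci l) dl]. The latter is singular at [l = 0], hence [0 < d], and its values on the
    edges [t = 0] and [t = 2 PI] cancel by periodicity. *)
Lemma cauchy_step d : 0 < d < 1 -> CRInt (A 1) 0 (2 * PI) = CRInt (A d) 0 (2 * PI).
Proof.
intros Hd. pose proof PI_RGT_0.
assert (E : (CRInt (A 1%R) 0 (2 * PI) - CRInt (A d) 0 (2 * PI))%C =
   CRInt (fun l => f (H l (2 * PI)) / (Ci * l) - f (H l 0) / (Ci * l))%C d 1).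
{ assert (Nz : forall l, d <= l <= 1 -> (Ci * l)%C <> 0%C).
  { intros l Hl. apply Cmult_neq_0. intros E; injection E; lra. intros E; injection E; lra. }
  apply (Cgreen_open A (fun l t => f (H l t) / (Ci * l))%C (fun l t => f' (H l t) * e t)%C); try lra.
  - intros l t Hl Ht. destruct (Hf (H l t)) as (h1 & h2 & h3). apply H_disc; lra.
    split; [|split].
    + unfold A. eapply is_Cderive_val. apply is_Cderive_mult.
      * apply (h1 (fun u => H u t) l (e t - h)%C); auto.
        unfold H. eapply is_Cderive_val. apply is_Cderive_plus. apply is_Cderive_plus. apply is_Cderive_const.
        apply is_Cderive_mult. apply is_Cderive_RtoC, is_derive_Rminus_const, is_derive_id. apply is_Cderive_const.
        apply is_Cderive_mult. apply is_Cderive_RtoC, is_derive_id. apply is_Cderive_const.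
        unfold one; simpl. apply C_eq; unfold Re, Im; simpl; ring.
      * apply is_Cderive_const.
      * transitivity (f' (H l t) * (wgt t * (e t - h)))%C. ring. now rewrite wgt_eh.
    + eapply is_Cderive_val. apply (is_Cderive_mult (fun t => f (H l t)) (fun _ => / (Ci * l))%C).
      * apply (h1 (fun u => H l u) t (l * (Ci * e t))%C); auto.
        unfold H. eapply is_Cderive_val. apply is_Cderive_plus. apply is_Cderive_plus. apply is_Cderive_const.
        apply is_Cderive_const.
        apply is_Cderive_mult. apply is_Cderive_const.
        apply (is_Cderive_ext_loc (fun s => polar r (1 * s))). apply filter_forall; intros s; unfold e; f_equal; ring.
        apply is_Cderive_polar.
        rewrite Rmult_1_l. unfold e. cbv beta. ring.
      * apply is_Cderive_const.
      * cbv beta. field. split; [|intros E0; injection E0; lra]. intros E0; injection E0; lra.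
    + apply Ccont_mult. apply (Ccont_comp f' (fun p : R * R => H (fst p) (snd p))). apply Ccont_H. exact h2.
      apply (Ccont_e (fun p : R * R => snd p)). apply continuous_snd.
  - intros l t Hl Ht. split. apply Ccont_A; lra.
    apply (Ccont_div (fun p : R * R => f (H (fst p) (snd p))) (fun p : R * R => Ci * fst p)%C).
    + apply (Ccont_comp f (fun p : R * R => H (fst p) (snd p))). apply Ccont_H. apply Hf. apply (H_disc l t); lra.
    + apply Ccont_mult. apply Ccont_const. apply Ccont_RtoC. apply continuous_fst.
    + apply (Nz l); lra. }
assert (E2 : CRInt (fun l => f (H l (2 * PI)) / (Ci * l) - f (H l 0) / (Ci * l))%C d 1 = 0%C).
{ rewrite (CRInt_ext _ (fun _ => 0%C)).
  - unfold CRInt; simpl. rewrite !RInt_const. unfold scal; simpl; unfold mult; simpl. apply C_eq; simpl; ring.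
  - lra.
  - intros l _. replace (H l (2 * PI)) with (H l 0). ring. unfold H, e, polar.
    now rewrite cos_2PI, sin_2PI, cos_0, sin_0. }
rewrite E2 in E. replace (CRInt (A 1%R) 0 (2 * PI)) with (CRInt (A 1%R) 0 (2 * PI) - CRInt (A d) 0 (2 * PI) + CRInt (A d) 0 (2 * PI))%C by ring.
rewrite E. ring.
Qed.

Lemma Ccont_A_t l t : 0 <= l <= 1 -> Ccont (A l) t.
Proof. intros Hl. apply (Ccont_slice_r A). now apply Ccont_A. Qed.

Lemma zero_at_left_end (G : R -> R) : continuous G 0 -> (forall c, 0 < c < 1 -> G c = 0) -> G 0 = 0.
Proof.
intros Hc HG. assert (G (1 - 1) = 0); [|now rewrite Rminus_eq_0 in H0].
apply (zero_at_right_end (fun x => G (1 - x)) 0 1). lra.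
- apply (cont_fun G). apply cont_minus. apply cont_const. apply cont_id. now rewrite Rminus_eq_0.
- intros c Hcc. apply HG; lra.
Qed.

(** [A] stays continuous at [l = 0], where [H] is constantly [w0 + h], so [d] may tend to 0. *)
Lemma cauchy_center : CRInt (A 1) 0 (2 * PI) = CRInt (A 0) 0 (2 * PI).
Proof.
pose proof PI_RGT_0.
set (cl := fun l => Rmax 0 (Rmin 1 l)).
assert (Hcl : forall t, 0 <= t <= 1 -> cl t = t) by (intros; now apply clamp_id).
assert (Hin : forall t, 0 <= cl t <= 1) by (intros; apply clamp_in; lra).
assert (Ccl : forall s, continuous cl s) by (intros; apply cont_clamp; auto using cont_id; lra).
assert (CA : forall l t, Ccont (fun p : R * R => A (cl (fst p)) (snd p)) (l, t)).
{ intros l t. destruct (Ccont_A (cl l) t (Hin l)) as [h1 h2]. split.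
  apply (cont_pair_map (fun l t => Re (A l t)) cl (fun t => t)); auto using cont_id.
  apply (cont_pair_map (fun l t => Im (A l t)) cl (fun t => t)); auto using cont_id. }
assert (ex : forall l, ex_RInt (fun t => Re (A (cl l) t)) 0 (2 * PI) /\ ex_RInt (fun t => Im (A (cl l) t)) 0 (2 * PI)).
{ intros l. apply ex_RInt_ReIm. lra. intros t _. apply Ccont_A_t, Hin. }
apply C_eq.
- apply Rminus_diag_uniq. 
  assert (Z : RInt (fun t => Re (A 1 t)) 0 (2 * PI) - RInt (fun t => Re (A (cl 0) t)) 0 (2 * PI) = 0).
  { apply (zero_at_left_end (fun d => RInt (fun t => Re (A 1 t)) 0 (2 * PI) - RInt (fun t => Re (A (cl d) t)) 0 (2 * PI))).
    + apply cont_minus. apply cont_const.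
      apply (cont_RInt_param (fun d t => Re (A (cl d) t))). lra. intros t _; exact (proj1 (CA 0 t)). apply filter_forall; intros d; exact (proj1 (ex d)).
    + intros c Hc. rewrite Hcl by lra. apply Rminus_diag_eq. exact (f_equal Re (cauchy_step c Hc)). }
  rewrite Hcl in Z by lra. exact Z.
- apply Rminus_diag_uniq. 
  assert (Z : RInt (fun t => Im (A 1 t)) 0 (2 * PI) - RInt (fun t => Im (A (cl 0) t)) 0 (2 * PI) = 0).
  { apply (zero_at_left_end (fun d => RInt (fun t => Im (A 1 t)) 0 (2 * PI) - RInt (fun t => Im (A (cl d) t)) 0 (2 * PI))).
    + apply cont_minus. apply cont_const.
      apply (cont_RInt_param (fun d t => Im (A (cl d) t))). lra. intros t _; exact (proj2 (CA 0 t)). apply filter_forall; intros d; exact (proj2 (ex d)).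
    + intros c Hc. rewrite Hcl by lra. apply Rminus_diag_eq. exact (f_equal Im (cauchy_step c Hc)). }
  rewrite Hcl in Z by lra. exact Z.
Qed.

(** For [g] the values of [f] on the circle, [coef g n] is [2 PI] times a Taylor coefficient, and
    [rem g n] is the remainder after [n] terms of the geometric series [wgt = 1 + q + q^2 + ...]
    integrated against [g]. *)
Let rem (g : R -> C) (n : nat) : C := CRInt (fun t => g t * wgt t * Cpw (q t) n)%C 0 (2 * PI).
Let coef (g : R -> C) (n : nat) : C := CRInt (fun t => g t * Cpw (polar (/ r) (- t)) n)%C 0 (2 * PI).

Lemma Ccont_Cpw {T : UniformSpace} (g : T -> C) n x : Ccont g x -> Ccont (fun y => Cpw (g y) n) x.
Proof.
intros Hg. induction n as [|n IH]. apply Ccont_const. apply (Ccont_mult g (fun y => Cpw (g y) n)); assumption.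
Qed.

Lemma rem_S g n : (forall t, Ccont g t) -> rem g n = (Cpw h n * coef g n + rem g (S n))%C.
Proof.
intros Hg. pose proof PI_RGT_0. unfold rem, coef.
assert (Cp : forall t, Ccont (fun t => polar (/ r) (- t)) t).
{ intros t. apply (Ccont_polar (fun _ => / r) (fun t => - t)). apply cont_const. apply cont_opp, cont_id. }
rewrite <- CRInt_scal.
- rewrite <- CRInt_plus.
  + apply CRInt_ext. lra. intros t _. rewrite Cpw_S.
    assert (Eq : Cpw (q t) n = (Cpw h n * Cpw (polar (/ r) (- t)) n)%C) by apply Cpw_mult. rewrite Eq.
    transitivity (g t * (Cpw h n * Cpw (polar (/ r) (- t)) n) * (wgt t * (1 - q t) + wgt t * q t))%C. ring.
    unfold wgt at 1. rewrite Cinv_l by apply nz_1q. ring.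
  + lra.
  + intros t _. apply Ccont_mult. apply Ccont_const. apply Ccont_mult; auto. now apply Ccont_Cpw.
  + intros t _. apply Ccont_mult. apply Ccont_mult; auto. apply (Ccont_wgt (fun t => t)), cont_id.
    apply Ccont_Cpw, (Ccont_q (fun t => t)), cont_id.
- lra.
- intros t _. apply Ccont_mult; auto. now apply Ccont_Cpw.
Qed.

Lemma rem_bound g M n : (forall t, Ccont g t) -> (forall t, Cmod (g t) <= M) ->
  Cmod (rem g n) <= 2 * PI * (M / (1 - rat) * rat ^ n).
Proof.
intros Hg HM. pose proof PI_RGT_0. pose proof rat_bounds as Hrat.
replace (2 * PI) with (2 * PI - 0) at 1 by ring.
apply CRInt_bound. lra.
- intros t _. apply Ccont_mult. apply Ccont_mult; auto. apply (Ccont_wgt (fun t => t)), cont_id.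
  apply Ccont_Cpw, (Ccont_q (fun t => t)), cont_id.
- intros t _. rewrite !Cmod_mult, Cmod_Cpw, Cmod_q. apply Rmult_le_compat_r. apply pow_le; lra.
  unfold Rdiv. apply Rmult_le_compat; auto using Cmod_ge_0.
  unfold wgt. rewrite Cmod_inv by apply nz_1q. apply Rinv_le_contravar. lra. apply Cmod_1q.
Qed.

Lemma rem_expansion g n : (forall t, Ccont g t) ->
  rem g 0 = (Csum (fun k => Cpw h k * coef g k) n + rem g (S n))%C.
Proof.
intros Hg. induction n as [|n IH]. rewrite Csum_O. now apply rem_S.
rewrite Csum_S, IH, (rem_S g (S n)) by assumption. ring.
Qed.

Lemma rem_series g M : (forall t, Ccont g t) -> (forall t, Cmod (g t) <= M) ->
  is_Cpseries (coef g) h (rem g 0).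
Proof.
intros Hg HM. pose proof PI_RGT_0. pose proof rat_bounds as Hrat.
assert (M0 : 0 <= M) by (eapply Rle_trans; [apply Cmod_ge_0|apply (HM 0)]).
set (K := 2 * PI * (M / (1 - rat)) + 1).
assert (HK : 0 < K). { assert (0 <= M / (1 - rat)) by (apply Rdiv_le_0_compat; lra). unfold K; nra. }
apply is_Cpseries_intro. intros eps He.
destruct (small_pow rat (eps / K) Hrat) as [N HN]. now apply Rdiv_lt_0_compat.
exists N. intros n Hn. rewrite (rem_expansion g n Hg).
replace (Csum (fun k => Cpw h k * coef g k) n - (Csum (fun k => Cpw h k * coef g k) n + rem g (S n)))%C with (- rem g (S n))%C by ring.
rewrite Cmod_opp. eapply Rle_lt_trans. apply rem_bound; eauto.
specialize (HN (S n) ltac:(lia)).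
assert (0 <= rat ^ S n) by (apply pow_le; lra).
apply Rle_lt_trans with (K * rat ^ S n). unfold K; nra.
apply Rmult_lt_reg_r with (/ K). now apply Rinv_0_lt_compat.
replace (K * rat ^ S n * / K) with (rat ^ S n) by (field; lra). exact HN.
Qed.

Lemma polar_pow s a n : Cpw (polar s a) n = polar (s ^ n) (INR n * a).
Proof.
induction n as [|n IH].
- unfold Cpw, polar; simpl. rewrite Rmult_0_l, cos_0, sin_0. apply C_eq; unfold Re, Im; simpl; ring.
- rewrite Cpw_S, IH, polar_mult, S_INR. simpl. f_equal. ring.
Qed.

Lemma sin_cos_period n : sin (INR n * (2 * PI)) = 0 /\ cos (INR n * (2 * PI)) = 1.
Proof.
replace (INR n * (2 * PI)) with (0 + 2 * INR n * PI) by ring. rewrite sin_period, cos_period, sin_0, cos_0. auto.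
Qed.

Lemma coef_1_S n : coef (fun _ => 1%C) (S n) = 0%C.
Proof.
pose proof PI_RGT_0. unfold coef. set (k := INR (S n)). assert (Hk : 0 < k) by (unfold k; apply lt_0_INR; lia).
destruct (sin_cos_period (S n)) as [Es Ec]. fold k in Es, Ec.
assert (I1 : forall cc, is_RInt (fun t => cc * cos (k * - t)) 0 (2 * PI) 0).
{ intros cc. replace 0 with (minus (cc * (sin (k * (2 * PI)) / k)) (cc * (sin (k * 0) / k))) at 2.
  - apply (is_RInt_derive (V := R_CompleteNormedModule) (fun t => cc * (sin (k * t) / k))); intros t _.
    + eapply is_derive_val. auto_derive. easy. reflexivity. rewrite Ropp_mult_distr_r_reverse, cos_neg. field. lra.
    + apply cont_mult. apply cont_const. apply (cont_fun cos). 2: apply continuous_cos.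
      apply cont_mult. apply cont_const. apply cont_opp, cont_id.
  - rewrite Es, Rmult_0_r, sin_0. unfold minus, plus, opp; simpl. field. lra. }
assert (I2 : forall cc, is_RInt (fun t => cc * sin (k * - t)) 0 (2 * PI) 0).
{ intros cc. replace 0 with (minus (cc * (cos (k * (2 * PI)) / k)) (cc * (cos (k * 0) / k))) at 2.
  - apply (is_RInt_derive (V := R_CompleteNormedModule) (fun t => cc * (cos (k * t) / k))); intros t _.
    + eapply is_derive_val. auto_derive. easy. reflexivity. replace (k * - t) with (- (k * t)) by ring. rewrite sin_neg. field. lra.
    + apply cont_mult. apply cont_const. apply (cont_fun sin). 2: apply continuous_sin.
      apply cont_mult. apply cont_const. apply cont_opp, cont_id.
  - rewrite Ec, Rmult_0_r, cos_0. unfold minus, plus, opp; simpl. field. lra. }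
rewrite (CRInt_ext _ (fun t => polar ((/ r) ^ S n) (k * - t))).
- unfold CRInt, polar. cbn [Re Im fst snd]. apply C_eq; simpl.
  exact (is_RInt_unique _ _ _ _ (I1 _)). exact (is_RInt_unique _ _ _ _ (I2 _)).
- lra.
- intros t _. rewrite polar_pow. fold k. ring.
Qed.

(** In the expansion for [g = 1] only the coefficient of index 0 survives, so the mean of [wgt] over
    the circle is 1. *)
Lemma rem_1 : rem (fun _ => 1%C) 0 = (2 * PI)%R.
Proof.
pose proof PI_RGT_0.
assert (C1 : forall t : R, Ccont (fun _ : R => 1%C) t) by (intros; apply Ccont_const).
apply (is_Cpseries_unique (coef (fun _ => 1%C)) h).
- apply rem_series with 1; auto. intros _; rewrite Cmod_1; lra.
- apply is_Cpseries_intro. intros eps He. exists O. intros n _.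
  replace (Csum (fun k => Cpw h k * coef (fun _ => 1%C) k)%C n) with (RtoC (2 * PI)).
  + replace (RtoC (2 * PI) - RtoC (2 * PI))%C with (RtoC 0) by ring. now rewrite Cmod_0.
  + induction n as [|n IH].
    * rewrite Csum_O. unfold coef, Cpw; simpl. change (one : C) with (RtoC 1).
      rewrite (CRInt_ext _ (fun _ => RtoC 1)) by (lra || intros; ring).
      unfold CRInt; simpl. rewrite !RInt_const. unfold scal; simpl; unfold mult; simpl. apply C_eq; unfold Re, Im; simpl; ring.
    * rewrite Csum_S, <- IH, coef_1_S. ring.
Qed.

(** One integral is evaluated twice: [cauchy_center] and [rem_1] give [2 PI f (w0 + h)], and
    [rem_series] expands it in powers of [h]. *)
Lemma cauchy_series M : (forall t, Cmod (f (w0 + polar r t)%C) <= M) ->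
  is_Cpseries (fun n => / (2 * PI)%R * CRInt (fun t => f (w0 + polar r t) * Cpw (polar (/ r) (- t)) n) 0 (2 * PI))%C h
    (f (w0 + h)%C).
Proof.
intros HM. pose proof PI_RGT_0.
set (g := fun t => f (w0 + polar r t)%C).
assert (Hg : forall t, Ccont g t).
{ intros t. apply (Ccont_comp f (fun t => w0 + polar r t)%C).
  - apply Ccont_plus. apply Ccont_const. apply (Ccont_e (fun t => t)), cont_id.
  - apply Hf. replace (w0 + polar r t - w0)%C with (polar r t) by ring. rewrite Cmod_polar; lra. }
assert (E : rem g 0 = ((2 * PI)%R * f (w0 + h))%C).
{ transitivity (CRInt (A 1) 0 (2 * PI)).
  - apply CRInt_ext. lra. intros t _. unfold A, H, g, e, Cpw; simpl. change (one : C) with (RtoC 1).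
    replace (w0 + (1 - 1)%R * h + 1 * polar r t)%C with (w0 + polar r t)%C. ring.
    rewrite Rminus_eq_0. ring.
  - rewrite cauchy_center, <- rem_1, Cmult_comm. unfold rem. rewrite <- CRInt_scal.
    + apply CRInt_ext. lra. intros t _. unfold A, H, Cpw; simpl. change (one : C) with (RtoC 1).
      replace (w0 + (1 - 0)%R * h + 0 * e t)%C with (w0 + h)%C. ring. rewrite Rminus_0_r. ring.
    + lra.
    + intros t _. apply Ccont_mult. apply Ccont_mult. apply Ccont_const. apply (Ccont_wgt (fun t => t)), cont_id. apply Ccont_const. }
pose proof (rem_series g M Hg HM) as S.
assert (Hpi : RtoC (2 * PI) <> 0%C) by (intros E0; injection E0; lra).
apply is_Cpseries_intro. intros eps He.
destruct (is_Cpseries_elim _ _ _ S (eps * (2 * PI))) as [N HN]. apply Rmult_lt_0_compat; lra.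
exists N. intros n Hn. specialize (HN n Hn). rewrite E in HN.
replace (Csum (fun k => Cpw h k * (/ (2 * PI)%R * CRInt (fun t => f (w0 + polar r t) * Cpw (polar (/ r) (- t)) k) 0 (2 * PI)))%C n)
  with (/ (2 * PI)%R * Csum (fun k => Cpw h k * coef g k) n)%C.
- replace (_ - _)%C with (/ (2 * PI)%R * (Csum (fun k => Cpw h k * coef g k) n - (2 * PI)%R * f (w0 + h)))%C by (field; exact Hpi).
  rewrite Cmod_mult, Cmod_inv, Cmod_R, Rabs_pos_eq by (try exact Hpi; lra).
  apply Rmult_lt_reg_l with (2 * PI). lra. rewrite <- Rmult_assoc, Rinv_r, Rmult_1_l by lra. lra.
- clear. induction n as [|n IH]. rewrite !Csum_O. unfold coef, g. ring.
  rewrite !Csum_S, <- IH. unfold coef, g. ring.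
Qed.
End Cauchy.

Lemma continuous_bounded_above (f : R -> R) a b : a <= b -> (forall t, a <= t <= b -> continuous f t) ->
  exists M, forall t, a <= t <= b -> f t <= M.
Proof.
intros Hab Hc. destruct (continuity_ab_maj f a b Hab) as [x [Hx _]].
- intros c Hcc. apply continuity_pt_filterlim. now apply Hc.
- exists (f x). exact Hx.
Qed.

Lemma polar_period_reduce r t : exists t', 0 <= t' <= 2 * PI /\ polar r t = polar r t'.
Proof.
pose proof PI_RGT_0.
set (n := Int_part (t / (2 * PI))). exists (t - IZR n * (2 * PI)).
destruct (base_Int_part (t / (2 * PI))) as [h1 h2]. fold n in h1, h2.
split.
- assert (E : t = t / (2 * PI) * (2 * PI)) by (field; lra). split.
  + assert (IZR n * (2 * PI) <= t / (2 * PI) * (2 * PI)) by (apply Rmult_le_compat_r; lra). lra.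
  + assert (t / (2 * PI) * (2 * PI) <= (IZR n + 1) * (2 * PI)) by (apply Rmult_le_compat_r; lra). lra.
- unfold polar. destruct (Z_le_gt_dec 0 n) as [Hn|Hn].
  + replace t with (t - IZR n * (2 * PI) + 2 * INR (Z.to_nat n) * PI) at 1 2.
    now rewrite cos_period, sin_period.
    rewrite INR_IZR_INZ, Z2Nat.id by assumption. ring.
  + replace (t - IZR n * (2 * PI)) with (t + 2 * INR (Z.to_nat (- n)) * PI).
    now rewrite cos_period, sin_period.
    rewrite INR_IZR_INZ, Z2Nat.id by lia. rewrite opp_IZR. ring.
Qed.

(** [cauchy_series] wants a bound for all real parameters of the circle: compactness gives it on
    [[0, 2 PI]], periodicity elsewhere. *)
Lemma holo_analytic (f f' : C -> C) w0 r : 0 < r ->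
  (forall u, Cmod (u - w0)%C <= r -> is_holo f u (f' u) /\ Ccont (T := C_UniformSpace) f' u /\ Ccont (T := C_UniformSpace) f u) ->
  analytic_at f w0.
Proof.
intros Hr Hf. pose proof PI_RGT_0.
destruct (continuous_bounded_above (fun t => Cmod (f (w0 + polar r t)%C)) 0 (2 * PI)) as [M HM]. lra.
- intros t _. apply (cont_Cmod (fun t => f (w0 + polar r t)%C)).
  apply (Ccont_comp f (fun t => w0 + polar r t)%C).
  + apply Ccont_plus. apply Ccont_const. apply (Ccont_polar (fun _ => r) (fun t => t)); auto using cont_const, cont_id.
  + apply Hf. replace (w0 + polar r t - w0)%C with (polar r t) by ring. rewrite Cmod_polar; lra.
- exists (fun n => / (2 * PI)%R * CRInt (fun t => f (w0 + polar r t) * Cpw (polar (/ r) (- t)) n) 0 (2 * PI))%C, r.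
  split; auto. intros h Hh. apply cauchy_series with f' M; auto.
  intros t. destruct (polar_period_reduce r t) as (t' & Ht' & ->). now apply HM.
Qed.

Lemma Cmod_le_ReIm w : Cmod w <= Rabs (Re w) + Rabs (Im w).
Proof.
pose proof (Cmod_triangle (Re w) (Ci * Im w)%C) as T. rewrite Cmod_mult, !Cmod_R in T.
replace (Cmod Ci) with 1 in T.
2:{ transitivity (sqrt 1). symmetry; apply sqrt_1. unfold Cmod, Ci; simpl. f_equal; ring. }
replace (Re w + Ci * Im w)%C with w in T by (apply C_eq; unfold Re, Im; simpl; ring). lra.
Qed.

Lemma Csum_bound a (b : nat -> R) n : (forall k, Cmod (a k) <= b k) -> Cmod (Csum a n) <= sum_n b n.
Proof.
intros H. induction n as [|n IH]. rewrite Csum_O, sum_O. apply H.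
rewrite Csum_S, sum_Sn. eapply Rle_trans. apply Cmod_triangle. apply Rplus_le_compat; auto.
Qed.

Lemma sum_n_le_series (b : nat -> R) n : (forall k, 0 <= b k) -> ex_series b -> sum_n b n <= Series b.
Proof.
intros Hb He. pose proof (Series_correct _ He) as H.
apply (is_lim_seq_incr_compare (sum_n b) (Series b)). exact H.
intros k. rewrite sum_Sn. unfold plus; simpl. specialize (Hb (S k)). lra.
Qed.

(** * Identity theorem along a segment *)

Lemma geom_tail_bound (t : R) m N : 0 <= t < 1 -> sum_n (fun k => if Compare_dec.le_lt_dec k m then 0 else t ^ k) N <= t ^ S m / (1 - t).
Proof.
intros Ht.
assert (H : sum_n (fun k => if Compare_dec.le_lt_dec k m then 0 else t ^ k) N <= (t ^ S m - t ^ (S (max N m))) / (1 - t)).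
{ induction N as [|N IH].
  - rewrite sum_O. destruct Compare_dec.le_lt_dec; [|lia]. replace (max 0 m) with m by lia.
    unfold Rdiv. rewrite Rminus_eq_0. lra.
  - rewrite sum_Sn. change plus with Rplus. cbv beta. destruct (Compare_dec.le_lt_dec (S N) m) as [h|h].
    + replace (max (S N) m) with m by lia. replace (max N m) with m in IH by lia. rewrite Rplus_0_r. exact IH.
    + replace (max (S N) m) with (S N) by lia. replace (max N m) with N in IH by lia.
      eapply Rle_trans. apply Rplus_le_compat_r, IH. right. simpl. field. lra. }
eapply Rle_trans. exact H. unfold Rdiv. apply Rmult_le_compat_r. left; apply Rinv_0_lt_compat; lra.
assert (0 <= t ^ S (max N m)) by (apply pow_le; lra). lra.
Qed.

Lemma series_terms_bounded (u : nat -> C) h l : is_Cpseries u h l -> exists M, 0 < M /\ forall n, Cmod (Cpw h n * u n)%C <= M.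
Proof.
intros H. destruct (is_Cpseries_elim _ _ _ H 1 Rlt_0_1) as [N HN].
assert (B : exists B, 0 <= B /\ forall n, (n <= N)%nat -> Cmod (Cpw h n * u n)%C <= B).
{ clear HN. induction N as [|N (B & HB0 & HB)].
  - exists (Cmod (Cpw h 0 * u 0%nat)%C). split. apply Cmod_ge_0. intros n Hn. replace n with O by lia. lra.
  - exists (B + Cmod (Cpw h (S N) * u (S N))%C). pose proof (Cmod_ge_0 (Cpw h (S N) * u (S N))%C). split. lra.
    intros n Hn. destruct (PeanoNat.Nat.eq_dec n (S N)) as [->|]. lra. specialize (HB n ltac:(lia)). lra. }
destruct B as (B & HB0 & HB). exists (B + 2). split. lra.
intros n. destruct (Compare_dec.le_lt_dec n N) as [h1|h1]. specialize (HB n h1). lra.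
destruct n as [|n]. lia.
pose proof (HN n ltac:(lia)) as K1. pose proof (HN (S n) ltac:(lia)) as K2.
rewrite Csum_S in K2. set (s := Csum _ _) in *. set (w := (Cpw h (S n) * u (S n))%C) in *.
replace w with ((s + w - l) + - (s - l))%C by ring. eapply Rle_trans. apply Cmod_triangle. rewrite Cmod_opp. lra.
Qed.

(** A first nonzero coefficient [u m] would dominate near 0. At the point [t d0 v] its term is of
    order [t^m], while the later ones add up to at most [M t^(m + 1) / (1 - t)], because the terms
    at [d0 v] are bounded by [M]. *)
Lemma pseries_vanish (u : nat -> C) (v : C) (d0 : R) : v <> 0%C -> 0 < d0 ->
  (forall d, 0 < d <= d0 -> is_Cpseries u (d * v)%C 0) -> forall n, u n = 0%C.
Proof.
intros Hv Hd0 H.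
destruct (series_terms_bounded _ _ _ (H d0 ltac:(lra))) as (M & HM0 & HM).
pose proof (proj1 (Cmod_gt_0 v) Hv) as Hv0.
assert (HM' : forall n, Cmod (u n) * (d0 * Cmod v) ^ n <= M).
{ intros n. specialize (HM n). rewrite Cmod_mult, Cmod_Cpw, Cmod_mult, Cmod_R, Rabs_pos_eq in HM by lra. lra. }
intros n. induction n as [m IH] using (well_founded_induction Wf_nat.lt_wf).
assert (B : forall t, 0 < t < 1 -> Cmod (u m) * (d0 * Cmod v) ^ m <= M * (t / (1 - t))).
{ intros t Ht. set (x := (t * d0 * Cmod v)).
  assert (Hx : 0 < x) by (unfold x; apply Rmult_lt_0_compat; nra).
  assert (K : Cmod (u m) * x ^ m <= M * (t ^ S m / (1 - t))).
  { apply Rnot_lt_le. intros Hn.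
    set (eps := Cmod (u m) * x ^ m - M * (t ^ S m / (1 - t))). assert (He : 0 < eps) by (unfold eps; lra).
    destruct (is_Cpseries_elim _ _ _ (H (t * d0) ltac:(nra)) eps He) as [N HN].
    specialize (HN (N + m)%nat ltac:(lia)).
    set (a := fun k => (Cpw (RtoC (t * d0) * v) k * u k)%C) in *.
    (* The terms below [m] vanish by induction, so a long partial sum is the [m]-th term plus the
       tail [b]. *)
    set (b := fun k => (if Compare_dec.le_lt_dec k m then RtoC 0 else a k) : C).
    assert (E : forall k, (m <= k)%nat -> Csum a k = (a m + Csum b k)%C).
    { assert (E0 : forall k, (k < m)%nat -> Csum a k = 0%C).
      { intros k. induction k as [|k IHk]; intros Hk. rewrite Csum_O. unfold a. rewrite IH by lia. ring.
        rewrite Csum_S, IHk by lia. unfold a. rewrite IH by lia. ring. }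
      assert (E1 : forall k, (k <= m)%nat -> Csum b k = 0%C).
      { intros k. induction k as [|k IHk]; intros Hk. rewrite Csum_O. unfold b. destruct Compare_dec.le_lt_dec; [ring|lia].
        rewrite Csum_S, IHk by lia. unfold b. destruct Compare_dec.le_lt_dec; [ring|lia]. }
      intros k Hk. induction Hk as [|k Hk IHk].
      - rewrite E1 by lia. destruct m as [|m']. rewrite Csum_O; ring. rewrite Csum_S, E0 by lia. ring.
      - rewrite !Csum_S, IHk. unfold b at 3. destruct Compare_dec.le_lt_dec; [lia|ring]. }
    rewrite E in HN by lia.
    assert (Ea : forall k, Cmod (a k) = Cmod (u k) * x ^ k).
    { intros k. unfold a. rewrite Cmod_mult, Cmod_Cpw, Cmod_mult, Cmod_R, Rabs_pos_eq by nra. fold x. ring. }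
    assert (Bb : Cmod (Csum b (N + m)) <= M * (t ^ S m / (1 - t))).
    { eapply Rle_trans. apply (Csum_bound b (fun k => M * (if Compare_dec.le_lt_dec k m then 0 else t ^ k))).
      - intros k. unfold b. destruct Compare_dec.le_lt_dec. rewrite Cmod_0; lra.
        rewrite Ea. unfold x. rewrite Rmult_assoc, Rpow_mult_distr.
        assert (0 <= t ^ k) by (apply pow_le; lra). specialize (HM' k). nra.
      - rewrite (sum_n_ext _ (fun k => scal M (if Compare_dec.le_lt_dec k m then 0 else t ^ k))) by reflexivity.
        rewrite (sum_n_scal_l (K := R_Ring) (V := R_ModuleSpace)). apply Rmult_le_compat_l. lra. apply geom_tail_bound; lra. }
    replace (a m + Csum b (N + m) - 0)%C with (a m - - Csum b (N + m))%C in HN by ring.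
    pose proof (Cmod_triangle (a m - - Csum b (N + m)) (- Csum b (N + m)))%C as T.
    replace (a m - - Csum b (N + m) + - Csum b (N + m))%C with (a m) in T by ring.
    rewrite Cmod_opp, Ea in T. unfold eps in HN. lra. }
  apply Rmult_le_reg_r with (t ^ m). apply pow_lt; lra.
  unfold x in K. rewrite Rmult_assoc, Rpow_mult_distr in K. simpl in K.
  replace (M * (t / (1 - t)) * t ^ m) with (M * (t * t ^ m / (1 - t))) by (field; lra).
  eapply Rle_trans. 2: exact K. right; ring. }
destruct (Ceq_dec (u m) 0) as [E|E]; [exact E|exfalso].
set (Q := Cmod (u m) * (d0 * Cmod v) ^ m) in *.
assert (HQ : 0 < Q). { apply Rmult_lt_0_compat. now apply Cmod_gt_0. apply pow_lt. nra. }
(* With this [t <= 1 / 2], the bound [M t / (1 - t) <= 2 M t = M Q / (M + Q)] falls below [Q]. *)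
set (t := Q / (2 * (M + Q))).
assert (Ht : 0 < t <= / 2). { unfold t. split. apply Rdiv_lt_0_compat; lra.
  apply Rmult_le_reg_r with (2 * (M + Q)). lra. replace (Q / (2 * (M + Q)) * (2 * (M + Q))) with Q by (field; lra). lra. }
specialize (B t ltac:(lra)).
assert (M * (t / (1 - t)) <= M * (2 * t)).
{ apply Rmult_le_compat_l. lra. apply Rmult_le_reg_r with (1 - t). lra. replace (t / (1 - t) * (1 - t)) with t by (field; lra). nra. }
assert (t * (2 * (M + Q)) = Q) by (unfold t; field; lra). nra.
Qed.

Lemma analytic_minus F G w : analytic_at F w -> analytic_at G w -> analytic_at (fun u => F u - G u)%C w.
Proof.
intros (u & r & Hr & Hu) (v & s & Hs & Hv).
exists (fun n => u n - v n)%C, (Rmin r s). split. now apply Rmin_pos.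
intros h Hh. apply is_Cpseries_minus. apply Hu. eapply Rlt_le_trans. exact Hh. apply Rmin_l.
apply Hv. eapply Rlt_le_trans. exact Hh. apply Rmin_r.
Qed.

(** Zeros along a single direction already kill all coefficients, by [pseries_vanish]. *)
Lemma analytic_zero_ray (G : C -> C) (w v : C) (d0 : R) : analytic_at G w -> v <> 0%C -> 0 < d0 ->
  (forall d, 0 < d <= d0 -> G (w + d * v)%C = 0%C) -> exists r, 0 < r /\ forall h, Cmod h < r -> G (w + h)%C = 0%C.
Proof.
intros (u & r & Hr & Hu) Hv Hd0 H0. pose proof (proj1 (Cmod_gt_0 v) Hv) as Hv0.
assert (Z : forall n, u n = 0%C).
{ set (d1 := Rmin d0 (r / (2 * Cmod v))).
  assert (Hq : 0 < r / (2 * Cmod v)) by (apply Rdiv_lt_0_compat; lra).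
  apply (pseries_vanish u v d1); auto. now apply Rmin_pos.
  intros d Hd. rewrite <- (H0 d). apply Hu.
  - rewrite Cmod_mult, Cmod_R, Rabs_pos_eq by lra.
    assert (d <= r / (2 * Cmod v)) by (eapply Rle_trans; [apply Hd|apply Rmin_r]).
    apply Rle_lt_trans with (r / (2 * Cmod v) * Cmod v). apply Rmult_le_compat_r; lra.
    replace (r / (2 * Cmod v) * Cmod v) with (r / 2) by (field; lra). lra.
  - split. lra. eapply Rle_trans; [apply Hd|apply Rmin_l]. }
exists r. split; auto. intros h Hh. exact (is_Cpseries_0 u h _ Z (Hu h Hh)).
Qed.

(** Let [s] be the supremum of the [r] such that [G] vanishes on the segment from 0 to [r w]. Then
    [G] vanishes on a disc around [s w], which carries the zeros past [s] unless [s = 1]. *)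
Lemma identity_segment (G : C -> C) (w : C) r0 : 0 < r0 ->
  (forall r, 0 <= r <= 1 -> analytic_at G (r * w)%C) ->
  (forall r, 0 <= r <= 1 -> r < r0 -> G (r * w)%C = 0%C) -> G w = 0%C.
Proof.
intros Hr0 HA H0.
destruct (Ceq_dec w 0) as [->|Hw].
{ replace (RtoC 0) with (0%R * 0)%C at 1 by ring. apply H0; lra. }
set (E := fun r => 0 <= r <= 1 /\ forall p, 0 <= p <= r -> G (p * w)%C = 0%C).
set (r1 := Rmin 1 (r0 / 2)). assert (Hr1 : 0 < r1 <= 1 /\ r1 < r0).
{ unfold r1, Rmin; destruct Rle_dec; lra. }
destruct (completeness E) as [s [Hs1 Hs2]].
- exists 1. intros r [Hr _]; lra.
- exists r1. split. lra. intros p Hp. apply H0; lra.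
- assert (Hsr : r1 <= s). { apply Hs1. split. lra. intros p Hp. apply H0; lra. }
  assert (Hs : s <= 1). { apply Hs2. intros r [Hr _]; lra. }
  assert (L : forall p, 0 <= p < s -> G (p * w)%C = 0%C).
  { intros p Hp. apply Classical_Prop.NNPP. intros Hn.
    assert (s <= p); [|lra]. apply Hs2. intros r [Hr Hr']. apply Rnot_lt_le. intros Hlt. apply Hn, Hr'. lra. }
  (* The ray points back to 0, where [G] is already known to vanish. *)
  destruct (analytic_zero_ray G (s * w)%C (- w)%C s) as (r & Hr & HG).
  + apply HA; lra.
  + intros E0. apply Hw. replace w with (- - w)%C by ring. rewrite E0; ring.
  + lra.
  + intros d Hd. replace (s * w + d * - w)%C with (RtoC (s - d) * w)%C by (rewrite RtoC_minus; ring). apply L; lra.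
  + assert (Hw0 := proj1 (Cmod_gt_0 w) Hw).
    set (e := r / (2 * Cmod w)). assert (He : 0 < e) by (apply Rdiv_lt_0_compat; lra).
    assert (X : forall p, 0 <= p < s + e -> G (p * w)%C = 0%C).
    { intros p Hp. destruct (Rlt_le_dec p s). apply L; lra.
      replace (p * w)%C with (s * w + RtoC (p - s) * w)%C by (rewrite RtoC_minus; ring). apply HG.
      rewrite Cmod_mult, Cmod_R, Rabs_pos_eq by lra.
      apply Rle_lt_trans with (e * Cmod w). apply Rmult_le_compat_r; lra.
      unfold e. replace (r / (2 * Cmod w) * Cmod w) with (r / 2) by (field; lra). lra. }
    destruct (Req_dec s 1) as [->|Hs']. replace w with (1%R * w)%C by ring. apply X; lra.
    assert (Rmin 1 (s + e / 2) <= s).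
    { apply Hs1. split. unfold Rmin; destruct Rle_dec; lra. intros p Hp. apply X.
      assert (p <= s + e / 2) by (eapply Rle_trans; [apply Hp|apply Rmin_r]). lra. }
    unfold Rmin in H; destruct Rle_dec; lra.
Qed.

(** * Power series with real coefficients *)

Definition CV1 (g : nat -> R) : Prop := forall x, 0 <= x < 1 -> Rbar_lt x (CV_radius g).

Lemma CV1_derive g : CV1 g -> CV1 (PS_derive g).
Proof. intros H x Hx. rewrite CV_radius_derive. now apply H. Qed.

Definition CSum (g : nat -> R) (w : C) : C :=
  (Series (fun n => g n * Re (Cpw w n)), Series (fun n => g n * Im (Cpw w n))).

Lemma CV1_abs g x : CV1 g -> 0 <= x < 1 -> ex_series (fun n => Rabs (g n) * x ^ n).
Proof.
intros H Hx. apply ex_series_ext with (fun n => Rabs (g n * x ^ n)).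
- intros n. rewrite Rabs_mult, (Rabs_pos_eq (x ^ n)). reflexivity. apply pow_le; lra.
- apply CV_disk_inside. rewrite Rabs_pos_eq by lra. now apply H.
Qed.

Lemma Rabs_Re_Cpw w n : Rabs (Re (Cpw w n)) <= Cmod w ^ n /\ Rabs (Im (Cpw w n)) <= Cmod w ^ n.
Proof.
rewrite <- Cmod_Cpw. split; apply Rle_trans with (2 := Rmax_Cmod _). apply Rmax_l. apply Rmax_r.
Qed.

Lemma CSum_correct g w : CV1 g -> Cmod w < 1 -> is_Cpseries (fun n => RtoC (g n)) w (CSum g w).
Proof.
intros Hg Hw. pose proof (Cmod_ge_0 w) as Hw0.
assert (e : ex_series (fun n => Rabs (g n) * Cmod w ^ n)) by (apply CV1_abs; auto).
assert (e1 : ex_series (fun n => g n * Re (Cpw w n))).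
{ apply (ex_series_le (V := R_CompleteNormedModule) _ _) with (2 := e). intros n. unfold norm; simpl; unfold abs; simpl.
  rewrite Rabs_mult. apply Rmult_le_compat_l. apply Rabs_pos. apply Rabs_Re_Cpw. }
assert (e2 : ex_series (fun n => g n * Im (Cpw w n))).
{ apply (ex_series_le (V := R_CompleteNormedModule) _ _) with (2 := e). intros n. unfold norm; simpl; unfold abs; simpl.
  rewrite Rabs_mult. apply Rmult_le_compat_l. apply Rabs_pos. apply Rabs_Re_Cpw. }
pose proof (Series_correct _ e1) as s1. pose proof (Series_correct _ e2) as s2.
apply is_Cpseries_intro. intros eps He.
assert (He2 : 0 < eps / 2) by lra.
destruct (proj1 (filterlim_locally _ _) s1 (mkposreal _ He2)) as [N1 K1].
destruct (proj1 (filterlim_locally _ _) s2 (mkposreal _ He2)) as [N2 K2].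
exists (N1 + N2)%nat. intros n Hn. specialize (K1 n ltac:(lia)). specialize (K2 n ltac:(lia)).
unfold ball in K1, K2; simpl in K1, K2; unfold AbsRing_ball, abs, minus, plus, opp in K1, K2; simpl in K1, K2.
assert (E : forall n, Csum (fun k => Cpw w k * g k)%C n =
  (sum_n (fun n => g n * Re (Cpw w n)) n, sum_n (fun n => g n * Im (Cpw w n)) n)).
{ clear. intros n. induction n as [|n IH].
  - rewrite Csum_O, !sum_O. apply C_eq; unfold Re, Im; simpl; ring.
  - rewrite Csum_S, IH, !sum_Sn. unfold plus; simpl. apply C_eq; unfold Re, Im; simpl; ring. }
rewrite E. eapply Rle_lt_trans. apply Cmod_le_ReIm.
change (Rabs (sum_n (fun n => g n * Re (Cpw w n)) n + - Series (fun n => g n * Re (Cpw w n))) +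
  Rabs (sum_n (fun n => g n * Im (Cpw w n)) n + - Series (fun n => g n * Im (Cpw w n))) < eps).
replace eps with (eps / 2 + eps / 2) by field. exact (Rplus_lt_compat _ _ _ _ K1 K2).
Qed.

(** Induction by splitting off a factor [w + h]. The constant is the one in the series of the second
    derivative, so the bounds can be summed against its coefficients. *)
Lemma Cpw_taylor w h rho n : 0 < rho -> Cmod w <= rho -> Cmod (w + h)%C <= rho ->
  Cmod (Cpw (w + h) (S (S n)) - Cpw w (S (S n)) - RtoC (INR (S (S n))) * Cpw w (S n) * h)%C <=
  INR (S (S n)) * INR (S n) * rho ^ n * Cmod h ^ 2.
Proof.
intros Hr Hw Hwh. induction n as [|n IH].
- replace (_ - _ - _)%C with (h * h)%C.
  + rewrite Cmod_mult. simpl. pose proof (Cmod_ge_0 h). nra.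
  + rewrite !Cpw_S. unfold Cpw; simpl. change (one : C) with (RtoC 1). apply C_eq; unfold Re, Im; simpl; ring.
- set (m := S (S n)) in *.
  replace (Cpw (w + h) (S m) - Cpw w (S m) - RtoC (INR (S m)) * Cpw w m * h)%C
   with ((w + h) * (Cpw (w + h) m - Cpw w m - RtoC (INR m) * Cpw w (S n) * h) + RtoC (INR m) * Cpw w (S n) * (h * h))%C.
  2:{ rewrite !(Cpw_S _ m), (S_INR m), RtoC_plus. unfold m at 8. rewrite !(Cpw_S w (S n)). unfold m. rewrite !(Cpw_S w (S n)). ring. }
  eapply Rle_trans. apply Cmod_triangle. rewrite !Cmod_mult, Cmod_R, Rabs_pos_eq, Cmod_Cpw by apply pos_INR.
  pose proof (Cmod_ge_0 w). pose proof (Cmod_ge_0 h). pose proof (Cmod_ge_0 (w + h)%C).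
  assert (P1 : Cmod w ^ S n <= rho ^ S n) by (apply pow_incr; lra).
  assert (Pm := pos_INR m).
  set (X := Cmod (Cpw (w + h) m - Cpw w m - RtoC (INR m) * Cpw w (S n) * h)%C) in *.
  assert (0 <= X) by apply Cmod_ge_0.
  assert (Q1 : Cmod (w + h)%C * X <= rho * (INR m * INR (S n) * rho ^ n * Cmod h ^ 2)) by (apply Rmult_le_compat; auto).
  assert (Q2 : INR m * Cmod w ^ S n * (Cmod h * Cmod h) <= INR m * rho ^ S n * (Cmod h * Cmod h)).
  { apply Rmult_le_compat_r. nra. apply Rmult_le_compat_l; auto. }
  replace (INR (S m)) with (INR (S n) + 2) by (unfold m; rewrite !S_INR; ring).
  assert (0 <= INR m * rho ^ S n * (Cmod h * Cmod h)).
  { apply Rmult_le_pos; [|nra]. apply Rmult_le_pos; auto. apply pow_le; lra. }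
  replace ((INR (S n) + 2) * INR m * rho ^ S n * Cmod h ^ 2) with
    (INR (S n) * (INR m * rho ^ S n * (Cmod h * Cmod h)) + 2 * (INR m * rho ^ S n * (Cmod h * Cmod h))) by ring.
  replace (rho * (INR m * INR (S n) * rho ^ n * Cmod h ^ 2)) with (INR (S n) * (INR m * rho ^ S n * (Cmod h * Cmod h))) in Q1 by (simpl; ring).
  lra.
Qed.

(** Summing [Cpw_taylor] bounds the remainder by [Cmod h ^ 2] times the series of absolute values of
    the second derivative at [rho], halfway between [Cmod w] and 1. *)
Lemma CSum_taylor g w : CV1 g -> Cmod w < 1 -> exists K r, 0 < r /\ forall h, Cmod h < r ->
  Cmod (CSum g (w + h) - CSum g w - CSum (PS_derive g) w * h)%C <= K * Cmod h ^ 2.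
Proof.
intros Hg Hw. pose proof (Cmod_ge_0 w) as Hw0.
set (rho := (1 + Cmod w) / 2). assert (Hrho : 0 < rho < 1 /\ Cmod w < rho) by (unfold rho; lra).
set (g2 := PS_derive (PS_derive g)). assert (Hg2 : CV1 g2) by (now apply CV1_derive, CV1_derive).
assert (e : ex_series (fun n => Rabs (g2 n) * rho ^ n)) by (apply CV1_abs; auto; lra).
set (K := Series (fun n => Rabs (g2 n) * rho ^ n)).
exists K, (rho - Cmod w). split. lra. intros h Hh.
assert (Hwh : Cmod (w + h)%C <= rho) by (eapply Rle_trans; [apply Cmod_triangle|lra]).
pose proof (CSum_correct g (w + h)%C Hg ltac:(lra)) as C1.
pose proof (CSum_correct g w Hg Hw) as C2.
pose proof (CSum_correct (PS_derive g) w (CV1_derive g Hg) Hw) as C3.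
apply Rnot_lt_le. intros Hn. set (L := (CSum g (w + h) - CSum g w - CSum (PS_derive g) w * h)%C) in *.
(* Replacing the three sums by partial sums costs [eps], [eps] and [eps * Cmod h]; the denominator
   makes these add up to the supposed excess. *)
set (eps := (Cmod L - K * Cmod h ^ 2) / (2 + Cmod h)).
assert (He : 0 < eps) by (apply Rdiv_lt_0_compat; pose proof (Cmod_ge_0 h); lra).
destruct (is_Cpseries_elim _ _ _ C1 eps He) as [N1 K1].
destruct (is_Cpseries_elim _ _ _ C2 eps He) as [N2 K2].
destruct (is_Cpseries_elim _ _ _ C3 eps He) as [N3 K3].
set (N := (N1 + N2 + N3)%nat).
specialize (K1 (S (S N)) ltac:(lia)). specialize (K2 (S (S N)) ltac:(lia)). specialize (K3 (S N) ltac:(lia)).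
cbv beta in K1, K2, K3.
set (S1 := Csum (fun k => Cpw (w + h) k * g k)%C (S (S N))) in *.
set (S2 := Csum (fun k => Cpw w k * g k)%C (S (S N))) in *.
set (S3 := Csum (fun k => Cpw w k * PS_derive g k)%C (S N)) in *.
(* The terms of degree 0 and 1 cancel, hence the shift by two; the differentiated series has one
   term fewer. *)
set (F := fun k => (g (S (S k)) * (Cpw (w + h) (S (S k)) - Cpw w (S (S k)) - RtoC (INR (S (S k))) * Cpw w (S k) * h))%C).
assert (E : (S1 - S2 - S3 * h)%C = Csum F N).
{ unfold S1, S2, S3. clearbody N. clear. 
  assert (Z : forall n, (RtoC (PS_derive g n) = INR (S n) * g (S n))%C) by (intros n; unfold PS_derive; now rewrite RtoC_mult).
  induction N as [|N IH].
  - rewrite !Csum_S, !Csum_O. unfold F. cbv beta. rewrite !Z, !Cpw_S. unfold Cpw; simpl. change (one : C) with (RtoC 1). apply C_eq; unfold Re, Im; simpl; ring.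
  - rewrite (Csum_S (fun k => Cpw (w + h) k * g k)%C (S (S N))), (Csum_S (fun k => Cpw w k * g k)%C (S (S N))), (Csum_S (fun k => Cpw w k * PS_derive g k)%C (S N)), (Csum_S F N), <- IH. cbv beta. rewrite Z. unfold F. ring. }
assert (B : Cmod (S1 - S2 - S3 * h)%C <= K * Cmod h ^ 2).
{ rewrite E. eapply Rle_trans. apply (Csum_bound F (fun k => scal (Cmod h ^ 2) (Rabs (g2 k) * rho ^ k))).
  - intros k. unfold F. rewrite Cmod_mult, Cmod_R. eapply Rle_trans. apply Rmult_le_compat_l. apply Rabs_pos.
    apply (Cpw_taylor w h rho k); lra. right. unfold g2, PS_derive. rewrite !Rabs_mult, !(Rabs_pos_eq (INR _)) by apply pos_INR.
    unfold scal; simpl; unfold mult; simpl. ring.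
  - rewrite (sum_n_scal_l (K := R_Ring) (V := R_ModuleSpace)). unfold scal; simpl; unfold mult; simpl. rewrite Rmult_comm.
    apply Rmult_le_compat_r. pose proof (Cmod_ge_0 h); nra. apply sum_n_le_series; auto.
    intros k. apply Rmult_le_pos. apply Rabs_pos. apply pow_le; lra. }
assert (T : Cmod L < Cmod (S1 - S2 - S3 * h)%C + (eps + eps + eps * Cmod h)).
{ replace L with ((S1 - S2 - S3 * h) + (- (S1 - CSum g (w + h)) + (S2 - CSum g w) + (S3 - CSum (PS_derive g) w) * h))%C by (unfold L; ring).
  eapply Rle_lt_trans. apply Cmod_triangle. apply Rplus_lt_compat_l.
  eapply Rle_lt_trans. apply Cmod_triangle. apply Rplus_lt_le_compat.
  eapply Rle_lt_trans. apply Cmod_triangle. rewrite Cmod_opp. lra.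
  rewrite Cmod_mult. apply Rmult_le_compat_r. apply Cmod_ge_0. lra. }
assert (Ee : eps + eps + eps * Cmod h = Cmod L - K * Cmod h ^ 2).
{ unfold eps. field. pose proof (Cmod_ge_0 h); lra. }
lra.
Qed.

Lemma squeeze_derive (E N : R -> R) (t : R) : locally t (fun s => Rabs (E s) <= N s) -> N t = 0 -> is_derive N t 0 -> is_derive E t 0.
Proof.
intros HL Ht HN. apply is_derive_Reals in HN. apply is_derive_Reals. intros eps He.
destruct (HN eps He) as [d Hd]. destruct HL as [d2 Hd2].
assert (E0 : E t = 0). { pose proof (Hd2 t (ball_center t d2)) as h. rewrite Ht in h. pose proof (Rabs_pos (E t)).
  destruct (Req_dec (E t) 0); auto. pose proof (Rabs_pos_lt (E t) H0). lra. }
assert (Hm : 0 < Rmin d d2) by (apply Rmin_pos; apply cond_pos).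
exists (mkposreal _ Hm). intros h Hh Hhd. simpl in Hhd.
specialize (Hd h Hh ltac:(eapply Rlt_le_trans; [exact Hhd|apply Rmin_l])).
assert (B := Hd2 (t + h)). unfold ball in B; simpl in B; unfold AbsRing_ball, abs, minus, plus, opp in B; simpl in B.
replace (t + h + - t) with h in B by ring. specialize (B ltac:(eapply Rlt_le_trans; [exact Hhd|apply Rmin_r])).
rewrite E0. rewrite Ht in Hd. rewrite !Rminus_0_r in *.
unfold Rdiv in *. rewrite Rabs_mult in *. eapply Rle_lt_trans. 2: exact Hd.
apply Rmult_le_compat_r. apply Rabs_pos. eapply Rle_trans. exact B. apply Rle_abs.
Qed.

(** Along a curve through [w] the remainder is at most [K] times the squared distance to [w], a
    function whose derivative vanishes there. *)
Lemma taylor_holo f w d K r : 0 < r ->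
  (forall h, Cmod h < r -> Cmod (f (w + h) - f w - d * h)%C <= K * Cmod h ^ 2) ->
  is_holo f w d /\ Ccont (T := C_UniformSpace) f w.
Proof.
intros Hr H.
assert (HT : forall u, Cmod (u - w)%C < r -> Cmod (f u - f w - d * (u - w))%C <= K * Cmod (u - w)%C ^ 2).
{ intros u Hu. specialize (H (u - w)%C Hu). now replace (w + (u - w))%C with u in H by ring. }
split.
- intros c t d' Ec Hc. pose proof Hc as [D1 D2].
  assert (Cc : Ccont c t) by exact (Ccont_of_deriv _ _ _ Hc).
  set (e := fun s => (f (c s) - f w - d * (c s - w))%C).
  set (N := fun s => K * (((Re (c s) - Re w) * (Re (c s) - Re w)) + ((Im (c s) - Im w) * (Im (c s) - Im w)))).
  assert (Nt : N t = 0) by (unfold N; rewrite Ec; ring).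
  assert (DN : is_derive N t 0).
  { assert (Q : forall (x : R -> R) x' x0, is_derive x t x' -> x t = x0 -> is_derive (fun s => (x s - x0) * (x s - x0)) t 0).
    { intros x x' x0 Dx Ex. assert (ex_derive x t) by (eexists; exact Dx).
      eapply is_derive_val. auto_derive. repeat split; auto. reflexivity. rewrite Ex. ring. }
    assert (P := is_derive_plus (V := R_NormedModule) _ _ _ _ _ (Q _ _ (Re w) D1 ltac:(cbv beta; now rewrite Ec)) (Q _ _ (Im w) D2 ltac:(cbv beta; now rewrite Ec))).
    apply (is_derive_scal _ t K) in P. eapply is_derive_val. exact P. unfold plus; simpl. ring. }
  assert (L : locally t (fun s => Cmod (e s) <= N s)).
  { assert (Cm : continuous (fun s => Cmod (c s - w)%C) t) by (apply cont_Cmod, Ccont_minus; auto using Ccont_const).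
    assert (Z : Cmod (c t - w)%C < r) by (rewrite Ec; replace (w - w)%C with (RtoC 0) by ring; now rewrite Cmod_0).
    apply filter_imp with (2 := locally_lt _ _ _ Cm Z). intros s Hs. eapply Rle_trans. apply HT, Hs.
    unfold N. right. f_equal. simpl. rewrite Rmult_1_r, Cmod_sqr. unfold Re, Im; simpl. ring. }
  assert (De : is_Cderive e t 0).
  { split.
    - apply (squeeze_derive _ N); auto. apply filter_imp with (2 := L). intros s Hs. eapply Rle_trans. 2: exact Hs.
      apply Rle_trans with (2 := Rmax_Cmod _). apply Rmax_l.
    - apply (squeeze_derive _ N); auto. apply filter_imp with (2 := L). intros s Hs. eapply Rle_trans. 2: exact Hs.
      apply Rle_trans with (2 := Rmax_Cmod _). apply Rmax_r. }
  apply is_Cderive_ext_loc with (fun s => e s + (f w + d * (c s - w)))%C.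
  { apply filter_forall. intros s. unfold e. ring. }
  eapply is_Cderive_val.
  + apply is_Cderive_plus. exact De. apply is_Cderive_plus. apply is_Cderive_const. apply is_Cderive_mult. apply is_Cderive_const.
    apply is_Cderive_minus. exact Hc. apply is_Cderive_const.
  + cbv beta. ring.
- assert (Cf : forall eps : posreal, locally (T := C_UniformSpace) w (fun u => Cmod (f u - f w)%C < eps)).
  { intros eps. pose proof (cond_pos eps). set (B := Cmod d + Rabs K * r + 1).
    assert (HB : 0 < B). { unfold B. pose proof (Cmod_ge_0 d). pose proof (Rabs_pos K). nra. }
    set (dl := Rmin r (eps / B) / 2). assert (Hdl : 0 < dl).
    { apply Rdiv_lt_0_compat; [|lra]. apply Rmin_pos; auto. now apply Rdiv_lt_0_compat. }
    exists (mkposreal _ Hdl). intros u Hu. apply Cball_inv in Hu. simpl in Hu.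
    replace (2 * dl) with (Rmin r (eps / B)) in Hu by (unfold dl; field).
    assert (h1 : Cmod (u - w)%C < r) by (eapply Rlt_le_trans; [exact Hu|apply Rmin_l]).
    assert (h2 : Cmod (u - w)%C < eps / B) by (eapply Rlt_le_trans; [exact Hu|apply Rmin_r]).
    specialize (HT u h1). pose proof (Cmod_ge_0 (u - w)%C).
    replace (f u - f w)%C with ((f u - f w - d * (u - w)) + d * (u - w))%C by ring.
    eapply Rle_lt_trans. apply Cmod_triangle. rewrite Cmod_mult.
    set (x := Cmod (u - w)%C) in *.
    assert (K * x ^ 2 <= Rabs K * r * x).
    { apply Rle_trans with (Rabs K * x ^ 2). apply Rmult_le_compat_r. nra. apply Rle_abs.
      pose proof (Rabs_pos K). simpl. rewrite Rmult_1_r, !Rmult_assoc. apply Rmult_le_compat_l; auto. nra. }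
    apply Rle_lt_trans with (B * x). unfold B; nra.
    apply Rmult_lt_reg_r with (/ B). now apply Rinv_0_lt_compat. replace (B * x * / B) with x by (field; lra). exact h2. }
  split; apply filterlim_locally; intros eps; apply filter_imp with (2 := Cf eps); intros u Hu;
    unfold ball; simpl; unfold AbsRing_ball, abs, minus, plus, opp; simpl;
    (eapply Rle_lt_trans; [|exact Hu]); apply Rle_trans with (2 := Rmax_Cmod _). apply Rmax_l. apply Rmax_r.
Qed.

Lemma CSum_holo g w : CV1 g -> Cmod w < 1 -> is_holo (CSum g) w (CSum (PS_derive g) w) /\ Ccont (T := C_UniformSpace) (CSum g) w.
Proof.
intros Hg Hw. destruct (CSum_taylor g w Hg Hw) as (K & r & Hr & H). now apply taylor_holo with K r.
Qed.

Lemma CSum_analytic g w : CV1 g -> Cmod w < 1 -> analytic_at (CSum g) w.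
Proof.
intros Hg Hw. apply (holo_analytic (CSum g) (CSum (PS_derive g)) w ((1 - Cmod w) / 2)). lra.
intros u Hu.
assert (Cmod u < 1).
{ replace u with (u - w + w)%C by ring. eapply Rle_lt_trans. apply Cmod_triangle. lra. }
destruct (CSum_holo g u Hg H) as [h1 h2]. destruct (CSum_holo (PS_derive g) u (CV1_derive g Hg) H) as [_ h3]. auto.
Qed.

(** * Gauss's series and its differential equation *)

(** The real number inside [gauss_coef], to which the theory of [PSeries] applies. *)
Definition gcoef (a b c : R) (n : nat) : R :=
  pochhammer a n * pochhammer b n / (pochhammer c n * INR (fact n)).

Lemma pochhammer_pos c n : 0 < c -> 0 < pochhammer c n.
Proof.
intros Hc. induction n as [|n IH]; simpl. lra. apply Rmult_lt_0_compat; auto. pose proof (pos_INR n); lra.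
Qed.

Lemma gcoef_rec a b c n : 0 < c ->
  INR (S n) * (c + INR n) * gcoef a b c (S n) = (a + INR n) * (b + INR n) * gcoef a b c n.
Proof.
intros Hc. unfold gcoef. pose proof (pochhammer_pos c n Hc). pose proof (INR_fact_lt_0 n). pose proof (pos_INR n).
rewrite fact_simpl, mult_INR, S_INR. simpl pochhammer. field. repeat split; lra.
Qed.

Lemma gcoef_0 a b c : gcoef a b c 0 = 1.
Proof. unfold gcoef; simpl. field. Qed.

(** For [rho < 1] the terms [g n * rho ^ n] eventually decrease in modulus. Comparing products
    rather than quotients admits vanishing coefficients, which occur when [a] or [b] is a
    nonpositive integer, as for even [alpha]. *)
Lemma gcoef_CV1 a b c : 0 < c -> CV1 (gcoef a b c).
Proof.
intros Hc x Hx. set (g := gcoef a b c).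
set (rho := (1 + x) / 2). assert (Hr : x < rho < 1 /\ 0 < rho) by (unfold rho; lra).
assert (B : exists M, forall n, Rabs (g n * rho ^ n) <= M).
{ set (A := Rabs a). set (B := Rabs b). pose proof (Rabs_pos a). pose proof (Rabs_pos b). fold A in H. fold B in H0.
  (* [Q] collects the lower-order terms: [(A + n) (B + n) <= n^2 + Q n] once [1 <= n], which the
     summand 1 in the threshold ensures. *)
  set (Q := A + B + A * B). assert (HQ : 0 <= Q) by (unfold Q; nra).
  destruct (INR_unbounded (rho * Q / (1 - rho) + 1)) as [N HN].
  assert (Hq : 0 <= rho * Q / (1 - rho)) by (apply Rdiv_le_0_compat; nra).
  assert (Hstep : forall n, (N <= n)%nat -> Rabs (g (S n) * rho ^ S n) <= Rabs (g n * rho ^ n)).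
  { intros n Hn. apply le_INR in Hn.
    assert (E := gcoef_rec a b c n Hc). fold g in E.
    assert (Hpos : 0 < INR (S n) * (c + INR n)) by (rewrite S_INR; apply Rmult_lt_0_compat; lra).
    apply Rmult_le_reg_l with (INR (S n) * (c + INR n)); auto.
    rewrite <- (Rabs_pos_eq (INR (S n) * (c + INR n))) at 1 by lra.
    rewrite <- Rabs_mult, <- Rmult_assoc, E. simpl pow. rewrite !Rabs_mult.
    rewrite (Rabs_pos_eq rho) by lra. set (P := Rabs (rho ^ n)). set (G := Rabs (g n)).
    assert (0 <= P) by apply Rabs_pos. assert (0 <= G) by apply Rabs_pos.
    assert (a1 : Rabs (a + INR n) <= A + INR n). { eapply Rle_trans. apply Rabs_triang. rewrite (Rabs_pos_eq (INR n)) by lra. unfold A; lra. }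
    assert (a2 : Rabs (b + INR n) <= B + INR n). { eapply Rle_trans. apply Rabs_triang. rewrite (Rabs_pos_eq (INR n)) by lra. unfold B; lra. }
    assert (a3 : Rabs (a + INR n) * Rabs (b + INR n) <= (A + INR n) * (B + INR n)).
    { apply Rmult_le_compat; auto using Rabs_pos. }
    assert (a4 : rho * Q <= (1 - rho) * INR n).
    { apply Rmult_le_reg_r with (/ (1 - rho)). apply Rinv_0_lt_compat; lra.
      replace ((1 - rho) * INR n * / (1 - rho)) with (INR n) by (field; lra). unfold Rdiv in HN. lra. }
    assert (a5 : (A + INR n) * (B + INR n) * rho <= INR (S n) * (c + INR n)).
    { rewrite S_INR. set (m := INR n) in *. assert (1 <= m) by lra.
      assert (0 <= A * B * (m - 1)) by (apply Rmult_le_pos; [nra|lra]).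
      assert ((A + m) * (B + m) <= m * m + Q * m) by (unfold Q; lra).
      assert (m * (rho * Q) <= m * ((1 - rho) * m)) by (apply Rmult_le_compat_l; lra).
      assert ((m * m + Q * m) * rho <= m * m) by lra.
      assert ((A + m) * (B + m) * rho <= (m * m + Q * m) * rho) by (apply Rmult_le_compat_r; lra).
      assert (m * m <= (m + 1) * (c + m)) by nra. lra. }
    assert (Rabs (a + INR n) * Rabs (b + INR n) * rho <= INR (S n) * (c + INR n)).
    { eapply Rle_trans. 2: exact a5. apply Rmult_le_compat_r; lra. }
    assert (0 <= G * P) by nra.
    replace (Rabs (a + INR n) * Rabs (b + INR n) * G * (rho * P)) with (Rabs (a + INR n) * Rabs (b + INR n) * rho * (G * P)) by ring.
    apply Rmult_le_compat_r; lra. }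
  assert (Hfin : exists M, forall n, (n <= N)%nat -> Rabs (g n * rho ^ n) <= M).
  { clear HN Hstep. induction N as [|N [M HM]].
    - exists (Rabs (g 0%nat * rho ^ 0)). intros n Hn. replace n with O by lia. lra.
    - exists (Rmax M (Rabs (g (S N) * rho ^ S N))). intros n Hn. destruct (PeanoNat.Nat.eq_dec n (S N)) as [->|].
      apply Rmax_r. eapply Rle_trans. apply HM; lia. apply Rmax_l. }
  destruct Hfin as [M HM]. exists M. intros n. destruct (Compare_dec.le_lt_dec n N) as [h|h]. auto.
  assert (forall k, Rabs (g (N + k)%nat * rho ^ (N + k)) <= M).
  { intros k. induction k as [|k IH]. replace (N + 0)%nat with N by lia. apply HM; lia.
    replace (N + S k)%nat with (S (N + k)) by lia. eapply Rle_trans. apply Hstep; lia. exact IH. }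
  replace n with (N + (n - N))%nat by lia. apply H1. }
apply Rbar_lt_le_trans with rho. simpl; lra.
apply (proj1 (CV_radius_bounded g)). exact B.
Qed.

Lemma Series_zero : Series (fun _ => 0) = 0.
Proof.
rewrite <- (Series_ext (fun n => 0 * 0)). rewrite Series_scal_l; ring. intros; ring.
Qed.

Lemma Cpw_R (x : R) n : Cpw x n = x ^ n.
Proof. induction n as [|n IH]. reflexivity. rewrite Cpw_S, IH. simpl. now rewrite RtoC_mult. Qed.

Lemma CSum_R g (x : R) : CSum g x = PSeries g x.
Proof.
unfold CSum, PSeries. apply C_eq; simpl.
- apply Series_ext. intros n. now rewrite Cpw_R.
- rewrite <- Series_zero. apply Series_ext. intros n. rewrite Cpw_R. unfold Im; simpl; ring.
Qed.

Section PSode.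
Variables (g : nat -> R) (a b c : R).
Hypothesis Hg : CV1 g.
Hypothesis Hrec : forall n, INR (S n) * (c + INR n) * g (S n) = (a + INR n) * (b + INR n) * g n.
Let g1 := PS_derive g.
Let g2 := PS_derive g1.

Lemma CV1_Rbar h x : CV1 h -> Rabs x < 1 -> Rbar_lt (Rabs x) (CV_radius h).
Proof. intros Hh Hx. apply Hh. split; auto. apply Rabs_pos. Qed.

Lemma CV1_is_pseries h x : CV1 h -> Rabs x < 1 -> is_pseries h x (PSeries h x).
Proof. intros Hh Hx. apply PSeries_correct, CV_radius_inside. now apply CV1_Rbar. Qed.

Lemma ps_ode z : Rabs z < 1 ->
  z * (1 - z) * PSeries g2 z + (c - (a + b + 1) * z) * PSeries g1 z - a * b * PSeries g z = 0.
Proof.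
intros Hz.
assert (H0 := CV1_is_pseries g z Hg Hz).
assert (H1 := CV1_is_pseries g1 z (CV1_derive g Hg) Hz).
assert (H2 := CV1_is_pseries g2 z (CV1_derive g1 (CV1_derive g Hg)) Hz).
set (L0 := PSeries g z) in *. set (L1 := PSeries g1 z) in *. set (L2 := PSeries g2 z) in *.
assert (I2 := is_pseries_incr_1 _ _ _ H2). assert (I22 := is_pseries_incr_1 _ _ _ I2). assert (I1 := is_pseries_incr_1 _ _ _ H1).
assert (mc : forall k : R, mult (K := R_AbsRing) z k = mult k z) by (intros; apply Rmult_comm).
assert (T := is_pseries_minus _ _ _ _ _
  (is_pseries_plus _ _ _ _ _ (is_pseries_minus _ _ _ _ _ I2 I22) (is_pseries_scal c _ _ _ (mc c) H1))
  (is_pseries_plus _ _ _ _ _ (is_pseries_scal (a + b + 1) _ _ _ (mc _) I1) (is_pseries_scal (a * b) _ _ _ (mc _) H0))).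
assert (Z : is_pseries (fun _ => 0) z (z * (1 - z) * L2 + (c - (a + b + 1) * z) * L1 - a * b * L0)).
{ replace (z * (1 - z) * L2 + (c - (a + b + 1) * z) * L1 - a * b * L0) with
   (plus (plus (plus (scal z L2) (opp (scal z (scal z L2)))) (scal c L1)) (opp (plus (scal (a + b + 1) (scal z L1)) (scal (a * b) L0)))).
  2:{ unfold plus, opp, scal; simpl; unfold mult; simpl. ring. }
  revert T. apply is_pseries_ext. intros n.
  unfold PS_minus, PS_plus, PS_scal, PS_opp, plus, opp, scal; simpl; unfold mult; simpl.
  assert (R0 := Hrec n).
  (* Degrees 0 and 1 are separate because of the shifts [PS_incr_1]; in each degree the coefficient
     is [Hrec]. *)
  destruct n as [|[|n]].
  - unfold PS_incr_1, g2, g1, PS_derive, zero; simpl in *. lra.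
  - unfold PS_incr_1, g2, g1, PS_derive, zero; simpl in *. lra.
  - change (PS_incr_1 g2 (S (S n))) with (g2 (S n)). change (PS_incr_1 (PS_incr_1 g2) (S (S n))) with (g2 n). change (PS_incr_1 g1 (S (S n))) with (g1 (S n)).
    unfold g2, g1, PS_derive. rewrite !S_INR in *. set (k := INR n) in *.
    set (u := g (S (S (S n)))) in *. set (v := g (S (S n))) in *. lra. }
rewrite <- (is_pseries_unique _ _ _ Z). apply PSeries_const_0.
Qed.
End PSode.

(** * The two solutions at the origin in the variable [t], where [w = - t ^ 2] *)

(** The hypergeometric equation at a point in the variable [x = - w], with both derivatives named so
    that the chain rule can transport it. *)
Definition hyp_ode (a b c : R) (y y1 y2 : R -> R) (x : R) : Prop :=
  is_derive y x (y1 x) /\ is_derive y1 x (y2 x) /\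
  x * (1 + x) * y2 x + (c + (a + b + 1) * x) * y1 x + a * b * y x = 0.

Lemma gauss_ode a b c x : 0 < c -> Rabs x < 1 ->
  hyp_ode a b c (fun x => PSeries (gcoef a b c) (- x))
    (fun x => - PSeries (PS_derive (gcoef a b c)) (- x))
    (fun x => PSeries (PS_derive (PS_derive (gcoef a b c))) (- x)) x.
Proof.
intros Hc Hx. set (g := gcoef a b c). assert (Hg : CV1 g) by now apply gcoef_CV1.
assert (Hx' : Rabs (- x) < 1) by (now rewrite Rabs_Ropp).
assert (D : forall h, CV1 h -> is_derive (fun x => PSeries h (- x)) x (- PSeries (PS_derive h) (- x))).
{ intros h Hh. eapply is_derive_val. apply (is_derive_comp (PSeries h) (fun x => - x)).
  apply is_derive_PSeries. now apply CV1_Rbar. auto_derive. easy. reflexivity.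
  unfold scal; simpl; unfold mult; simpl. ring. }
split; [|split].
- now apply D.
- eapply is_derive_val. apply (is_derive_opp (V := R_NormedModule)). apply D. now apply CV1_derive.
  unfold opp; simpl. ring.
- pose proof (ps_ode g a b c Hg (fun n => gcoef_rec a b c n Hc) (- x) Hx') as E. lra.
Qed.

(* Pfaff's transformation of Gauss's series at [w = - x]; it converges for [- 1 / 2 < x]. *)
Definition pfaff (a b c x : R) : R := Rpower (1 + x) (- a) * PSeries (gcoef a (c - b) c) (x / (1 + x)).

(** Up to the factor [(1 + x)^(- a - 1)] the left-hand side is that of [ps_ode] with [c - b] for
    [b], at [x / (1 + x)]. The bound on [x] says that this point has modulus below 1. *)
Lemma pfaff_ode a b c x : 0 < c -> - 1 / 2 < x ->
  hyp_ode a b c (pfaff a b c)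
    (fun x => Rpower (1 + x) (- a) * (- a * PSeries (gcoef a (c - b) c) (x / (1 + x)) / (1 + x)
       + PSeries (PS_derive (gcoef a (c - b) c)) (x / (1 + x)) / (1 + x) ^ 2))
    (fun x => Rpower (1 + x) (- a) * (a * (a + 1) * PSeries (gcoef a (c - b) c) (x / (1 + x)) / (1 + x) ^ 2
       - (2 * a + 2) * PSeries (PS_derive (gcoef a (c - b) c)) (x / (1 + x)) / (1 + x) ^ 3
       + PSeries (PS_derive (PS_derive (gcoef a (c - b) c))) (x / (1 + x)) / (1 + x) ^ 4)) x.
Proof.
intros Hc Hx. set (g := gcoef a (c - b) c). assert (Hg : CV1 g) by now apply gcoef_CV1.
assert (Hz : Rabs (x / (1 + x)) < 1).
{ unfold Rdiv. rewrite Rabs_mult, Rabs_inv, (Rabs_pos_eq (1 + x)) by lra.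
  apply Rmult_lt_reg_r with (1 + x). lra. rewrite Rmult_assoc, Rinv_l by lra.
  unfold Rabs; destruct Rcase_abs; lra. }
assert (D : forall h, CV1 h -> is_derive (fun x => PSeries h (x / (1 + x))) x (PSeries (PS_derive h) (x / (1 + x)) / (1 + x) ^ 2)).
{ intros h Hh. eapply is_derive_val. apply (is_derive_comp (PSeries h) (fun x => x / (1 + x))).
  apply is_derive_PSeries. now apply CV1_Rbar. auto_derive. lra. reflexivity.
  unfold scal; simpl; unfold mult; simpl. field. lra. }
assert (DR : is_derive (fun x => Rpower (1 + x) (- a)) x (- a * Rpower (1 + x) (- a) / (1 + x))).
{ unfold Rpower. eapply is_derive_val. auto_derive. 2: reflexivity. lra. field. lra. }
pose proof (D g Hg) as D0. pose proof (D _ (CV1_derive g Hg)) as D1.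
set (Rp := fun x => Rpower (1 + x) (- a)) in *.
set (P0 := fun x => PSeries g (x / (1 + x))) in *.
set (P1 := fun x => PSeries (PS_derive g) (x / (1 + x))) in *.
set (P2 := fun x => PSeries (PS_derive (PS_derive g)) (x / (1 + x))) in *.
assert (e0 : ex_derive Rp x) by (eexists; exact DR).
assert (e1 : ex_derive P0 x) by (eexists; exact D0).
assert (e2 : ex_derive P1 x) by (eexists; exact D1).
change (is_derive P0 x (P1 x / (1 + x) ^ 2)) in D0. change (is_derive P1 x (P2 x / (1 + x) ^ 2)) in D1.
change (is_derive Rp x (- a * Rp x / (1 + x))) in DR.
assert (d0 : Derive (fun x : R => Rp x) x = - a * Rp x / (1 + x)) by exact (is_derive_unique _ _ _ DR).
assert (d1 : Derive (fun x : R => P0 x) x = P1 x / (1 + x) ^ 2) by exact (is_derive_unique _ _ _ D0).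
assert (d2 : Derive (fun x : R => P1 x) x = P2 x / (1 + x) ^ 2) by exact (is_derive_unique _ _ _ D1).
split; [|split].
- apply is_derive_ext with (fun x => Rp x * P0 x). reflexivity.
  eapply is_derive_val. auto_derive. repeat split; auto. reflexivity.
  rewrite d0, d1. unfold Rp, P0, P1. field. lra.
- apply is_derive_ext with (fun x => Rp x * (- a * P0 x / (1 + x) + P1 x / (1 + x) ^ 2)). reflexivity.
  eapply is_derive_val. auto_derive. repeat split; auto; try lra. simpl. nra. reflexivity.
  rewrite d0, d1, d2. fold (P0 x) (P1 x) (P2 x) (Rp x). field. lra.
- pose proof (ps_ode g a (c - b) c Hg (fun n => gcoef_rec a (c - b) c n Hc) (x / (1 + x)) Hz) as E.
  unfold pfaff. fold g. fold (P0 x) (P1 x) (P2 x) (Rp x) in *.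
  replace (x * (1 + x) * _ + _ + _) with (Rp x * / (1 + x) *
    (x / (1 + x) * (1 - x / (1 + x)) * P2 x + (c - (a + (c - b) + 1) * (x / (1 + x))) * P1 x - a * (c - b) * P0 x)).
  rewrite E. ring. field. lra.
Qed.

Section Eta.
Variable al : R.

(** In [x = t^2] the origin is a singular point with exponents 0 and 1/2. The solution with exponent
    0 becomes even in [t], and the factor [1 + t^2] brings the equation to a form without
    first-order term or singularity. *)
Lemma eta_even (y y1 y2 : R -> R) t : hyp_ode (1 / 2 + al / 2) (1 - al / 2) (1 / 2) y y1 y2 (t ^ 2) ->
  is_derive (fun t => (1 + t ^ 2) * y (t ^ 2)) t (2 * t * (y (t ^ 2) + (1 + t ^ 2) * y1 (t ^ 2))) /\
  is_derive (fun t => 2 * t * (y (t ^ 2) + (1 + t ^ 2) * y1 (t ^ 2))) t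
    (al * (al - 1) / (1 + t ^ 2) * ((1 + t ^ 2) * y (t ^ 2))).
Proof.
intros (D0 & D1 & E).
assert (S : is_derive (fun t => t ^ 2) t (2 * t)). { eapply is_derive_val. auto_derive. easy. reflexivity. ring. }
assert (C0 : is_derive (fun t => y (t ^ 2)) t (2 * t * y1 (t ^ 2))) by exact (is_derive_comp y (fun t => t ^ 2) t _ _ D0 S).
assert (C1 : is_derive (fun t => y1 (t ^ 2)) t (2 * t * y2 (t ^ 2))) by exact (is_derive_comp y1 (fun t => t ^ 2) t _ _ D1 S).
set (Y := fun t => y (t ^ 2)) in *. set (Y1 := fun t => y1 (t ^ 2)) in *.
assert (e0 : ex_derive Y t) by (eexists; exact C0). assert (e1 : ex_derive Y1 t) by (eexists; exact C1).
assert (d0 : Derive (fun x : R => Y x) t = 2 * t * y1 (t ^ 2)) by exact (is_derive_unique _ _ _ C0).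
assert (d1 : Derive (fun x : R => Y1 x) t = 2 * t * y2 (t ^ 2)) by exact (is_derive_unique _ _ _ C1).
split.
- apply is_derive_ext with (fun t => (1 + t ^ 2) * Y t). reflexivity.
  eapply is_derive_val. auto_derive. repeat split; auto. reflexivity. rewrite d0. unfold Y. ring.
- apply is_derive_ext with (fun t => 2 * t * (Y t + (1 + t ^ 2) * Y1 t)). reflexivity.
  eapply is_derive_val. auto_derive. repeat split; auto. reflexivity. rewrite d0, d1. unfold Y, Y1.
  set (x := t ^ 2) in *. apply Rminus_diag_uniq.
  transitivity (4 * (x * (1 + x) * y2 x + (1 / 2 + (1 / 2 + al / 2 + (1 - al / 2) + 1) * x) * y1 x + (1 / 2 + al / 2) * (1 - al / 2) * y x)).
  + unfold x. field. nra.
  + rewrite E. ring.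
Qed.

(** The solution with exponent 1/2: its parameters are [a + 1 - c], [b + 1 - c] and [2 - c] for
    those of [eta_even], and [x^(1 / 2)] becomes the factor [t]. It leads to the same equation. *)
Lemma eta_odd (y y1 y2 : R -> R) t : hyp_ode (1 + al / 2) (3 / 2 - al / 2) (3 / 2) y y1 y2 (t ^ 2) ->
  is_derive (fun t => t * (1 + t ^ 2) * y (t ^ 2)) t ((1 + 3 * t ^ 2) * y (t ^ 2) + 2 * t ^ 2 * (1 + t ^ 2) * y1 (t ^ 2)) /\
  is_derive (fun t => (1 + 3 * t ^ 2) * y (t ^ 2) + 2 * t ^ 2 * (1 + t ^ 2) * y1 (t ^ 2)) t
    (al * (al - 1) / (1 + t ^ 2) * (t * (1 + t ^ 2) * y (t ^ 2))).
Proof.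
intros (D0 & D1 & E).
assert (S : is_derive (fun t => t ^ 2) t (2 * t)). { eapply is_derive_val. auto_derive. easy. reflexivity. ring. }
assert (C0 : is_derive (fun t => y (t ^ 2)) t (2 * t * y1 (t ^ 2))) by exact (is_derive_comp y (fun t => t ^ 2) t _ _ D0 S).
assert (C1 : is_derive (fun t => y1 (t ^ 2)) t (2 * t * y2 (t ^ 2))) by exact (is_derive_comp y1 (fun t => t ^ 2) t _ _ D1 S).
set (Y := fun t => y (t ^ 2)) in *. set (Y1 := fun t => y1 (t ^ 2)) in *.
assert (e0 : ex_derive Y t) by (eexists; exact C0). assert (e1 : ex_derive Y1 t) by (eexists; exact C1).
assert (d0 : Derive (fun x : R => Y x) t = 2 * t * y1 (t ^ 2)) by exact (is_derive_unique _ _ _ C0).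
assert (d1 : Derive (fun x : R => Y1 x) t = 2 * t * y2 (t ^ 2)) by exact (is_derive_unique _ _ _ C1).
split.
- apply is_derive_ext with (fun t => t * (1 + t ^ 2) * Y t). reflexivity.
  eapply is_derive_val. auto_derive. repeat split; auto. reflexivity. rewrite d0. unfold Y. ring.
- apply is_derive_ext with (fun t => (1 + 3 * t ^ 2) * Y t + 2 * t ^ 2 * (1 + t ^ 2) * Y1 t). reflexivity.
  eapply is_derive_val. auto_derive. repeat split; auto. reflexivity. rewrite d0, d1. unfold Y, Y1.
  set (x := t ^ 2) in *. apply Rminus_diag_uniq.
  transitivity (4 * t * (x * (1 + x) * y2 x + (3 / 2 + (1 + al / 2 + (3 / 2 - al / 2) + 1) * x) * y1 x + (1 + al / 2) * (3 / 2 - al / 2) * y x)).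
  + unfold x. field. nra.
  + rewrite E. ring.
Qed.
End Eta.

(* Gronwall for the energy [d ^ 2 + d1 ^ 2]. *)
Lemma ode_unique (d d1 q : R -> R) Q T : 0 <= Q ->
  (forall t, 0 <= t < T -> is_derive d t (d1 t) /\ is_derive d1 t (q t * d t) /\ Rabs (q t) <= Q) ->
  d 0 = 0 -> d1 0 = 0 -> forall t, 0 <= t < T -> d t = 0.
Proof.
intros HQ H d00 d10 t Ht. destruct (Req_dec t 0) as [->|Ht0]; auto.
(* The rate [1 + Q] suffices because [2 d d1 (1 + q) <= (1 + Q) (d^2 + d1^2)]. *)
set (E := fun t => (d t * d t + d1 t * d1 t) * exp (- ((1 + Q) * t))).
assert (DE : forall s, 0 <= s < T -> exists e', is_derive E s e' /\ e' <= 0).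
{ intros s Hs. destruct (H s Hs) as (D0 & D1 & Hq).
  assert (e0 : ex_derive d s) by (eexists; exact D0). assert (e1 : ex_derive d1 s) by (eexists; exact D1).
  assert (f0 : Derive (fun x : R => d x) s = d1 s) by exact (is_derive_unique _ _ _ D0).
  assert (f1 : Derive (fun x : R => d1 x) s = q s * d s) by exact (is_derive_unique _ _ _ D1).
  eexists. split. unfold E. auto_derive. repeat split; auto. reflexivity.
  rewrite f0, f1. set (e := exp _). assert (0 < e) by apply exp_pos.
  replace (_ + _) with (e * (2 * (d s * d1 s) * (1 + q s) - (1 + Q) * (d s * d s + d1 s * d1 s))) by ring.
  assert (2 * (d s * d1 s) * (1 + q s) <= (1 + Q) * (d s * d s + d1 s * d1 s)).
  { apply Rabs_le_between in Hq.
    assert (h1 := Rle_0_sqr (d s + d1 s)). assert (h2 := Rle_0_sqr (d s - d1 s)). unfold Rsqr in *.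
    set (X := d s * d s + d1 s * d1 s) in *. set (Y := 2 * (d s * d1 s)).
    assert (- X <= Y <= X) by (unfold X, Y; lra). assert (0 <= X) by lra.
    destruct (Rle_dec 0 (1 + q s)).
    - apply Rle_trans with (X * (1 + q s)). apply Rmult_le_compat_r; lra.
      rewrite Rmult_comm. apply Rmult_le_compat_r; lra.
    - apply Rle_trans with (X * (- (1 + q s))).
      + replace (Y * (1 + q s)) with (- Y * (- (1 + q s))) by ring. apply Rmult_le_compat_r; lra.
      + rewrite Rmult_comm. apply Rmult_le_compat_r; lra. }
  nra. }
assert (Ed : E t <= E 0).
(* The mean value theorem takes the derivative as a function; it is obtained by choice on [[0, T)],
   with an arbitrary value outside. *)
{ set (E' := fun s => proj1_sig (constructive_indefinite_description (fun v => 0 <= s < T -> is_derive E s v /\ v <= 0)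
     ltac:(destruct (excluded_middle_informative (0 <= s < T)) as [h|h]; [destruct (DE s h) as [v Hv]; exists v; auto|exists 0; tauto]))).
  assert (HE : forall s, 0 <= s < T -> is_derive E s (E' s) /\ E' s <= 0).
  { intros s. unfold E'. destruct constructive_indefinite_description. assumption. }
  destruct (MVT_gen E 0 t E') as (c & Hc & Ec).
  - rewrite Rmin_left, Rmax_right by lra. intros x Hx. apply HE; lra.
  - rewrite Rmin_left, Rmax_right by lra. intros x Hx. apply continuity_pt_filterlim.
    exact (is_derive_cont _ _ _ (proj1 (HE x ltac:(lra)))).
  - rewrite Rmin_left, Rmax_right in Hc by lra. destruct (HE c ltac:(lra)). nra. }
unfold E in Ed. rewrite d00, d10 in Ed. set (e := exp (- ((1 + Q) * t))) in *.
assert (He : 0 < e) by apply exp_pos.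
assert (Hsum : d t * d t + d1 t * d1 t <= 0) by (apply Rmult_le_reg_r with e; lra).
apply Rsqr_0_uniq. unfold Rsqr. pose proof (Rle_0_sqr (d t)). pose proof (Rle_0_sqr (d1 t)). unfold Rsqr in *. lra.
Qed.

Lemma sq_lt_1 t : 0 <= t < 1 -> Rabs (t ^ 2) < 1 /\ - 1 / 2 < t ^ 2.
Proof. intros Ht. rewrite Rabs_pos_eq by nra. nra. Qed.

Lemma PSeries_gcoef_0 a b c : PSeries (gcoef a b c) 0 = 1.
Proof. rewrite PSeries_0. apply gcoef_0. Qed.

Lemma pfaff_0 a b c : pfaff a b c 0 = 1.
Proof.
unfold pfaff. replace (0 / (1 + 0)) with 0 by field. rewrite PSeries_gcoef_0, Rplus_0_r.
unfold Rpower. rewrite ln_1, Rmult_0_r, exp_0. ring.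
Qed.

Lemma q_bound al t : 1 <= al -> Rabs (al * (al - 1) / (1 + t ^ 2)) <= al * (al - 1).
Proof.
intros Hal. assert (0 <= al * (al - 1)) by nra.
rewrite Rabs_pos_eq by (apply Rdiv_le_0_compat; nra).
apply Rmult_le_reg_r with (1 + t ^ 2). nra. unfold Rdiv. rewrite Rmult_assoc, Rinv_l by nra. nra.
Qed.

Lemma is_derive_minus_R (f g : R -> R) t df dg : is_derive f t df -> is_derive g t dg -> is_derive (fun s => f s - g s) t (df - dg).
Proof. exact (is_derive_minus (V := R_NormedModule) f g t df dg). Qed.

(** On [0 <= x < 1] both series converge. With [x = t^2], both sides times [1 + t^2] solve the
    equation of [eta_even] with value 1 and slope 0 at [t = 0]. *)
Lemma gauss_pfaff_even al x : 1 <= al -> 0 <= x < 1 ->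
  PSeries (gcoef (1 / 2 + al / 2) (1 - al / 2) (1 / 2)) (- x) = pfaff (1 / 2 + al / 2) (1 - al / 2) (1 / 2) x.
Proof.
intros Hal Hx. assert (HQ : 0 <= al * (al - 1)) by nra. set (t := sqrt x).
assert (Et : x = t ^ 2) by (unfold t; rewrite <- Rsqr_pow2, Rsqr_sqrt; lra).
assert (Ht : 0 <= t < 1). { unfold t. split. apply sqrt_pos. rewrite <- sqrt_1. apply sqrt_lt_1_alt; lra. }
assert (U := ode_unique (fun t => (1 + t ^ 2) * PSeries (gcoef (1 / 2 + al / 2) (1 - al / 2) (1 / 2)) (- t ^ 2) - (1 + t ^ 2) * pfaff (1 / 2 + al / 2) (1 - al / 2) (1 / 2) (t ^ 2))
  _ (fun t => al * (al - 1) / (1 + t ^ 2)) (al * (al - 1)) 1 HQ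
  (fun s Hs => let (h1, h2) := sq_lt_1 s Hs in
    let (A, A') := eta_even al _ _ _ s (gauss_ode (1 / 2 + al / 2) (1 - al / 2) (1 / 2) (s ^ 2) ltac:(lra) h1) in
    let (B, B') := eta_even al _ _ _ s (pfaff_ode (1 / 2 + al / 2) (1 - al / 2) (1 / 2) (s ^ 2) ltac:(lra) h2) in
    conj (is_derive_minus_R _ _ _ _ _ A B)
      (conj (is_derive_val _ _ _ _ (is_derive_minus_R _ _ _ _ _ A' B') (eq_sym (Rmult_minus_distr_l _ _ _))) (q_bound al s Hal)))).
specialize (U ltac:(cbv beta; replace (0 ^ 2) with 0 by ring; rewrite Ropp_0, pfaff_0, PSeries_gcoef_0; ring) ltac:(cbv beta; ring) t Ht).
cbv beta in U. rewrite <- Et in U. apply Rmult_eq_reg_l with (1 + x). lra. lra.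
Qed.

Lemma gauss_pfaff_odd al x : 1 <= al -> 0 <= x < 1 ->
  PSeries (gcoef (1 + al / 2) (3 / 2 - al / 2) (3 / 2)) (- x) = pfaff (1 + al / 2) (3 / 2 - al / 2) (3 / 2) x.
Proof.
(* The odd solution carries a factor [t], which cannot be cancelled at 0. *)
intros Hal Hx. destruct (Req_dec x 0) as [->|Hx0].
{ rewrite Ropp_0, pfaff_0, PSeries_gcoef_0. reflexivity. }
assert (HQ : 0 <= al * (al - 1)) by nra. set (t := sqrt x).
assert (Et : x = t ^ 2) by (unfold t; rewrite <- Rsqr_pow2, Rsqr_sqrt; lra).
assert (Ht : 0 < t < 1). { unfold t. split. apply sqrt_lt_R0; lra. rewrite <- sqrt_1. apply sqrt_lt_1_alt; lra. }
assert (U := ode_unique (fun t => t * (1 + t ^ 2) * PSeries (gcoef (1 + al / 2) (3 / 2 - al / 2) (3 / 2)) (- t ^ 2) - t * (1 + t ^ 2) * pfaff (1 + al / 2) (3 / 2 - al / 2) (3 / 2) (t ^ 2))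
  _ (fun t => al * (al - 1) / (1 + t ^ 2)) (al * (al - 1)) 1 HQ
  (fun s Hs => let (h1, h2) := sq_lt_1 s Hs in
    let (A, A') := eta_odd al _ _ _ s (gauss_ode (1 + al / 2) (3 / 2 - al / 2) (3 / 2) (s ^ 2) ltac:(lra) h1) in
    let (B, B') := eta_odd al _ _ _ s (pfaff_ode (1 + al / 2) (3 / 2 - al / 2) (3 / 2) (s ^ 2) ltac:(lra) h2) in
    conj (is_derive_minus_R _ _ _ _ _ A B)
      (conj (is_derive_val _ _ _ _ (is_derive_minus_R _ _ _ _ _ A' B') (eq_sym (Rmult_minus_distr_l _ _ _))) (q_bound al s Hal)))).
specialize (U ltac:(cbv beta; ring) ltac:(cbv beta; replace (0 ^ 2) with 0 by ring; rewrite Ropp_0, pfaff_0, PSeries_gcoef_0; ring) t ltac:(lra)).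
cbv beta in U. rewrite <- Et in U. apply Rmult_eq_reg_l with (t * (1 + x)). lra. nra.
Qed.

(** * The hypergeometric function on the negative half-line *)

Lemma Ccont_id (w : C) : Ccont (T := C_UniformSpace) (fun u => u) w.
Proof.
destruct w as [x y]. split.
- exact (continuous_fst (U := R_UniformSpace) (V := R_UniformSpace) x y).
- exact (continuous_snd (U := R_UniformSpace) (V := R_UniformSpace) x y).
Qed.

Lemma half_plane_star w r : Re w < 1 / 2 -> 0 <= r <= 1 -> Re (r * w)%C < 1 / 2.
Proof. intros Hw Hr. rewrite Re_scal. destruct (Rle_dec 0 (Re w)); nra. Qed.

(** The Möbius map that carries the half-plane [Re w < 1 / 2] onto the unit disc, since there [w] is
    nearer to 0 than to 1. *)
Definition zeta (w : C) : C := (w / (w - 1))%C.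
Definition Fpfaff (a b c : R) (w : C) : C := (Cpower (1 - w) (- a) * CSum (gcoef a (c - b) c) (zeta w))%C.
Definition Fpfaff' (a b c : R) (w : C) : C :=
  ((RtoC (- a) * Cpower (1 - w) (- a) / (1 - w) * (- (1))) * CSum (gcoef a (c - b) c) (zeta w)
   + Cpower (1 - w) (- a) * (CSum (PS_derive (gcoef a (c - b) c)) (zeta w) * (- (1) / ((w - 1) * (w - 1)))))%C.

Lemma half_plane_facts w : Re w < 1 / 2 -> slit (1 - w) /\ (w - 1)%C <> 0%C /\ Cmod (zeta w) < 1.
Proof.
intros H.
assert (Hn : (w - 1)%C <> 0%C). { intros E. apply (f_equal Re) in E. unfold Re in *; simpl in E. lra. }
split; [|split]; auto.
- left. unfold Re in *; simpl. lra.
- unfold zeta, Cdiv. rewrite Cmod_mult, Cmod_inv by assumption.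
  assert (Hp := proj1 (Cmod_gt_0 _) Hn). apply Rmult_lt_reg_r with (Cmod (w - 1)%C). exact Hp.
  rewrite Rmult_assoc, Rinv_l, Rmult_1_r, Rmult_1_l by lra.
  apply Rsqr_incrst_0; try apply Cmod_ge_0. unfold Rsqr. rewrite !Cmod_sqr. unfold Re, Im in *; simpl. nra.
Qed.

Lemma zeta_holo w : (w - 1)%C <> 0%C -> is_holo zeta w (- (1) / ((w - 1) * (w - 1)))%C.
Proof.
intros H. eapply is_holo_val.
- apply (is_holo_mult (fun u => u) (fun u => / (u - 1))%C). apply is_holo_id.
  apply (is_holo_comp Cinv (fun u => u - 1)%C). apply is_holo_minus. apply is_holo_id. apply is_holo_const.
  now apply is_holo_inv.
- cbv beta. field. exact H.
Qed.

Lemma Ccont_zeta w : (w - 1)%C <> 0%C -> Ccont (T := C_UniformSpace) zeta w.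
Proof.
intros H. apply (Ccont_div (T := C_UniformSpace) (fun u => u) (fun u => u - 1)%C); auto.
apply Ccont_id. apply Ccont_minus. apply Ccont_id. apply Ccont_const.
Qed.

Lemma Fpfaff_holo a b c w : 0 < c -> Re w < 1 / 2 ->
  is_holo (Fpfaff a b c) w (Fpfaff' a b c w) /\ Ccont (T := C_UniformSpace) (Fpfaff' a b c) w /\
  Ccont (T := C_UniformSpace) (Fpfaff a b c) w.
Proof.
intros Hc Hw. destruct (half_plane_facts w Hw) as (H1 & H2 & H3).
set (g := gcoef a (c - b) c). assert (Hg : CV1 g) by now apply gcoef_CV1.
destruct (CSum_holo g (zeta w) Hg H3) as [S1 S2].
destruct (CSum_holo _ (zeta w) (CV1_derive g Hg) H3) as [_ S3].
assert (C1w : Ccont (T := C_UniformSpace) (fun u => 1 - u)%C w).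
{ apply Ccont_minus. apply Ccont_const. apply Ccont_id. }
assert (Cw1 : Ccont (T := C_UniformSpace) (fun u => u - 1)%C w).
{ apply Ccont_minus. apply Ccont_id. apply Ccont_const. }
assert (Cp : Ccont (T := C_UniformSpace) (fun u => Cpower (1 - u) (- a)) w).
{ apply (Ccont_power (fun u => 1 - u)%C); auto. }
assert (CS : Ccont (T := C_UniformSpace) (fun u => CSum g (zeta u)) w).
{ apply (Ccont_comp (CSum g) zeta); auto. now apply Ccont_zeta. }
assert (CS' : Ccont (T := C_UniformSpace) (fun u => CSum (PS_derive g) (zeta u)) w).
{ apply (Ccont_comp (CSum (PS_derive g)) zeta); auto. now apply Ccont_zeta. }
split; [|split].
- eapply is_holo_val. 
  + apply (is_holo_mult (fun u => Cpower (1 - u) (- a)) (fun u => CSum g (zeta u))).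
    * apply (is_holo_comp (fun u => Cpower u (- a)) (fun u => 1 - u)%C).
      apply is_holo_minus. apply is_holo_const. apply is_holo_id. now apply Cpower_holo.
    * apply (is_holo_comp (CSum g) zeta). now apply zeta_holo. exact S1.
  + unfold Fpfaff'. fold g. cbv beta. f_equal. f_equal. f_equal. ring.
- apply Ccont_plus.
  + apply Ccont_mult; [|exact CS]. apply Ccont_mult; [|apply Ccont_const].
    apply (Ccont_div (fun u => RtoC (- a) * Cpower (1 - u) (- a))%C (fun u => 1 - u)%C); auto.
    apply Ccont_mult; [apply Ccont_const|exact Cp]. now apply slit_neq_0.
  + apply Ccont_mult. exact Cp. apply Ccont_mult. exact CS'.
    apply (Ccont_div (fun _ => - (1))%C (fun u => (u - 1) * (u - 1))%C). apply Ccont_const.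
    now apply Ccont_mult. now apply Cmult_neq_0.
- now apply Ccont_mult.
Qed.

Lemma Fpfaff_analytic a b c w : 0 < c -> Re w < 1 / 2 -> analytic_at (Fpfaff a b c) w.
Proof.
intros Hc Hw. apply (holo_analytic _ (Fpfaff' a b c) w ((1 / 2 - Re w) / 2)). lra.
intros u Hu. apply Fpfaff_holo; auto.
assert (Rabs (Re (u - w)%C) <= Cmod (u - w)%C) by (apply Rle_trans with (2 := Rmax_Cmod _); apply Rmax_l).
assert (Re (u - w)%C <= Rabs (Re (u - w)%C)) by apply Rle_abs.
replace (Re (u - w)%C) with (Re u - Re w) in * by (unfold Re; simpl; ring). lra.
Qed.

Lemma Fpfaff_real a b c x : - 1 / 2 < x -> Fpfaff a b c (RtoC (- x)) = pfaff a b c x.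
Proof.
intros Hx. unfold Fpfaff, pfaff, zeta.
replace (1 - RtoC (- x))%C with (RtoC (1 + x)) by (apply C_eq; unfold Re, Im; simpl; ring).
replace (RtoC (- x) / (RtoC (- x) - 1))%C with (RtoC (x / (1 + x))).
- rewrite CSum_R, RtoC_mult. f_equal.
  replace (RtoC (1 + x)) with (polar (1 + x) 0) by (unfold polar; rewrite cos_0, sin_0; apply C_eq; unfold Re, Im; simpl; ring).
  pose proof PI_RGT_0. rewrite Cpower_polar by lra. rewrite Rmult_0_r. unfold polar. rewrite cos_0, sin_0.
  apply C_eq; unfold Re, Im; simpl; ring.
- rewrite <- RtoC_minus, <- RtoC_div by lra. f_equal. field. lra.
Qed.

(** Agreement on a piece of the negative axis gives agreement on a disc around 0, by
    [analytic_zero_ray]. The half-disc where both functions are analytic contains the segment from 0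
    to [w], along which the identity theorem extends it. *)
Lemma gauss_series_pfaff a b c w : 0 < c ->
  (forall x, 0 <= x < 1 -> PSeries (gcoef a b c) (- x) = pfaff a b c x) ->
  Re w < 1 / 2 -> Cmod w < 1 -> Fpfaff a b c w = CSum (gcoef a b c) w.
Proof.
intros Hc Hgp Hw Hw1.
assert (Hg : CV1 (gcoef a b c)) by now apply gcoef_CV1.
set (G := fun u => (Fpfaff a b c u - CSum (gcoef a b c) u)%C).
assert (HA : forall u, Re u < 1 / 2 -> Cmod u < 1 -> analytic_at G u).
{ intros u H1 H2. apply analytic_minus. now apply Fpfaff_analytic. now apply CSum_analytic. }
destruct (analytic_zero_ray G 0 (RtoC (-1)) (1 / 2)) as (r & Hr & HG).
- apply HA. simpl; lra. rewrite Cmod_0; lra.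
- intros E. apply (f_equal Re) in E. simpl in E; lra.
- lra.
- intros d Hd. replace (0 + d * RtoC (-1))%C with (RtoC (- d)) by (apply C_eq; unfold Re, Im; simpl; ring).
  unfold G. rewrite Fpfaff_real, CSum_R, Hgp by lra. ring.
- pose proof (Cmod_ge_0 w) as Hw0.
  assert (GZ : G w = 0%C).
  { apply (identity_segment G w (r / (1 + Cmod w))).
    - apply Rdiv_lt_0_compat; lra.
    - intros p Hp. apply HA.
      + now apply half_plane_star.
      + rewrite Cmod_mult, Cmod_R, Rabs_pos_eq by lra. nra.
    - intros p Hp Hpr. replace (p * w)%C with (0 + p * w)%C by ring. apply HG.
      rewrite Cmod_mult, Cmod_R, Rabs_pos_eq by lra.
      apply Rle_lt_trans with (p * (1 + Cmod w)). nra.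
      apply Rmult_lt_reg_r with (/ (1 + Cmod w)). apply Rinv_0_lt_compat; lra.
      replace (p * (1 + Cmod w) * / (1 + Cmod w)) with p by (field; lra). exact Hpr. }
  unfold G in GZ. replace (Fpfaff a b c w) with (Fpfaff a b c w - CSum (gcoef a b c) w + CSum (gcoef a b c) w)%C by ring.
  rewrite GZ. ring.
Qed.

(** The half-plane [Re w < 1 / 2] serves as neighbourhood: star-shaped about 0, disjoint from the
    cut, and containing all nonpositive reals. *)
Lemma is_hyp2F1_pfaff a b c x : 0 < c ->
  (forall x, 0 <= x < 1 -> PSeries (gcoef a b c) (- x) = pfaff a b c x) ->
  0 <= x -> is_hyp2F1 a b c (RtoC (- x)) (RtoC (pfaff a b c x)).
Proof.
intros Hc Hgp Hx.
exists (fun w => Re w < 1 / 2), (Fpfaff a b c). repeat split.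
- intros w Hw. apply (locally_lt (T := C_UniformSpace) (fun u => Re u) w). exact (proj1 (Ccont_id w)). exact Hw.
- intros w Hw [_ H]. lra.
- intros w r Hw Hr. now apply half_plane_star.
- intros w Hw. now apply Fpfaff_analytic.
- intros w Hw Hw1. rewrite gauss_series_pfaff by assumption. apply CSum_correct; auto. now apply gcoef_CV1.
- simpl; lra.
- apply Fpfaff_real; lra.
Qed.

(** Both neighbourhoods are star-shaped, so both contain the segment from 0 to [w]. Near 0 both
    functions sum Gauss's series; [identity_segment] carries the equality to [w]. *)
Lemma is_hyp2F1_unique a b c w v1 v2 : is_hyp2F1 a b c w v1 -> is_hyp2F1 a b c w v2 -> v1 = v2.
Proof.
intros (U & F & _ & _ & U3 & U4 & U5 & U6 & <-) (V & G & _ & _ & V3 & V4 & V5 & V6 & <-).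
pose proof (Cmod_ge_0 w) as Hw0.
assert (Z : (F w - G w)%C = 0%C).
{ apply (identity_segment (fun u => F u - G u)%C w (/ (1 + Cmod w))).
  - apply Rinv_0_lt_compat; lra.
  - intros r Hr. apply analytic_minus; auto.
  - intros r Hr Hr'.
    assert (Hm : Cmod (r * w)%C < 1).
    { rewrite Cmod_mult, Cmod_R, Rabs_pos_eq by lra. apply Rle_lt_trans with (r * (1 + Cmod w)). nra.
      apply Rmult_lt_reg_r with (/ (1 + Cmod w)). apply Rinv_0_lt_compat; lra.
      replace (r * (1 + Cmod w) * / (1 + Cmod w)) with r by (field; lra). lra. }
    replace (F (r * w)%C) with (G (r * w)%C). ring.
    apply (is_Cpseries_unique (gauss_coef a b c) (r * w)%C); auto. }
replace (F w) with (F w - G w + G w)%C by ring. rewrite Z. ring.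
Qed.

Lemma hyp2F1_pfaff a b c x : 0 < c ->
  (forall x, 0 <= x < 1 -> PSeries (gcoef a b c) (- x) = pfaff a b c x) ->
  0 <= x -> hyp2F1 a b c (RtoC (- x)) = RtoC (pfaff a b c x).
Proof.
intros Hc Hgp Hx. apply (iota_unique (V := C_CompleteNormedModule)).
- intros v Hv. apply (is_hyp2F1_unique a b c (RtoC (- x))). exact Hv. now apply is_hyp2F1_pfaff.
- now apply is_hyp2F1_pfaff.
Qed.

(** * Identification of [S] with the limit density *)

Definition kconst (al : R) : R :=
  2 * Gamma (1 + al / 2) * Gamma (al / 2) / (Gamma (1 / 2 + al / 2) * Gamma (- (1 / 2) + al / 2)).

Definition heven (al t : R) : R := (1 + t ^ 2) * pfaff (1 / 2 + al / 2) (1 - al / 2) (1 / 2) (t ^ 2).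
Definition hodd (al t : R) : R := t * (1 + t ^ 2) * pfaff (1 + al / 2) (3 / 2 - al / 2) (3 / 2) (t ^ 2).

Lemma S_fun_real al t : 1 <= al ->
  S_fun al t = RtoC (Rpower (1 + t ^ 2) (- al) * (heven al t - kconst al * hodd al t)).
Proof.
intros Hal. assert (Ht : 0 <= t ^ 2) by nra.
unfold S_fun. 
rewrite !hyp2F1_pfaff; try lra; auto using gauss_pfaff_even, gauss_pfaff_odd.
rewrite <- RtoC_mult, <- RtoC_minus, <- RtoC_mult. f_equal.
replace (Rpower (1 + t ^ 2) (1 - al)) with (Rpower (1 + t ^ 2) (- al) * (1 + t ^ 2)).
2:{ rewrite <- (Rpower_1 (1 + t ^ 2)) at 2 by lra. rewrite <- Rpower_plus. f_equal. ring. }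
unfold heven, hodd, kconst, Rdiv. ring.
Qed.

(** The constant in [S] is minus the logarithmic derivative of [Kfun] at 0, namely [al] times the
    quotient of the Wallis integrals of exponents [al - 1] and [al - 2]. *)
Lemma kconst_K al : 2 <= al -> Kfun' al 0 = - kconst al * Kfun al 0 /\ 0 < Kfun al 0 /\
  Kfun al 0 = Rpower 2 al * (sqrt PI / 2 * Gamma ((al - 1) / 2) / Gamma (al / 2)).
Proof.
intros Hal.
assert (P2 := Rpower_pos 2 al). pose proof PI_RGT_0. assert (Ps : 0 < sqrt PI) by now apply sqrt_lt_R0.
pose proof (Gamma_pos ((al - 1) / 2) ltac:(lra)). pose proof (Gamma_pos (al / 2) ltac:(lra)).
pose proof (Gamma_pos (1 / 2 + al / 2) ltac:(lra)).
assert (E0 : Kfun al 0 = Rpower 2 al * (sqrt PI / 2 * Gamma ((al - 1) / 2) / Gamma (al / 2))).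
{ rewrite Kfun_0, wallis_value by lra. 
  replace ((al - 2 + 1) / 2) with ((al - 1) / 2) by field. replace ((al - 2) / 2 + 1) with (al / 2) by field. reflexivity. }
split; [|split]; auto.
- rewrite E0, Kfun'_0, wallis_value by lra. unfold kconst.
  replace ((al - 1 + 1) / 2) with (al / 2) by field. replace ((al - 1) / 2 + 1) with (1 / 2 + al / 2) by field.
  replace (- (1 / 2) + al / 2) with ((al - 1) / 2) by field.
  rewrite (Rplus_comm 1 (al / 2)), Gamma_S by lra. field. lra.
- rewrite E0. repeat apply Rmult_lt_0_compat; try lra. now apply Rinv_0_lt_compat.
Qed.

(** At 0 [heven] has value 1 and slope 0, [hodd] has value 0 and slope 1. So the difference [d] of
    the two sides solves the regular equation with zero initial data, by [kconst_K]. *)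
Lemma hyp_solution_Kfun al t : 2 <= al -> heven al t - kconst al * hodd al t = Kfun al t / Kfun al 0.
Proof.
intros Hal. destruct (kconst_K al Hal) as (EK & PK & _).
set (k := kconst al) in *. set (K0 := Kfun al 0) in *.
pose (y1 := fun a b c x => Rpower (1 + x) (- a) * (- a * PSeries (gcoef a (c - b) c) (x / (1 + x)) / (1 + x)
       + PSeries (PS_derive (gcoef a (c - b) c)) (x / (1 + x)) / (1 + x) ^ 2)).
pose (he1 := fun t => 2 * t * (pfaff (1 / 2 + al / 2) (1 - al / 2) (1 / 2) (t ^ 2) + (1 + t ^ 2) * y1 (1 / 2 + al / 2) (1 - al / 2) (1 / 2) (t ^ 2))).
pose (ho1 := fun t => (1 + 3 * t ^ 2) * pfaff (1 + al / 2) (3 / 2 - al / 2) (3 / 2) (t ^ 2) + 2 * t ^ 2 * (1 + t ^ 2) * y1 (1 + al / 2) (3 / 2 - al / 2) (3 / 2) (t ^ 2)).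
set (q := fun t => al * (al - 1) / (1 + t ^ 2)).
assert (De : forall t, is_derive (heven al) t (he1 t) /\ is_derive he1 t (q t * heven al t)).
{ intros s. apply (eta_even al _ _ _ s (pfaff_ode (1 / 2 + al / 2) (1 - al / 2) (1 / 2) (s ^ 2) ltac:(lra) ltac:(nra))). }
assert (Do : forall t, is_derive (hodd al) t (ho1 t) /\ is_derive ho1 t (q t * hodd al t)).
{ intros s. apply (eta_odd al _ _ _ s (pfaff_ode (1 + al / 2) (3 / 2 - al / 2) (3 / 2) (s ^ 2) ltac:(lra) ltac:(nra))). }
set (d := fun t => heven al t - k * hodd al t - / K0 * Kfun al t).
set (d1 := fun t => he1 t - k * ho1 t - / K0 * Kfun' al t).
assert (Dd : forall t, is_derive d t (d1 t) /\ is_derive d1 t (q t * d t)).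
{ intros s. destruct (De s) as [a1 a2]. destruct (Do s) as [b1 b2]. split.
  - apply is_derive_minus_R. apply is_derive_minus_R. exact a1. exact (is_derive_scal _ _ k _ b1).
    exact (is_derive_scal _ _ (/ K0) _ (is_derive_Kfun al Hal s)).
  - eapply is_derive_val. apply is_derive_minus_R. apply is_derive_minus_R. exact a2. exact (is_derive_scal _ _ k _ b2).
    exact (is_derive_scal _ _ (/ K0) _ (is_derive_Kfun' al Hal s)).
    unfold d, q. ring. }
assert (HQ : 0 <= al * (al - 1)) by nra.
assert (d0 : d 0 = 0).
{ unfold d, heven, hodd. replace (0 ^ 2) with 0 by ring. rewrite !pfaff_0. fold K0. field. lra. }
assert (d10 : d1 0 = 0).
{ unfold d1, he1, ho1. replace (0 ^ 2) with 0 by ring. rewrite !pfaff_0, EK. field. lra. }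
assert (Z : d t = 0).
{ destruct (Rle_dec 0 t) as [Ht|Ht].
  - apply (ode_unique d d1 q (al * (al - 1)) (t + 1)); auto; try lra.
    intros s _. destruct (Dd s) as [D0 D1]. split; [exact D0|split; [exact D1|apply q_bound; lra]].
  (* The equation is invariant under [t -> - t], so the negative side follows by reflection. *)
  - rewrite <- (Ropp_involutive t).
    apply (ode_unique (fun s => d (- s)) (fun s => - d1 (- s)) q (al * (al - 1)) (- t + 1)); try lra.
    + intros s _. destruct (Dd (- s)) as [D0 D1].
      assert (Eq : q (- s) = q s) by (unfold q; replace ((- s) ^ 2) with (s ^ 2) by ring; reflexivity). rewrite Eq in D1.
      assert (No : is_derive (fun s => - s) s (- 1)). { eapply is_derive_val. auto_derive. easy. reflexivity. ring. }
      split; [|split].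
      * eapply is_derive_val. apply (is_derive_comp d (fun s => - s)). exact D0. exact No. 
        unfold scal; simpl; unfold mult; simpl. ring.
      * eapply is_derive_val. apply (is_derive_opp (V := R_NormedModule)). apply (is_derive_comp d1 (fun s => - s)). exact D1. exact No.
        unfold scal, opp; simpl; unfold mult; simpl. ring.
      * apply q_bound; lra.
    + now rewrite Ropp_0.
    + rewrite Ropp_0, d10; ring. }
unfold d in Z. unfold Rdiv. lra.
Qed.

Lemma S_fun_limit_density al t : 2 <= al -> S_fun al t = RtoC (/ Kfun al 0 * limit_density al t).
Proof.
intros Hal. rewrite S_fun_real, hyp_solution_Kfun, limit_density_Kfun by lra. f_equal. unfold Rdiv. ring.
Qed.

(** The factor [sqrt PI * Gamma ((al - 1) / 2)] cancels between [Kfun al 0] and [c_const al], and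
    the two factors 2 combine with [2^al] to [2^(al - 2)]. *)
Lemma constant_identity al : 2 <= al ->
  - Kfun al 0 / c_const al = Gamma (al / 2) * Gamma al / (Rpower 2 (2 - al) * PI * Gamma (3 * al / 2 - 1)).
Proof.
intros Hal. destruct (kconst_K al Hal) as (_ & _ & ->).
pose proof PI_RGT_0 as Hpi. assert (Ps : 0 < sqrt PI) by now apply sqrt_lt_R0.
pose proof (Gamma_pos ((al - 1) / 2) ltac:(lra)). pose proof (Gamma_pos (al / 2) ltac:(lra)).
pose proof (Gamma_pos al ltac:(lra)). pose proof (Gamma_pos (3 * al / 2 - 1) ltac:(lra)).
assert (P2 := Rpower_pos 2 al).
unfold c_const.
replace (Rpower PI (3 / 2)) with (PI * sqrt PI).
2:{ rewrite <- Rpower_sqrt by lra. rewrite <- (Rpower_1 PI) at 1 by lra. rewrite <- Rpower_plus. f_equal; field. }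
replace (Rpower 2 (2 - al)) with (4 / Rpower 2 al).
2:{ unfold Rminus. rewrite Rpower_plus, Rpower_Ropp, Rpower_sqr by lra. field. lra. }
field. repeat split; lra.
Qed.

Theorem corollary2p4 (kappa alpha : R) (s : C -> R -> R)
  (hkappa : 0 < kappa <= 4) (halpha : alpha = 8 / kappa)
  (hs : right_crossing s) :
  (forall t : R, Im (S_fun alpha t) = 0) /\
  (forall x y : R, 0 < y ->
    filterlim (fun xi => P alpha s (x, y) xi) (at_right 0)
      (locally
        (Gamma (alpha / 2) * Gamma alpha
         / (Rpower 2 (2 - alpha) * PI * Gamma (3 * alpha / 2 - 1))
         * RInt_gen (fun t' => Re (S_fun alpha t'))
             (at_point (x / y)) (Rbar_locally p_infty)))).
Proof.
(* The bound on [kappa] enters here: it makes the exponent [alpha - 2] at the ends of the contour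
   nonnegative. *)
assert (Hal : 2 <= alpha).
{ rewrite halpha. apply Rmult_le_reg_r with kappa. lra. unfold Rdiv. rewrite Rmult_assoc, Rinv_l by lra. lra. }
split.
- intros t. rewrite S_fun_limit_density by assumption. reflexivity.
- intros x y Hy.
  destruct (P_limit_density alpha s x y Hal hs Hy) as (L & HL & Hlim).
  destruct (kconst_K alpha Hal) as (_ & PK & _).
  assert (I : is_RInt_gen (fun t' => Re (S_fun alpha t')) (at_point (x / y)) (Rbar_locally p_infty) (/ Kfun alpha 0 * L)).
  { apply is_RInt_gen_ext with (fun t => scal (/ Kfun alpha 0) (limit_density alpha t)).
    - apply filter_forall. intros p t _. rewrite S_fun_limit_density by assumption. reflexivity.
    - apply (is_RInt_gen_scal (V := R_NormedModule)). exact HL. }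
  assert (E : RInt_gen (fun t' => Re (S_fun alpha t')) (at_point (x / y)) (Rbar_locally p_infty) = / Kfun alpha 0 * L).
  { exact (is_RInt_gen_unique (V := R_CompleteNormedModule) _ _ I). }
  rewrite E, <- constant_identity by assumption.
  replace (- Kfun alpha 0 / c_const alpha * (/ Kfun alpha 0 * L)) with (/ c_const alpha * - L). exact Hlim.
  unfold Rdiv.
  transitivity (/ c_const alpha * - L * (Kfun alpha 0 * / Kfun alpha 0)). rewrite Rinv_r by lra. ring. ring.
Qed.
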